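(* Let $p$ be a prime, $n,r,d$ integers with $p>d\ge1$, let $U\subseteq\mathbb{F}_p^n$ be nonempty and closed under shifts to zero, and let $X\subseteq\mathbb{A}^n$ be an absolutely irreducible $\mathbb{F}_p$-variety of dimension $r$ and degree $d$ which is not $(U-U)$-shift-free. Put $$\alpha=d^2+\big(5d^{13/3}+d^2\,\#(U-U)\big)p^{-1/2}$$ and assume $p\ge4\alpha^2$. Then $\Delta\ge p^r/2$.
   Context: $\overline{\mathbb{F}_p}$ is an algebraic closure of $\mathbb{F}_p$ and $\mathbb{A}^n=\overline{\mathbb{F}_p}^{\,n}$. An $\mathbb{F}_p$-variety is the common zero set in $\mathbb{A}^n$ of polynomials in $\mathbb{F}_p[x_1,\dots,x_n]$; $X(\mathbb{F}_p)=X\cap\mathbb{F}_p^n$. The degree of an absolutely irreducible variety $X$ is the maximum number of points in $X\cap L$ over affine linear subspaces $L$ of codimension $\dim X$ with $X\cap L$ finite. For $u\in\mathbb{A}^n$, $X^{(u)}=\{a+u:a\in X\}$. For absolutely irreducible $X$ and $V\subseteq\mathbb{F}_p^n$, $X$ is $V$-shift-free if $X\neq X^{(u)}$ for every nonzero $u\in V$. $U$ is closed under shifts to zero if for every $u\in U$ and every coordinate index $i$, the vector obtained from $u$ by replacing its $i$-th coordinate with $0$ lies in $U$. $U-U=\{v-w:v,w\in U\}$, $X(\mathbb{F}_p)+U=\{a+u:a\in X(\mathbb{F}_p),u\in U\}$, and $\Delta=\#X(\mathbb{F}_p)\cdot\#U-\#(X(\mathbb{F}_p)+U)$. *)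

(* Defs.v *)
From Stdlib Require Import Reals.
From HB Require Import structures.
From mathcomp Require Import all_boot all_order all_algebra all_field.

Set Implicit Arguments.
Unset Strict Implicit.
Unset Printing Implicit Defensive.

Import GRing.Theory.
Local Open Scope ring_scope.

Definition mpoly (R : Type) (n : nat) := seq (R * {ffun 'I_n -> nat}).

Definition meval (R : Type) (K : nzRingType) (n : nat) (f : R -> K)
    (P : mpoly R n) (x : 'rV[K]_n) : K :=
  \sum_(m <- P) (f m.1 * \prod_(i < n) x 0 i ^+ m.2 i).

(* The standard embedding of F_p into a field K of characteristic p. *)
Definition embFp (p : nat) (K : nzRingType) (c : 'F_p) : K := (nat_of_ord c)%:R.

Definition embv (p : nat) (K : nzRingType) (n : nat) (a : 'rV['F_p]_n) : 'rV[K]_n :=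
  map_mx (@embFp p K) a.

Definition variety (p : nat) (K : nzRingType) (n : nat) (S : seq (mpoly 'F_p n))
    (x : 'rV[K]_n) : bool :=
  all (fun P => meval (@embFp p K) P x == 0) S.

Definition Zclosed (K : nzRingType) (n : nat) (Z : 'rV[K]_n -> Prop) : Prop :=
  exists T : mpoly K n -> Prop,
    forall x, Z x <-> (forall P, T P -> meval id P x = 0).

(* Irreducible in the Zariski topology of K^n (K algebraically closed:
   absolute irreducibility). *)
Definition irreducible_set (K : nzRingType) (n : nat) (X : 'rV[K]_n -> Prop) : Prop :=
  (exists x, X x) /\
  forall Z1 Z2 : 'rV[K]_n -> Prop, Zclosed Z1 -> Zclosed Z2 ->
    (forall x, X x -> Z1 x \/ Z2 x) ->
    (forall x, X x -> Z1 x) \/ (forall x, X x -> Z2 x).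

Definition abs_irreducible (K : nzRingType) (n : nat) (X : 'rV[K]_n -> Prop) : Prop :=
  Zclosed X /\ irreducible_set X.

Definition has_chain (K : nzRingType) (n : nat) (X : 'rV[K]_n -> Prop) (k : nat) : Prop :=
  exists C : nat -> 'rV[K]_n -> Prop,
    (forall i, (i <= k)%N ->
       [/\ Zclosed (C i), irreducible_set (C i) & forall x, C i x -> X x]) /\
    (forall i, (i < k)%N ->
       (forall x, C i x -> C i.+1 x) /\ (exists x, C i.+1 x /\ ~ C i x)).

Definition var_dim (K : nzRingType) (n : nat) (X : 'rV[K]_n -> Prop) (r : nat) : Prop :=
  has_chain X r /\ ~ has_chain X r.+1.

(* For an affine subspace L = {x | x *m A = b} with rank A = r (i.e. of
   codimension r), X /\ L is finite and listed by s without repetition. *)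
Definition section_listed (K : fieldType) (n r : nat) (X : 'rV[K]_n -> Prop)
    (A : 'M[K]_(n, r)) (b : 'rV[K]_r) (s : seq 'rV[K]_n) : Prop :=
  \rank A = r /\ uniq s /\ (forall x, (X x /\ x *m A = b) <-> x \in s).

Definition var_deg (K : fieldType) (n : nat) (X : 'rV[K]_n -> Prop) (r d : nat) : Prop :=
  (exists A b s, @section_listed K n r X A b s /\ size s = d) /\
  (forall A b s, @section_listed K n r X A b s -> (size s <= d)%N).

Definition shiftv (K : zmodType) (n : nat) (X : 'rV[K]_n -> Prop) (u : 'rV[K]_n)
    : 'rV[K]_n -> Prop := fun x => exists a, X a /\ x = a + u.

Definition shift_free (p : nat) (K : nzRingType) (n : nat) (X : 'rV[K]_n -> Prop)
    (V : {set 'rV['F_p]_n}) : Prop :=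
  forall u, u \in V -> u != 0 -> ~ (forall x, X x <-> shiftv X (embv K u) x).

Definition shift0_closed (p n : nat) (U : {set 'rV['F_p]_n}) : Prop :=
  forall u, u \in U -> forall i : 'I_n,
    (\row_j (if j == i then 0 else u 0 j)) \in U.

Definition setDiff (p n : nat) (U : {set 'rV['F_p]_n}) : {set 'rV['F_p]_n} :=
  [set v - w | v in U, w in U].

Definition Fp_points (p : nat) (K : nzRingType) (n : nat) (S : seq (mpoly 'F_p n))
    : {set 'rV['F_p]_n} :=
  [set a | variety S (embv K a)].

Definition Delta_count (p : nat) (K : nzRingType) (n : nat) (S : seq (mpoly 'F_p n))
    (U : {set 'rV['F_p]_n}) : nat :=
  let XU := [set a + u | a in Fp_points K S, u in U] in
  (#|Fp_points K S| * #|U| - #|XU|)%N.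

Local Close Scope ring_scope.
Local Open Scope R_scope.

Definition alpha_bound (p d N : nat) : R :=
  INR d ^ 2 + (5 * Rpower (INR d) (13 / 3) + INR d ^ 2 * INR N) * Rpower (INR p) (- (1 / 2)).

(* Main.v *)
(* If [X] is invariant under the shift by [u = v - w], then [a + v = (a + u) + w] makes [v] superfluous in
   [X(F_p) + U], so [Delta >= #X(F_p)], and it remains to prove [#X(F_p) >= p^r / 2].
   A linear projection over [F_p] maps [X] to a hypersurface [f(t, T) = 0] of degree [D <= d], monic in [T]; choosing
   the projection with [D] maximal makes it injective outside the discriminant of [f], so that there rational
   points lift to rational points because Frobenius fixes the one-point fibres.
   The hypersurface is cut by the planes over the lines through a rational point [x0] off the discriminant.
   A proper factor of such a section vanishes on the power series root of [f], which is a linear system for its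
   coefficients; the system has only the zero solution on the generic line, hence outside the zeros of a minor.
   On an irreducible section Stepanov's method applies: a function on the square of the curve that vanishes to high
   order along the part of [t = t'] residual to the diagonal is nonzero on the graph of Frobenius and vanishes to high
   order at the points with [t] rational and [T] irrational, so these are too few to exhaust the [D] points
   above each [t]. Averaging over the lines bounds the number of rational points from below. *)

Require Import Defs.
From Stdlib Require Import Reals Lra.
From HB Require Import structures.
From mathcomp Require Import all_boot all_order all_algebra all_field.
From mathcomp Require all_fingroup zify ring generic_quotient ring_quotient fraction mpoly boolp classical_sets.
From Stdlib Require ZArith Lia Classical ClassicalEpsilon.
Import GRing.Theory.
Set Implicit Arguments.
Unset Strict Implicit.

(** The counting in Stepanov's method has no room to spare. On a curve of degree [k + 1] there are
    about [m1 (k + 1) ^ 2 l] auxiliary functions; vanishing to order [M], imposed naively, costs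
    about [m1 (k + 1) ^ 2 M] conditions. Then [M] is about [l], and the degree of the norm, about
    [(k + 1) l p], bounds the irrational points by [(k + 1) p], which is trivial. Multiples of the
    [M]-th power of the residual equation satisfy the conditions in advance. They lower the rank by
    a factor [k / (k + 1)], so that [M] rises to about [l (k + 1) / k] and the bound falls to about
    [k p]. Since only half of [p ^ r] is required, [(k + 9/20) p] is good enough: a line keeps about
    [11/20 p] rational points, and the surplus [1/20] pays for the base point, the discriminant and
    the reducible sections. All this fits under [21 d ^ 4 <= p], available for [d >= 2]. A model of
    degree one is a graph and is counted directly. *)

(** * Integer inequalities behind the choice of Stepanov's parameters *)

Module IntegerEstimates.
Import ZArith Lia.
Local Open Scope Z_scope.

(** The expression is [c (k + 1) (2 l + 2 - k) - 2 k (20 (1 + (k + 1) l) + c)] with [c = 20 k + 9]: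
    up to a positive factor, the coefficient of [m] in [stepanov_parameters] when [M] is largest.
    The coefficient [18 (k + 1)] of [l] comes entirely from the 9 in [c], that is, from the margin
    9/20. *)
Lemma cubic_weight_pos k l : 1 <= k -> 16 * (k + 1) * (k + 1) <= 7 * (l + 1) ->
  0 < 18 * (k + 1) * l - (20 * k * k * k + 29 * k * k + 9 * k - 18).
Proof.
intros hk hl.
assert (E : 0 <= (k + 1) * (7 * (l + 1) - 16 * (k + 1) * (k + 1))) by (apply Z.mul_nonneg_nonneg; lia).
assert (0 <= (k - 1) * (k - 1) * (k - 1)) by (repeat apply Z.mul_nonneg_nonneg; lia).
assert (0 <= (k - 1) * (k - 1)) by (repeat apply Z.mul_nonneg_nonneg; lia).
lia.
Qed.

(* In terms of [z = k - 1] and [y = 7 (l + 1) - 16 (k + 1) ^ 2] the difference of the two sides has nonnegative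
   coefficients; [16 / 7] is just below [sqrt 21 / 2]. *)
Lemma parameter_inequality k l : 1 <= k -> 16 * (k + 1) * (k + 1) <= 7 * (l + 1) ->
  2 * k * (k + 1) * (20 * (1 + (k + 1) * l) + 20 * k + 9) * ((20 * k + 9) * (l + 1) + (20 * (1 + (k + 1) * l) + 20 * k + 9)) <
  (4 * l * l - (k + 1) * k) * (20 * k + 9) * (18 * (k + 1) * l - (20 * k * k * k + 29 * k * k + 9 * k - 18)).
Proof.
intros hk hl.
set (z := k - 1); set (y := 7 * (l + 1) - 16 * (k + 1) * (k + 1)).
assert (hz : 0 <= z) by (unfold z; lia).
assert (hy : 0 <= y) by (unfold y; lia).
assert (E : 343 * ((4 * l * l - (k + 1) * k) * (20 * k + 9) * (18 * (k + 1) * l - (20 * k * k * k + 29 * k * k + 9 * k - 18)) -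
   2 * k * (k + 1) * (20 * (1 + (k + 1) * l) + 20 * k + 9) * ((20 * k + 9) * (l + 1) + (20 * (1 + (k + 1) * l) + 20 * k + 9))) =
  333846748 + 26814324 * y + 604336 * y * y + 4176 * y * y * y + 1374934060 * z + 85280850 * z * y + 1326436 * z * y * y + 4968 * z * y * y * y + 2426599721 * z * z + 111139812 * z * z * y + 1070956 * z * z * y * y + 1440 * z * z * y * y * y + 2376742200 * z * z * z + 75483414 * z * z * z * y + 373544 * z * z * z * y * y + 1395845031 * z * z * z * z + 27930904 * z * z * z * z * y + 46720 * z * z * z * z * y * y + 493106488 * z * z * z * z * z + 5270784 * z * z * z * z * z * y + 98221424 * z * z * z * z * z * z + 389120 * z * z * z * z * z * z * y + 9054208 * z * z * z * z * z * z * z + 163840 * z * z * z * z * z * z * z * z) by (unfold z, y; ring).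
assert (P : forall a b, 0 <= a -> 0 <= b -> 0 <= a * b) by (intros; apply Z.mul_nonneg_nonneg; assumption).
apply Z.lt_0_sub; apply (Z.mul_pos_cancel_l 343); [reflexivity|]; rewrite E; clear E hk hl; clearbody z y.
repeat apply Z.add_pos_nonneg; [reflexivity | repeat apply P; try assumption; discriminate ..].
Qed.

(** With [c = 20 k + 9], [M c] is at most [20 (1 + (k + 1) l) + c] and [m (k + 1)] is at least
    [4 l ^ 2 - k (k + 1)]. The inequality gets harder as [M] grows and, the coefficient of [m] being
    positive, as [m] shrinks; at the extreme values it is [parameter_inequality]. *)
Lemma stepanov_parameters k l m M p : 1 <= k -> 16 * (k + 1) * (k + 1) <= 7 * (l + 1) -> 4 * l * l <= p ->
  p <= (k + 1) * (m + k) -> 0 <= M -> M * (20 * k + 9) <= 20 * (1 + (k + 1) * l) + 20 * k + 9 ->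
  2 * M * k * (m + l + 1 + M) < m * (k + 1) * (2 * l + 2 - k).
Proof.
intros hk hl hp hm hM hc.
assert (P : forall a b, 0 <= a -> 0 <= b -> 0 <= a * b) by (intros; apply Z.mul_nonneg_nonneg; assumption).
assert (hkl : (k + 1) * (k + 1) <= l) by (assert (4 <= (k + 1) * (k + 1)) by (clear - hk; nia); lia).
assert (hkk : k * (k + 1) <= l) by (clear - hkl hk; nia).
assert (hl0 : 1 <= l) by (clear - hkl hk; nia).
pose proof (cubic_weight_pos hk hl) as hW; pose proof (parameter_inequality hk hl) as key.
set (W := 18 * (k + 1) * l - _) in *.
assert (EE : (20 * k + 9) * ((k + 1) * (2 * l + 2 - k)) - 2 * k * (20 * (1 + (k + 1) * l) + 20 * k + 9) = W) by (unfold W; ring).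
assert (hMb : 0 <= 20 * (1 + (k + 1) * l) + 20 * k + 9) by (assert (0 <= (k + 1) * l) by (apply P; lia); lia).
set (Mb := 20 * (1 + (k + 1) * l) + 20 * k + 9) in *; clearbody Mb W.
assert (hA : 4 * l * l - (k + 1) * k <= m * (k + 1)) by lia.
assert (hA0 : 0 <= m * (k + 1)) by (apply Z.le_trans with (2 := hA); clear - hkk hl0; nia).
set (c := 20 * k + 9) in *; assert (hc0 : 0 < c) by (unfold c; lia); clearbody c.
assert (hMc : 0 <= M * c) by (apply P; lia).
assert (E : W <= c * ((k + 1) * (2 * l + 2 - k)) - 2 * k * (M * c)).
  { rewrite <- EE; apply Z.sub_le_mono_l; apply Z.mul_le_mono_nonneg_l; lia. }
assert (hcl : 0 <= c * (l + 1)) by (apply P; lia).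
assert (h1 : 2 * k * (k + 1) * (M * c) * (c * (l + 1) + M * c) <= 2 * k * (k + 1) * Mb * (c * (l + 1) + Mb)).
  { assert (0 <= 2 * k * (k + 1)) by (repeat apply P; lia).
    apply Z.mul_le_mono_nonneg; [apply P; assumption | | lia | lia].
    apply Z.mul_le_mono_nonneg_l; assumption. }
assert (h2 : (4 * l * l - (k + 1) * k) * c * W <= m * (k + 1) * c * W).
  { apply Z.mul_le_mono_nonneg_r; [lia|]; apply Z.mul_le_mono_nonneg_r; lia. }
assert (h3 : m * (k + 1) * c * W <= m * (k + 1) * c * (c * ((k + 1) * (2 * l + 2 - k)) - 2 * k * (M * c))).
  { apply Z.mul_le_mono_nonneg_l; [apply P; lia | exact E]. }
assert (h4 : 0 < (c * c * (k + 1)) * (m * (k + 1) * (2 * l + 2 - k) - 2 * M * k * (m + l + 1 + M))).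
  { replace ((c * c * (k + 1)) * (m * (k + 1) * (2 * l + 2 - k) - 2 * M * k * (m + l + 1 + M))) with
      (m * (k + 1) * c * (c * ((k + 1) * (2 * l + 2 - k)) - 2 * k * (M * c)) -
       2 * k * (k + 1) * (M * c) * (c * (l + 1) + M * c)) by ring.
    apply Z.lt_0_sub; apply Z.le_lt_trans with (1 := h1); apply Z.lt_le_trans with (1 := key).
    apply Z.le_trans with (1 := h2); exact h3. }
apply Z.mul_pos_cancel_l in h4; [lia | ].
apply Z.mul_pos_pos; [apply Z.mul_pos_pos|]; lia.
Qed.

End IntegerEstimates.

(** * Consequences of [p >= 4 alpha ^ 2] *)

Module RealEstimates.
Local Open Scope R_scope.

Lemma Rpower_third_ge (D c : R) : 0 < c -> c ^ 3 <= D -> c <= Rpower D (1 / 3).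
Proof.
intros hc hD; assert (0 < c ^ 3) by (apply pow_lt; assumption).
assert (E : Rpower (c ^ 3) (1 / 3) = c).
{ rewrite <- (Rpower_pow 3 c hc), Rpower_mult.
  replace (INR 3 * (1 / 3)) with 1 by (simpl; field). apply Rpower_1; assumption. }
rewrite <- E at 1; apply Rle_Rpower_l; lra.
Qed.

(** The bound [2 alpha <= s] is multiplied by [s], which clears [p ^ (-1/2)]; splitting 13/3 as 4 +
    1/3 leaves only a cube root of [d] to be bounded from below. *)
Lemma alpha_bound_inv (p d N : nat) : (0 < p)%N -> (0 < d)%N -> 4 * Rsqr (alpha_bound p d N) <= INR p ->
  let s := sqrt (INR p) in let q := Rpower (INR d) (1 / 3) in
  2 * INR d ^ 2 * s + 10 * (INR d ^ 4 * q) <= s * s.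
Proof.
intros hp hd h s q.
assert (P0 : 0 < INR p) by (apply lt_0_INR; apply /ltP; assumption).
assert (D1 : 1 <= INR d) by (apply (le_INR 1); apply /leP; assumption).
assert (s0 : 0 < s) by (apply sqrt_lt_R0; assumption).
assert (ss : s * s = INR p) by (apply sqrt_sqrt; lra).
assert (q0 : 0 < q) by apply exp_pos.
assert (E1 : Rpower (INR p) (- (1 / 2)) = / s).
{ rewrite Rpower_Ropp; f_equal. unfold Rdiv; rewrite Rmult_1_l. apply Rpower_sqrt; assumption. }
assert (E2 : Rpower (INR d) (13 / 3) = INR d ^ 4 * q).
{ assert (D0 : 0 < INR d) by lra. rewrite <- (Rpower_pow 4 (INR d) D0); unfold q; rewrite <- Rpower_plus; f_equal; simpl; field. }
unfold alpha_bound in h; rewrite E1 E2 in h.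
set (a := INR d ^ 2 + _ * / s) in h.
assert (d4 : 0 < INR d ^ 4) by (apply pow_lt; lra).
assert (d2 : 0 < INR d ^ 2) by (apply pow_lt; lra).
assert (N0 : 0 <= INR N) by apply pos_INR.
assert (a1 : a * s = INR d ^ 2 * s + 5 * (INR d ^ 4 * q) + INR d ^ 2 * INR N) by (unfold a; field; lra).
assert (x0 : 0 <= INR d ^ 2 * INR N) by (apply Rmult_le_pos; lra).
assert (x1 : 0 < INR d ^ 4 * q) by (apply Rmult_lt_0_compat; assumption).
assert (x2 : 0 < INR d ^ 2 * s) by (apply Rmult_lt_0_compat; assumption).
assert (a0 : 0 < a) by (apply (Rmult_lt_reg_r s); lra).
assert (as2 : 2 * a <= s) by (apply Rsqr_incr_0; unfold Rsqr in *; lra).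
assert (2 * a * s <= s * s) by (apply Rmult_le_compat_r; lra).
lra.
Qed.

(* With [s = sqrt p], the bound [s ^ 2 >= 2 d ^ 2 s + 10 d ^ (13 / 3)] and [2 ^ (1 / 3) >= 5 / 4] give [s >= 4.6 d ^ 2]. *)
Lemma alpha_bound_large (p d N : nat) : (0 < p)%N -> (0 < d)%N -> 4 * Rsqr (alpha_bound p d N) <= INR p ->
  (10 * (d * d * (d * d)) <= p)%N /\ ((1 < d)%N -> (21 * (d * d * (d * d)) <= p)%N).
Proof.
intros hp hd h; generalize (alpha_bound_inv hp hd h); cbv zeta.
assert (P0 : 0 < INR p) by (apply lt_0_INR; apply /ltP; assumption).
assert (D1 : 1 <= INR d) by (apply (le_INR 1); apply /leP; assumption).
set (s := sqrt _); set (q := Rpower _ _); intros hs.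
assert (s0 : 0 < s) by (apply sqrt_lt_R0; assumption).
assert (ss : s * s = INR p) by (apply sqrt_sqrt; lra).
assert (E : INR (d * d * (d * d)) = INR d ^ 4) by (rewrite !mult_INR; ring).
assert (d4 : 0 < INR d ^ 4) by (apply pow_lt; lra).
assert (d2 : 0 < INR d ^ 2) by (apply pow_lt; lra).
assert (sq : INR d ^ 4 = INR d ^ 2 * INR d ^ 2) by ring.
assert (x2 : 0 < INR d ^ 2 * s) by (apply Rmult_lt_0_compat; assumption).
split; [| intros hd2]; apply /leP; apply INR_le; rewrite mult_INR E (INR_IZR_INZ _); simpl Z.of_nat.
- assert (q1 : 1 <= q) by (apply Rpower_third_ge; lra).
  assert (INR d ^ 4 * 1 <= INR d ^ 4 * q) by (apply Rmult_le_compat_l; lra). lra.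
- assert (D2 : 2 <= INR d) by (apply (le_INR 2); apply /leP; assumption).
  assert (q1 : 5 / 4 <= q) by (apply Rpower_third_ge; lra).
  assert (INR d ^ 4 * (5 / 4) <= INR d ^ 4 * q) by (apply Rmult_le_compat_l; lra).
  rewrite <- ss; destruct (Rle_or_lt (21 * INR d ^ 4) (s * s)) as [|lt]; [assumption|exfalso].
  rewrite sq in lt, H, hs; set (u := INR d ^ 2) in *.
  (* The number 4.6 has square 21.16, above 21, and lies below the positive root [1 + sqrt 13.5] of
     [x ^ 2 = 2 x + 12.5]; so [s < 4.6 u] contradicts [hs]. *)
  assert (s < 46 / 10 * u) by (apply Rsqr_incrst_0; unfold Rsqr; nra).
  nra.
Qed.

End RealEstimates.

Module PointCount.
Import all_fingroup all_algebra all_field zify ring generic_quotient ring_quotient fraction mpoly Classical ClassicalEpsilon.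
Import GRing.Theory Pdiv.CommonRing Pdiv.RingMonic.
Import IntegerEstimates RealEstimates.
Unset Printing Implicit Defensive.
Local Open Scope ring_scope.

(** * Norms in [R[T]/(f)] *)

Section MulMx.
Variables (R : comNzRingType) (n : nat) (f : {poly R}).

(* Rows are the coordinates of [X^i g mod f], so coordinate row vectors are multiplied on the right. *)
Definition mulmodmx (g : {poly R}) : 'M[R]_n.+1 :=
  \matrix_(i, j) (rmodp ('X^i * g) f)`_j.

Hypotheses (mf : f \is monic) (sf : size f = n.+2).

Let f0 : f != 0. Proof. exact: monic_neq0. Qed.

Lemma size_rmodf (g : {poly R}) : (size (rmodp g f) <= n.+1)%N.
Proof. by rewrite -ltnS -sf ltn_rmodpN0. Qed.

Lemma rmodf_small (g : {poly R}) : (size g <= n.+1)%N -> rmodp g f = g.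
Proof. by move=> sg; rewrite rmodp_small // sf ltnS. Qed.

Lemma mulmodmxP (u : 'rV_n.+1) g :
  u *m mulmodmx g = poly_rV (rmodp (rVpoly u * g) f).
Proof.
have -> : rVpoly u = \sum_i u 0 i *: 'X^i.
  by rewrite {1}(row_sum_delta u) linear_sum; apply: eq_bigr => i _; rewrite linearZ /= rVpoly_delta.
apply/rowP=> j; rewrite !mxE mulr_suml rmodp_sum // coef_sum.
by apply: eq_bigr => i _; rewrite !mxE -scalerAl rmodpZ // coefZ.
Qed.

Lemma mulmodmx_is_zmod_morphism : zmod_morphism mulmodmx.
Proof. by move=> g h; apply/matrixP=> i j; rewrite !mxE mulrBr rmodpB // coefB. Qed.

Lemma mulmodmx_is_monoid_morphism : monoid_morphism mulmodmx.
Proof.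
split.
  apply/matrixP=> i j; rewrite !mxE mulr1 rmodf_small ?coefXn ?size_polyXn //.
  by rewrite eq_sym.
move=> g h; apply/row_matrixP => i; rewrite row_mul mulmodmxP.
apply/rowP=> j; rewrite !mxE.
have -> : rVpoly (row i (mulmodmx g)) = rmodp ('X^i * g) f.
  rewrite -[RHS](@poly_rV_K _ n.+1) ?size_rmodf //; congr rVpoly.
  by apply/rowP=> k; rewrite !mxE.
by rewrite [rmodp _ _ * h]mulrC rmodp_mulmr // mulrA [h * _]mulrC.
Qed.

Definition mulmod : {rmorphism {poly R} -> 'M[R]_n.+1} :=
  HB.pack mulmodmx
    (GRing.isZmodMorphism.Build _ _ _ mulmodmx_is_zmod_morphism)
    (GRing.isMonoidMorphism.Build _ _ _ mulmodmx_is_monoid_morphism).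

Lemma mulmodE g : mulmod g = mulmodmx g. Proof. by []. Qed.

Lemma mulmodmxM g h : mulmodmx (g * h) = mulmodmx g * mulmodmx h.
Proof. exact: (rmorphM mulmod). Qed.

Lemma mulmodmxXn g k : mulmodmx (g ^+ k) = mulmodmx g ^+ k.
Proof. exact: (rmorphXn mulmod). Qed.

Lemma mulmodmxD g h : mulmodmx (g + h) = mulmodmx g + mulmodmx h.
Proof. exact: (rmorphD mulmod). Qed.

Lemma mulmodmxB g h : mulmodmx (g - h) = mulmodmx g - mulmodmx h.
Proof. exact: (rmorphB mulmod). Qed.

Lemma mulmodmx_sum (I : Type) (r : seq I) (P : pred I) (F : I -> {poly R}) :
  mulmodmx (\sum_(i <- r | P i) F i) = \sum_(i <- r | P i) mulmodmx (F i).
Proof. exact: (rmorph_sum mulmod). Qed.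

Lemma mulmodmxC c : mulmodmx c%:P = c%:M.
Proof.
apply/matrixP=> i j; rewrite !mxE mulrC mul_polyC rmodpZ // rmodf_small ?size_polyXn //.
by rewrite coefZ coefXn mulr_natr eq_sym.
Qed.

Lemma mulmodmx_mod g : mulmodmx (rmodp g f) = mulmodmx g.
Proof. by apply/matrixP=> i j; rewrite !mxE rmodp_mulmr. Qed.

Lemma mulmodmx_eq0 g : mulmodmx g = 0 -> rmodp g f = 0.
Proof.
move=> g0; apply/polyP=> k; rewrite coef0.
have [kn|kn] := ltnP k n.+1; last by rewrite nth_default // (leq_trans (size_rmodf _)).
by move/matrixP/(_ 0 (Ordinal kn)): g0; rewrite !mxE expr0 mul1r.
Qed.

End MulMx.

Section MulMxMorph.
Variables (R : comNzRingType) (n : nat) (f : {poly R}).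
Hypotheses (mf : f \is monic) (sf : size f = n.+2).

(** Evaluation at a root [b] of [f] kills the multiple of [f] removed by the reduction, so the
    values of [g] at the roots of [f] are eigenvalues of its matrix, with the powers of the root as
    eigenvector. *)
Lemma mulmodmx_eigen (S : comNzRingType) (phi : {rmorphism R -> S}) (b : S) g :
  (map_poly phi f).[b] = 0 ->
  map_mx phi (mulmodmx n f g) *m (\col_i b ^+ i) = (map_poly phi g).[b] *: \col_i b ^+ i.
Proof.
move=> fb; apply/colP=> i; rewrite !mxE.
have := rdivp_eq mf ('X^i * g); set q := rdivp _ _; set r := rmodp _ _ => E.
have := congr1 (fun h => (map_poly phi h).[b]) E.
rewrite !rmorphD !rmorphM /= map_polyXn !hornerE fb mulr0 add0r mulrC => ->.
rewrite (@horner_coef_wide _ n.+1); last first.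
  by apply: leq_trans (size_poly _ _) _; apply: size_rmodf.
by apply: eq_bigr => j _; rewrite !mxE coef_map.
Qed.

(* The determinant of multiplication by [g] is the resultant of [f] and [g]; here is its membership
   in the ideal (f, g), evaluated anywhere: [(beta ^ i)] is an eigenvector modulo [f(beta)]. *)
Lemma det_mulmodmx_ideal (S : comNzRingType) (phi : {rmorphism R -> S}) (b : S) g :
  exists a c, phi (\det (mulmodmx n f g)) =
    a * (map_poly phi g).[b] + c * (map_poly phi f).[b].
Proof.
set A := mulmodmx n f g.
pose v : 'cV[S]_n.+1 := \col_i b ^+ i.
pose w : 'cV[S]_n.+1 := \col_i (map_poly phi (rdivp ('X^i * g) f)).[b].
have Av : map_mx phi A *m v = (map_poly phi g).[b] *: v - (map_poly phi f).[b] *: w.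
  apply/colP=> i; rewrite !mxE.
  have := rdivp_eq mf ('X^i * g); set q := rdivp _ _; set r := rmodp _ _ => E.
  have := congr1 (fun h => (map_poly phi h).[b]) E.
  rewrite !rmorphD !rmorphM /= map_polyXn !hornerE => E'.
  have -> : \sum_j (map_mx phi A) i j * v j 0 = (map_poly phi r).[b].
    rewrite (@horner_coef_wide _ n.+1); last first.
      by apply: leq_trans (size_poly _ _) _; apply: size_rmodf.
    by apply: eq_bigr => j _; rewrite !mxE coef_map.
  by rewrite mulrC E' (mulrC _.[b]) addrC addKr.
have := congr1 (fun x : 'cV_n.+1 => x 0 0) (congr1 (mulmx (\adj (map_mx phi A))) Av).
rewrite mulmxA mul_adj_mx mul_scalar_mx !mxE expr0 mulr1 det_map_mx => ->.
exists (\sum_j (\adj (map_mx phi A)) 0 j * v j 0), (- \sum_j (\adj (map_mx phi A)) 0 j * w j 0).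
rewrite mulNr !mulr_suml -sumrB; apply: eq_bigr => j _.
by rewrite !mxE mulrBr !mulrA; congr (_ - _); rewrite mulrAC.
Qed.

End MulMxMorph.

Section MulMxDom.
Variables (R : idomainType) (n : nat) (f : {poly R}).
Hypotheses (mf : f \is monic) (sf : size f = n.+2).

Lemma det_mulmodmx_eq0 g : \det (mulmodmx n f g) = 0 ->
  exists2 h : {poly R}, h != 0 & (size h <= n.+1)%N /\ rmodp (h * g) f = 0.
Proof.
move/eqP/det0P=> [v vn0 v0]; exists (rVpoly v).
  by apply: contraNneq vn0 => v'0; rewrite -(rVpolyK v) v'0 linear0.
split; first exact: size_poly.
move: v0; rewrite mulmodmxP // => v0.
by rewrite -[LHS](@poly_rV_K _ n.+1) ?size_rmodf // v0 linear0.
Qed.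

(* [R[T]/(f)] has no zero divisors *)
Definition domainp := forall g : {poly R}, g != 0 -> (size g <= n.+1)%N -> \det (mulmodmx n f g) != 0.

Lemma domainp_det g : domainp -> rmodp g f != 0 -> \det (mulmodmx n f g) != 0.
Proof. by move=> df gf; rewrite -mulmodmx_mod // df // size_rmodf. Qed.

End MulMxDom.

(** * Total degree in two variables and the degree of norms *)

Section TotalDegree.
Variables (R : comNzRingType).
Implicit Types (g : {poly {poly R}}) (w : nat).

Definition tdeg_le w g := forall k i, (w < i + k)%N -> g`_k`_i = 0.

Lemma tdeg_leW w w' g : (w <= w')%N -> tdeg_le w g -> tdeg_le w' g.
Proof. by move=> ww gw k i ki; apply: gw; apply: leq_ltn_trans ww ki. Qed.

Lemma tdeg_leD w g h : tdeg_le w g -> tdeg_le w h -> tdeg_le w (g + h).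
Proof. by move=> gw hw k i ki; rewrite !coefD gw ?hw ?addr0. Qed.

Lemma tdeg_le0 w : tdeg_le w 0.
Proof. by move=> k i _; rewrite !coef0. Qed.

Lemma tdeg_le_sum (I : Type) (r : seq I) (P : pred I) (F : I -> {poly {poly R}}) w :
  (forall i, P i -> tdeg_le w (F i)) -> tdeg_le w (\sum_(i <- r | P i) F i).
Proof. by move=> H; elim/big_ind: _ => //; [exact: tdeg_le0 | move=> *; exact: tdeg_leD]. Qed.

Lemma tdeg_leM w1 w2 g h : tdeg_le w1 g -> tdeg_le w2 h -> tdeg_le (w1 + w2) (g * h).
Proof.
move=> gw hw k i ki; rewrite coefM coef_sum big1 // => -[a /= ak] _.
rewrite coefM big1 // => -[b /= bi] _.
have [lt|le] := ltnP w1 (b + a); first by rewrite gw ?mul0r.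
by rewrite hw ?mulr0 //; lia.
Qed.

Variables (n : nat) (f : {poly {poly R}}).
Hypotheses (mf : f \is monic) (sf : size f = n.+2).

(** The coordinate at [T ^ j] of the image of [T ^ i] has degree at most [w + i - j] in [t], as
    multiplication by an element of total degree [w] requires; an entry with [j > w + i] is zero. *)
Definition mxwt_le w (A : 'M[{poly R}]_n.+1) :=
  forall (i j : 'I_n.+1) k, (w + i < k + j)%N -> (A i j)`_k = 0.

Lemma mxwt_leM w1 w2 A B : mxwt_le w1 A -> mxwt_le w2 B -> mxwt_le (w1 + w2) (A *m B).
Proof.
move=> Aw Bw i j k ki; rewrite mxE coef_sum big1 // => l _.
rewrite coefM big1 // => -[b /= bk] _.
have [lt|le] := ltnP (w1 + i) (b + l); first by rewrite Aw ?mul0r.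
by rewrite Bw ?mulr0 //; lia.
Qed.

Lemma mxwt_leD w A B : mxwt_le w A -> mxwt_le w B -> mxwt_le w (A + B).
Proof. by move=> Aw Bw i j k ki; rewrite mxE coefD Aw ?Bw ?addr0. Qed.

Lemma mxwt_le_sum (I : Type) (r : seq I) (P : pred I) (F : I -> 'M[{poly R}]_n.+1) w :
  (forall i, P i -> mxwt_le w (F i)) -> mxwt_le w (\sum_(i <- r | P i) F i).
Proof.
move=> H; elim/big_ind: _ => //; last by move=> *; exact: mxwt_leD.
by move=> i j k _; rewrite mxE coef0.
Qed.

Lemma mxwt_scalar w (c : {poly R}) : (size c <= w.+1)%N -> mxwt_le w (c%:M).
Proof.
move=> sc i j k wk; rewrite mxE; case: eqVneq => [E|_]; last by rewrite mulr0n coef0.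
by rewrite mulr1n nth_default //; apply: leq_trans sc _; move: wk; rewrite E ltn_add2r.
Qed.

Hypothesis tf : tdeg_le n.+1 f.

Lemma mxwt_mulmodmxX : mxwt_le 1 (mulmodmx n f 'X).
Proof.
move=> i j k ki; rewrite mxE -exprSr.
have [lt|] := ltnP i n; first rewrite (rmodf_small sf) ?size_polyXn //.
  by rewrite coefXn; case: eqP => [E|_]; rewrite ?coef0 // coef1; case: eqP => // k0; lia.
move=> le; have -> : (i.+1 = n.+1)%N by case: i le ki => /= i; lia.
have E : rmodp 'X^(n.+1) f = 'X^(n.+1) - f.
  have -> : 'X^(n.+1) = 1 * f + ('X^(n.+1) - f) by rewrite mul1r addrC subrK.
  rewrite rmodp_addl_mul_small // ?mul1r ?[f + _]addrC ?subrK // sf ltnS.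
  apply/leq_sizeP => j'; rewrite leq_eqVlt => /orP[/eqP <-|lt].
    by rewrite coefB coefXn eqxx; move/monicP: mf; rewrite /lead_coef sf /= => ->; rewrite subrr.
  by rewrite coefB coefXn gtn_eqF // [f`_j']nth_default ?subr0 // sf.
rewrite E !coefB coefXn ltn_eqF ?ltn_ord // coef0 tf ?subr0 //; lia.
Qed.

Lemma mxwt_mulmodmx w g : tdeg_le w g -> mxwt_le w (mulmodmx n f g).
Proof.
move=> gw.
rewrite -[g]coefK poly_def mulmodmx_sum //.
apply: mxwt_le_sum => k _; move: (nat_of_ord k) => {}k; rewrite -mul_polyC mulmodmxM // mulmodmxXn // mulmodmxC //.
have [le|lt] := leqP k w; last first.
  have -> : g`_k = 0 by apply/polyP=> i; rewrite coef0 gw //; lia.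
  by rewrite -[_ * _]/(_ *m _) raddf0 mul0mx => i j l _; rewrite mxE coef0.
rewrite -(subnK le); apply: mxwt_leM.
  by apply: mxwt_scalar; apply/leq_sizeP => j kj; apply: gw; lia.
elim: {le} k => [|k IH]; first by rewrite expr0; apply: mxwt_scalar; rewrite size_poly1.
by rewrite exprSr -addn1; apply: mxwt_leM => //; exact: mxwt_mulmodmxX.
Qed.

(** In each term of the Leibniz expansion the shifts [i - s i] cancel because [s] is a permutation,
    and only [n.+1] contributions of [w] remain. *)
Lemma size_det_mxwt w A : mxwt_le w A -> (size (\det A) <= (n.+1 * w).+1)%N.
Proof.
move=> Aw; apply: (big_ind (fun p : {poly R} => size p <= (n.+1 * w).+1)%N); first by rewrite size_poly0.
  by move=> p q sp sq; apply: leq_trans (size_polyD _ _) _; rewrite geq_max sp.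
move=> s0 _; pose s : {perm 'I_n.+1} := s0; rewrite -[s0]/s mulr_sign.
suff H : (size (\prod_i A i (s i))%R <= (n.+1 * w).+1)%N by case: (odd_perm s); rewrite ?size_polyN.
have [i Ai0|nz] := @pickP 'I_n.+1 (fun i => A i (s i) == 0).
  by rewrite (bigD1 i) //= (eqP Ai0) mul0r size_poly0.
apply: leq_trans (size_prod_leq _ _) _ => /=.
have sA i : (size (A i (s i)) + s i <= (w + i).+1)%N.
  have := nz i; rewrite -size_poly_eq0 => sz; rewrite leqNgt; apply/negP => lt.
  have: lead_coef (A i (s i)) = 0 by rewrite /lead_coef Aw //; move: sz lt; clear; lia.
  by move/eqP; rewrite lead_coef_eq0 nz.
have: (\sum_(i < n.+1) (size (A i (s i)) + s i) <= \sum_(i < n.+1) (w + i).+1)%N.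
  by apply: leq_sum => i _; exact: sA.
rewrite big_split /=.
have -> : (\sum_(i < n.+1) s i = \sum_(i < n.+1) i)%N by rewrite [RHS](reindex_inj (@perm_inj _ s)).
have -> : (\sum_(i < n.+1) (w + i).+1 = n.+1 * w + \sum_(i < n.+1) i + n.+1)%N.
  under eq_bigr do rewrite -addn1.
  by rewrite !big_split /= !sum_nat_const !card_ord muln1.
rewrite card_ord.
set X := (\sum_(i < _) (size _))%N; set Y := (\sum_(i < _) _)%N; lia.
Qed.

(** Bezout's bound for the curves [f] and [g] of degrees [n.+1] and [w]. *)
Lemma size_det_mulmodmx w g : tdeg_le w g -> (size (\det (mulmodmx n f g)) <= (n.+1 * w).+1)%N.
Proof. by move=> gw; apply: size_det_mxwt; apply: mxwt_mulmodmx. Qed.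

End TotalDegree.

(** * Stepanov's method on a plane curve *)

Section Shift.
Variable K : comNzRingType.

(* [c(t)] as a polynomial in [eps] over [K[t]], evaluated at [t + eps]; opaque to stop simplification. *)
Fact shift_key : {s : {rmorphism {poly K} -> {poly {poly K}}} |
  forall c, s c = (map_poly (polyC \o polyC) c).['X + 'X%:P]}.
Proof. by exists (horner_eval ('X + ('X : {poly K})%:P) \o map_poly (polyC \o polyC))%FUN. Qed.

Definition shift : {rmorphism {poly K} -> {poly {poly K}}} := sval shift_key.

Lemma shiftE c : shift c = (map_poly (polyC \o polyC) c).['X + 'X%:P].
Proof. exact: (svalP shift_key). Qed.

Lemma shiftC (c : K) : shift c%:P = c%:P%:P.
Proof. by rewrite shiftE map_polyC hornerC. Qed.

Lemma shiftX : shift 'X = 'X + 'X%:P.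
Proof. by rewrite shiftE map_polyX hornerX. Qed.

Lemma rmorph_shift_horner (S : comNzRingType) (phi : {rmorphism {poly {poly K}} -> S}) (c : {poly K}) :
  phi (shift c) = (map_poly (phi \o polyC \o polyC) c).[phi 'X + phi 'X%:P].
Proof. by rewrite shiftE -(horner_map phi) /= rmorphD -map_poly_comp. Qed.

Lemma shift_eps0 c : (shift c).[0] = c.
Proof.
rewrite -[LHS]/(horner_eval 0 (shift c)) rmorph_shift_horner /= /horner_eval hornerX add0r hornerC.
rewrite (eq_map_poly (g := polyC)); last by move=> x; rewrite /= hornerC.
by rewrite -[RHS]comp_polyXr.
Qed.

Lemma tdeg_le_shift w (c : {poly K}) : (size c <= w.+1)%N -> tdeg_le w (shift c).
Proof.
move=> sc; rewrite -[c]coefK poly_def rmorph_sum; apply: tdeg_le_sum => k _.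
rewrite -mul_polyC rmorphM rmorphXn shiftC shiftX.
have [lt|ge] := ltnP w k.
  rewrite nth_default; last by apply: leq_trans sc lt.
  by rewrite mul0r; exact: tdeg_le0.
apply: (@tdeg_leW _ (0 + k)) => //; apply: tdeg_leM.
  by move=> i j ij; rewrite coefC; case: eqP => [i0|_]; rewrite ?coef0 // coefC; case: eqP => // j0; lia.
elim: {ge} (nat_of_ord k) => [|i IH].
  by rewrite expr0 => i j ij; rewrite coef1; case: eqP => [i0|_]; rewrite ?coef0 //= coef1; case: eqP => // j0; lia.
rewrite exprSr -addn1; apply: tdeg_leM => //; apply: tdeg_leD => i' j ij; rewrite ?coefX ?coefC.
  by case: eqP => [i0|_]; rewrite ?coef0 //= coef1; case: eqP => // j0; lia.
by case: eqP => [i0|_]; rewrite ?coef0 // coefX; case: eqP => // j0; lia.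
Qed.

End Shift.

(** * The square of the curve and the residual of the diagonal *)

Section AdMatrix.
Variables (K : comNzRingType) (n : nat) (f : {poly {poly K}}).
Hypotheses (mf : f \is monic) (sf : size f = n.+2).
Hypothesis tf : tdeg_le n.+1 f.

Local Notation sh := (shift K).
Notation Rte := {poly {poly K}}.
Notation mx := 'M[Rte]_n.+1.
Let C := mulmodmx n f 'X.

Lemma mulmodmxX_row (j : 'I_n.+1) : rmodp 'X^(j.+1) f = \sum_(i < n.+1) C j i *: 'X^i.
Proof.
rewrite -[LHS](@poly_rV_K _ n.+1) ?size_rmodf // /rVpoly poly_def.
apply: eq_bigr => i _; rewrite insubT ?ltn_ord //= => Hi; rewrite !mxE -exprSr; congr (_ *: _).
Qed.

(* A matrix [Z] stands for [\sum Z j k T^j T'^k] in the coordinate ring of the square of the curve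
   [f = 0], expanded in [eps = t' - t]: then [T] acts by [adL] on the left and [T'] by [adN] on the right. *)
Definition adL : mx := (map_mx polyC C)^T.
Definition adN : mx := map_mx sh C.
Definition ad (Z : mx) : mx := adL *m Z - Z *m adN.

(* The quotient of [f(t',T') - f(t',T)] by [T' - T]; it cuts out the residual of the diagonal. *)
Definition resid (Z : mx) : mx :=
  \sum_(k < n.+2) sh f`_k *: \sum_(b < k) (adL ^+ (k.-1 - b) *m Z *m adN ^+ b).

Lemma ad_is_zmod : zmod_morphism ad.
Proof. by move=> Y Z; rewrite /ad mulmxBr mulmxBl !opprD !opprK addrACA. Qed.

Lemma ad_scale c Z : ad (c *: Z) = c *: ad Z.
Proof. by rewrite /ad -scalemxAr -scalemxAl scalerBr. Qed.

Lemma resid_is_zmod : zmod_morphism resid.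
Proof.
move=> Y Z; rewrite /resid -sumrB; apply: eq_bigr => k _; rewrite -scalerBr; congr (_ *: _).
by rewrite -sumrB; apply: eq_bigr => b _; rewrite mulmxBr mulmxBl.
Qed.

Lemma resid_scale c Z : resid (c *: Z) = c *: resid Z.
Proof.
rewrite /resid scaler_sumr; apply: eq_bigr => k _; rewrite scalerA mulrC -scalerA; congr (_ *: _).
by rewrite scaler_sumr; apply: eq_bigr => b _; rewrite -scalemxAr -scalemxAl.
Qed.

Lemma adL_resid Z : adL *m resid Z = resid (adL *m Z).
Proof.
rewrite /resid mulmx_sumr; apply: eq_bigr => k _; rewrite -scalemxAr; congr (_ *: _).
rewrite mulmx_sumr; apply: eq_bigr => b _; rewrite !mulmxA; congr (_ *m _ *m _).
by rewrite -[_ *m _]/(_ * _) -exprS exprSr.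
Qed.

Lemma resid_adN Z : resid Z *m adN = resid (Z *m adN).
Proof.
rewrite /resid mulmx_suml; apply: eq_bigr => k _; rewrite -scalemxAl; congr (_ *: _).
rewrite mulmx_suml; apply: eq_bigr => b _; rewrite -!mulmxA; congr (_ *m (_ *m _)).
by rewrite -[LHS]/(_ * _) -exprSr exprS.
Qed.

Lemma ad_resid Z : ad (resid Z) = resid (ad Z).
Proof. by rewrite /ad resid_is_zmod adL_resid resid_adN. Qed.

Lemma iter_ad_resid M Z : ad (iter M resid Z) = iter M resid (ad Z).
Proof. by elim: M => //= M IH; rewrite ad_resid IH. Qed.

(** This is [(f(t', T) - f(t, T)) / eps] at the matrix of [T]; [drop_poly 1] divides by [eps],
    exactly by [shift_gap]. *)
Definition gapmx : mx := \sum_(k < n.+2) drop_poly 1 (sh f`_k - (f`_k)%:P) *: adL ^+ k.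

Lemma mulmodmxX_root : \sum_(k < n.+2) f`_k *: C ^+ k = 0.
Proof.
have := mulmodmx_mod n mf f; rewrite rmodpp // => E.
have : mulmodmx n f f = 0 by rewrite -E; apply/matrixP=> i j; rewrite !mxE mulr0 rmod0p coef0.
have {2}-> : f = \sum_(k < n.+2) f`_k *: 'X^k by rewrite -[LHS]coefK poly_def sf.
rewrite mulmodmx_sum // => E0; rewrite -[RHS]E0; apply: eq_bigr => k _.
by rewrite -mul_polyC mulmodmxM // mulmodmxXn // mulmodmxC // -[RHS]/(_ *m _) mul_scalar_mx.
Qed.

Lemma adL_root : \sum_(k < n.+2) (f`_k)%:P *: adL ^+ k = 0.
Proof.
have := congr1 (fun A : 'M_n.+1 => (map_mx (@polyC _) A)^T) mulmodmxX_root.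
rewrite map_mx0 trmx0 raddf_sum raddf_sum => E0; rewrite -[RHS]E0; apply: eq_bigr => k _.
rewrite /= map_mxZ linearZ /= -[X in map_mx _ X]/(C ^+ k) rmorphXn /=; congr (_ *: _).
by rewrite /adL; elim: (nat_of_ord k) => [|i IH]; rewrite ?expr0 ?trmx1 // exprS exprSr IH -[LHS]/(_ *m _) -trmx_mul.
Qed.

Lemma adN_root : \sum_(k < n.+2) sh f`_k *: adN ^+ k = 0.
Proof.
have := congr1 (map_mx sh) mulmodmxX_root.
rewrite map_mx0 raddf_sum => E0; rewrite -[RHS]E0; apply: eq_bigr => k _.
by rewrite /= map_mxZ -[X in map_mx _ X]/(C ^+ k) rmorphXn.
Qed.

Lemma shift_gap c : sh c - c%:P = drop_poly 1 (sh c - c%:P) * 'X :> Rte.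
Proof.
rewrite -{1}[sh c - _](poly_take_drop 1) expr1 -[RHS]add0r; congr (_ + _).
apply/polyP=> -[|k]; rewrite coef_take_poly coef0 //= coefB coefC /=.
by rewrite -horner_coef0 shift_eps0 subrr.
Qed.

(** Multiplication by [T - T'] telescopes the difference quotient to [f(t', T) - f(t', T')]. The
    second value is zero on the curve, the value [f(t, T) = 0] may be subtracted from the first, and
    the difference is divisible by [eps]. *)
Lemma ad_residE Z : ad (resid Z) = 'X *: (gapmx *m Z).
Proof.
have T k : (adL *m (\sum_(b < k) (adL ^+ (k.-1 - b) *m Z *m adN ^+ b)) -
   (\sum_(b < k) (adL ^+ (k.-1 - b) *m Z *m adN ^+ b)) *m adN) = adL ^+ k *m Z - Z *m adN ^+ k.
  pose F b := adL ^+ (k - b) *m Z *m adN ^+ b.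
  rewrite mulmx_sumr mulmx_suml -sumrB.
  rewrite (eq_bigr (fun b : 'I_k => - (F b.+1 - F b))); last first.
    move=> b _; rewrite opprB; congr (_ - _).
      rewrite /F !mulmxA; congr (_ *m _ *m _); rewrite -[LHS]/(_ * _) -exprS; congr (_ ^+ _).
      by have := ltn_ord b; lia.
    rewrite /F (_ : k - b.+1 = k.-1 - b)%N; last by have := ltn_ord b; lia.
    by rewrite -!mulmxA exprSr.
  rewrite sumrN -(big_mkord xpredT (fun b => F b.+1 - F b)) telescope_sumr // opprB /F subn0 subnn.
  by rewrite !expr0 mul1mx mulmx1.
rewrite /ad /resid mulmx_sumr mulmx_suml -sumrB.
under eq_bigr do rewrite -scalemxAr -scalemxAl -scalerBr T scalerBr.
rewrite sumrB.
under [X in _ - X]eq_bigr do rewrite scalemxAr; rewrite -mulmx_sumr adN_root mulmx0 subr0.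
under eq_bigr do rewrite scalemxAl; rewrite -mulmx_suml scalemxAl; congr (_ *m _).
have -> : \sum_(k < n.+2) sh f`_k *: adL ^+ k =
    \sum_(k < n.+2) sh f`_k *: adL ^+ k - \sum_(k < n.+2) (f`_k)%:P *: adL ^+ k by rewrite adL_root subr0.
rewrite -sumrB scaler_sumr; apply: eq_bigr => k _.
by rewrite -scalerBl {1}shift_gap scalerA mulrC.
Qed.

(** The image of the [M]-th power of the residual thus meets the vanishing condition in advance;
    these known solutions are what lowers the number of independent conditions. *)
Lemma iter_ad_iter_resid M Z : iter M ad (iter M resid Z) = 'X^M *: (gapmx ^+ M *m Z).
Proof.
elim: M Z => [|M IH] Z; first by rewrite /= !expr0 scale1r mul1mx.
rewrite iterSr [iter M.+1 resid Z]iterSr iter_ad_resid ad_residE IH -scalemxAr scalerA -exprSr mulmxA.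
by rewrite -[gapmx ^+ M *m _]/(_ * _) -exprSr.
Qed.

(* Weight of [eps^i t^a T^j T'^k] is [a + i + j + k]. *)
Definition wt_le w (Z : mx) :=
  forall (j k : 'I_n.+1) i a, (w < a + i + j + k)%N -> (Z j k)`_i`_a = 0.

Lemma wt_leD w Y Z : wt_le w Y -> wt_le w Z -> wt_le w (Y + Z).
Proof. by move=> Yw Zw j k i a lt; rewrite mxE !coefD Yw ?Zw ?addr0. Qed.

Lemma wt_le_sum (I : Type) (r : seq I) (P : pred I) (F : I -> mx) w :
  (forall i, P i -> wt_le w (F i)) -> wt_le w (\sum_(i <- r | P i) F i).
Proof.
move=> H; elim/big_ind: _ => //; last by move=> *; exact: wt_leD.
by move=> j k i a _; rewrite mxE !coef0.
Qed.

Lemma wt_leZ w1 w2 c Z : tdeg_le w1 c -> wt_le w2 Z -> wt_le (w1 + w2) (c *: Z).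
Proof.
move=> cw Zw j k i a lt; rewrite mxE coefM coef_sum big1 // => -[x /= xi] _.
rewrite coefM big1 // => -[y /= yi] _.
have [ltx|le] := ltnP w1 (y + x); first by rewrite cw ?mul0r.
by rewrite Zw ?mulr0 //; lia.
Qed.

Lemma wt_le_adL w Z : wt_le w Z -> wt_le w.+1 (adL *m Z).
Proof.
move=> Zw j k i a lt; rewrite mxE coef_sum coef_sum big1 // => l _.
have -> : adL j l = (C l j)%:P by rewrite !mxE.
rewrite coefCM coefM big1 // => -[y /= yi] _.
have [ltx|le] := ltnP (1 + l) (y + j); first by rewrite (mxwt_mulmodmxX mf sf tf) ?mul0r.
by rewrite Zw ?mulr0 //; lia.
Qed.

Lemma wt_le_adN w Z : wt_le w Z -> wt_le w.+1 (Z *m adN).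
Proof.
move=> Zw j k i a lt; rewrite mxE coef_sum coef_sum big1 // => l _.
have -> : adN l k = sh (C l k) by rewrite !mxE.
have Ckl a' : (1 + l < a' + k)%N -> (C l k)`_a' = 0 by move=> ?; rewrite (mxwt_mulmodmxX mf sf tf).
have : forall i' a', (1 + l < a' + i' + k)%N -> (sh (C l k))`_i'`_a' = 0.
  move=> i' a' lt'; have [l0|kl] := ltnP (1 + l) k.
    have -> : C l k = 0 by apply/polyP=> z; rewrite coef0 Ckl //; lia.
    by rewrite rmorph0 !coef0.
  rewrite (@tdeg_le_shift _ (1 + l - k)) //; last by lia.
  by apply/leq_sizeP => z zl; apply: Ckl; lia.
move: (sh (C l k)) => c cw.
rewrite coefM coef_sum big1 // => -[x /= xi] _.
rewrite coefM big1 // => -[y /= yi] _.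
have [ltx|le] := ltnP w (y + x + j + l); first by rewrite Zw ?mul0r.
by rewrite cw ?mulr0 //; lia.
Qed.

(** The residual equation has total degree [n], one less than [f]. *)
Lemma wt_le_resid w Z : wt_le w Z -> wt_le (w + n) (resid Z).
Proof.
move=> Zw; apply: wt_le_sum => k _.
have fk : tdeg_le (n.+1 - k) (sh f`_k).
  by apply: tdeg_le_shift; apply/leq_sizeP => j jk; apply: tf; have := ltn_ord k; move: jk; clear; lia.
have [k0|k0] := posnP k.
  by rewrite k0 big_ord0 scaler0 => j l i a _; rewrite mxE !coef0.
have -> : (w + n = (n.+1 - k) + (w + k.-1))%N by have := ltn_ord k; move: k0; clear; lia.
apply: wt_leZ => //; apply: wt_le_sum => b _.
have -> : (w + k.-1 = w + (k.-1 - b) + b)%N by have := ltn_ord b; move: k0; clear; lia.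
elim: (nat_of_ord b) (_ - _)%N => [|b' IH] i.
  rewrite expr0 mulmx1 addn0; elim: i => [|i IH]; first by rewrite expr0 mul1mx addn0.
  by rewrite exprS -mulmxA addnS; apply: wt_le_adL.
by rewrite exprSr mulmxA addnS; apply: wt_le_adN; exact: IH.
Qed.

Lemma wt_le_iter_resid M w Z : wt_le w Z -> wt_le (w + M * n) (iter M resid Z).
Proof.
elim: M => [|M IH] Zw /=; first by rewrite addn0.
by rewrite mulSn addnA addnAC; apply: wt_le_resid; exact: IH.
Qed.

End AdMatrix.

Section Specialise.
Variables (K : comNzRingType) (n : nat) (f : {poly {poly K}}).
Hypotheses (mf : f \is monic) (sf : size f = n.+2).
Notation Rte := {poly {poly K}}.
Notation mx := 'M[Rte]_n.+1.
Local Notation sh := (shift K).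
Local Notation mm := (mulmodmx n f).
Variables (phi : {rmorphism Rte -> {poly K}}) (e : {poly {poly K}}).
Hypothesis phiC : forall c, phi c%:P = c.

(** The value [e] for [T'] is admissible: with [t'] specialised by [phi], the pair [(t', e)] lies on
    the curve again, modulo [f]. *)
Hypothesis fe : mm ((map_poly (polyC \o phi \o sh) f).[e]) = 0.

(* The specialisation [T' := e], [eps := phi eps]. *)
Definition spec (Z : mx) : {poly {poly K}} :=
  \sum_j \sum_k (phi (Z j k))%:P * 'X^(val j) * e ^+ val k.

Lemma spec_is_zmod : zmod_morphism spec.
Proof.
move=> Y Z; rewrite /spec -sumrB; apply: eq_bigr => j _; rewrite -sumrB; apply: eq_bigr => k _.
by rewrite !mxE rmorphB /= polyCB !mulrBl.
Qed.

Definition spec_additive : {additive mx -> {poly {poly K}}} :=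
  HB.pack spec (GRing.isZmodMorphism.Build _ _ _ spec_is_zmod).

Lemma spec_sum (I : Type) (r : seq I) (P : pred I) (F : I -> mx) :
  spec (\sum_(i <- r | P i) F i) = \sum_(i <- r | P i) spec (F i).
Proof. exact: (raddf_sum spec_additive). Qed.

Lemma specZ c Z : spec (c *: Z) = (phi c)%:P * spec Z.
Proof.
rewrite /spec mulr_sumr; apply: eq_bigr => j _; rewrite mulr_sumr; apply: eq_bigr => k _.
by rewrite !mxE rmorphM /= polyCM !mulrA.
Qed.

Lemma spec_adL Z : mm (spec (adL n f *m Z)) = mm ('X * spec Z).
Proof.
have -> : spec (adL n f *m Z) = \sum_j \sum_k (phi (Z j k))%:P * rmodp 'X^(j.+1) f * e ^+ val k.
  rewrite /spec exchange_big [RHS]exchange_big; apply: eq_bigr => k _ /=.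
  rewrite (eq_bigr (fun i : 'I_n.+1 => \sum_j (phi (Z j k))%:P * (mulmodmx n f 'X j i *: 'X^i) * e ^+ k)).
    rewrite exchange_big; apply: eq_bigr => j _ /=.
    by rewrite mulmodmxX_row // mulr_sumr mulr_suml.
  move=> i _; rewrite mxE rmorph_sum rmorph_sum !mulr_suml; apply: eq_bigr => j _.
  rewrite rmorphM /= polyCM !mxE phiC -mul_polyC; congr (_ * _).
  by rewrite mulrA; congr (_ * _); rewrite mulrC.
rewrite /spec mulr_sumr !mulmodmx_sum //; apply: eq_bigr => j _.
rewrite mulr_sumr !mulmodmx_sum //; apply: eq_bigr => k _.
by rewrite mulmodmxM // mulmodmxM // mulmodmx_mod // -!mulmodmxM //; congr mulmodmx; rewrite exprS; ring.
Qed.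

Lemma spec_adN Z : mm (spec (Z *m adN n f)) = mm (e * spec Z).
Proof.
pose psi : {rmorphism {poly {poly K}} -> {poly {poly K}}} := (horner_eval e \o map_poly (polyC \o phi \o sh))%FUN.
have psiE (k : 'I_n.+1) : mm (\sum_i (phi (sh (mulmodmx n f 'X k i)))%:P * e ^+ val i) = mm (e ^+ k.+1).
  (* The power [T' ^ (k + 1)] is divided by [f] before specialising; the multiple of [f] vanishes by
     [fe]. *)
  have := congr1 psi (rdivp_eq mf 'X^(k.+1)).
  rewrite rmorphD rmorphM /= {1 3}/horner_eval map_polyXn !hornerE /= => ->.
  rewrite mulmodmxD // mulmodmxM // fe mulr0 add0r mulmodmxX_row //; congr mulmodmx.
  rewrite [map_poly _ _]raddf_sum [RHS]raddf_sum; apply: eq_bigr => i _.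
  by rewrite /= map_polyZ map_polyXn /horner_eval hornerZ hornerXn.
have -> : spec (Z *m adN n f) =
   \sum_j \sum_k (phi (Z j k))%:P * 'X^j * \sum_i (phi (sh (mulmodmx n f 'X k i)))%:P * e ^+ val i.
  apply: eq_bigr => j _.
  rewrite (eq_bigr (fun i : 'I_n.+1 => \sum_k (phi (Z j k))%:P * 'X^j * ((phi (sh (mulmodmx n f 'X k i)))%:P * e ^+ i))).
    by rewrite exchange_big; apply: eq_bigr => k _ /=; rewrite mulr_sumr.
  move=> i _; rewrite mxE rmorph_sum rmorph_sum !mulr_suml; apply: eq_bigr => k _.
  by rewrite rmorphM /= polyCM [adN _ _ _ _]mxE; ring.
rewrite /spec mulr_sumr !mulmodmx_sum //; apply: eq_bigr => j _.
rewrite mulr_sumr !mulmodmx_sum //; apply: eq_bigr => k _.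
by rewrite mulmodmxM // psiE -mulmodmxM //; congr mulmodmx; rewrite exprS; ring.
Qed.

Lemma spec_iter_ad M Z : mm (spec (iter M (ad f) Z)) = mm (('X - e) ^+ M * spec Z).
Proof.
elim: M => [|M IH]; first by rewrite /= expr0 mul1r.
rewrite iterS {1}/ad spec_is_zmod mulmodmxB // spec_adL spec_adN -mulmodmxB // -mulrBl.
by rewrite mulmodmxM // IH -mulmodmxM // mulrA -exprS.
Qed.

Lemma spec_adLN a b Z : mm (spec (adL n f ^+ a *m Z *m adN n f ^+ b)) = mm ('X^a * e ^+ b * spec Z).
Proof.
elim: b => [|b IHb].
  rewrite !expr0 mulmx1 mulr1; elim: a => [|a IHa]; first by rewrite !expr0 mul1mx mul1r.
  by rewrite exprS -mulmxA spec_adL mulmodmxM // IHa -mulmodmxM // mulrA -exprS.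
by rewrite exprSr mulmxA spec_adN mulmodmxM // IHb -mulmodmxM //; congr mulmodmx; rewrite exprS; ring.
Qed.

End Specialise.

Section Spec0.
Variables (K : comNzRingType) (n : nat) (f : {poly {poly K}}).
Hypotheses (mf : f \is monic) (sf : size f = n.+2).
Notation Rte := {poly {poly K}}.
Notation mx := 'M[Rte]_n.+1.
Local Notation sh := (shift K).
Local Notation mm := (mulmodmx n f).

Definition eps0 : {rmorphism Rte -> {poly K}} := horner_eval 0.
Lemma eps0C c : eps0 c%:P = c. Proof. by rewrite /eps0 /= /horner_eval hornerC. Qed.

(** On the diagonal [t' = t], [T' = T] the difference quotient of [f] becomes the derivative. *)
Lemma spec_resid (Z : mx) : mm (spec eps0 'X (resid f Z)) = mm (f^`() * spec eps0 'X Z).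
Proof.
have e0 c : eps0 (sh c) = c by rewrite /eps0 /= /horner_eval shift_eps0.
have fe : mm ((map_poly (polyC \o eps0 \o sh) f).['X]) = 0.
  rewrite (eq_map_poly (g := polyC)); last by move=> x; rewrite /= e0.
  have := comp_polyXr f; rewrite /comp_poly => ->.
  by rewrite -mulmodmx_mod // rmodpp // ; apply/matrixP=> i j; rewrite !mxE mulr0 rmod0p coef0.
have S0 : spec eps0 'X (0 : mx) = 0 by rewrite -(subrr (0 : mx)) spec_is_zmod subrr.
rewrite /resid spec_sum.
rewrite [f^`()]/deriv poly_def sf mulr_suml mulmodmx_sum // mulmodmx_sum // big_ord_recl /=.
rewrite big_ord0 scaler0 S0 -{1}(mulmodE mf sf) rmorph0 add0r.
apply: eq_bigr => k _; rewrite specZ e0 /bump /=.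
rewrite spec_sum mulr_sumr mulmodmx_sum //.
rewrite (eq_bigr (fun=> mm ((f`_k.+1)%:P * 'X^k * spec eps0 'X Z))); last first.
  move=> b _ /=; rewrite mulmodmxM // spec_adLN //; last exact: eps0C.
  rewrite -mulmodmxM //; congr mulmodmx; rewrite -exprD mulrA; congr (_ * 'X^_ * _).
  by have := ltn_ord b; rewrite /bump /=; lia.
rewrite sumr_const card_ord -(mulmodE mf sf) -rmorphMn /=; congr mulmodmx.
by rewrite -mul_polyC polyCMn !mulrnAl.
Qed.

End Spec0.

Section EpsDivisible.
Variables (K : comNzRingType) (n : nat).
Notation mx := 'M[{poly {poly K}}]_n.+1.
Implicit Types (Y Z : mx) (M : nat).

Definition epsdvd M Z := forall j k i, (i < M)%N -> (Z j k)`_i = 0.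

Lemma epsdvdD M Y Z : epsdvd M Y -> epsdvd M Z -> epsdvd M (Y + Z).
Proof. by move=> YM ZM j k i iM; rewrite mxE coefD YM ?ZM ?addr0. Qed.

Lemma epsdvdB M Y Z : epsdvd M Y -> epsdvd M Z -> epsdvd M (Y - Z).
Proof. by move=> YM ZM j k i iM; rewrite !mxE coefB YM ?ZM ?subr0. Qed.

Lemma epsdvd_mull M Y Z : epsdvd M Z -> epsdvd M (Y *m Z).
Proof.
move=> ZM j k i iM; rewrite mxE coef_sum big1 // => l _; rewrite coefM big1 // => -[x /= xi] _.
by rewrite ZM ?mulr0 // (leq_ltn_trans _ iM) // leq_subr.
Qed.

Lemma epsdvd_mulr M Y Z : epsdvd M Z -> epsdvd M (Z *m Y).
Proof.
move=> ZM j k i iM; rewrite mxE coef_sum big1 // => l _; rewrite coefM big1 // => -[x /= xi] _.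
by rewrite ZM ?mul0r // (leq_ltn_trans _ iM).
Qed.

Lemma epsdvdX M Z : epsdvd M ('X^M *: Z).
Proof. by move=> j k i iM; rewrite mxE coefXnM iM. Qed.

Definition epsdiv M Z : mx := map_mx (drop_poly M) Z.

Lemma epsdivK M Z : epsdvd M Z -> Z = 'X^M *: epsdiv M Z.
Proof.
move=> ZM; apply/matrixP=> j k; rewrite !mxE mulrC -[LHS](poly_take_drop M) -[RHS]add0r; congr (_ + _).
by apply/polyP=> i; rewrite coef_take_poly coef0; case: ifP => // iM; rewrite ZM.
Qed.

Variables (f : {poly {poly K}}).
Lemma epsdvd_iter_ad M r Z : epsdvd M Z -> epsdvd M (iter r (ad f) Z).
Proof.
move=> ZM; elim: r => //= r IH; rewrite /ad.
by apply: epsdvdB; [exact: epsdvd_mull | exact: epsdvd_mulr].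
Qed.

Definition ad_additive : {additive mx -> mx} := HB.pack (ad f) (GRing.isZmodMorphism.Build _ _ _ (@ad_is_zmod K n f)).
Definition resid_additive : {additive mx -> mx} := HB.pack (@resid K n f) (GRing.isZmodMorphism.Build _ _ _ (@resid_is_zmod K n f)).

Lemma ad_sum (I : Type) (r : seq I) (P : pred I) (F : I -> mx) :
  ad f (\sum_(i <- r | P i) F i) = \sum_(i <- r | P i) ad f (F i).
Proof. exact: (raddf_sum ad_additive). Qed.

Lemma resid_sum (I : Type) (r : seq I) (P : pred I) (F : I -> mx) :
  resid f (\sum_(i <- r | P i) F i) = \sum_(i <- r | P i) resid f (F i).
Proof. exact: (raddf_sum resid_additive). Qed.

Lemma iter_ad_lin r (I : Type) (s : seq I) (P : pred I) (c : I -> {poly {poly K}}) (F : I -> mx) :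
  iter r (ad f) (\sum_(i <- s | P i) c i *: F i) = \sum_(i <- s | P i) c i *: iter r (ad f) (F i).
Proof.
elim: r => //= r ->; rewrite ad_sum; apply: eq_bigr => i _.
by rewrite -ad_scale.
Qed.

Lemma iter_ad_sub r Y Z : iter r (ad f) (Y - Z) = iter r (ad f) Y - iter r (ad f) Z.
Proof. by elim: r => //= r ->; exact: ad_is_zmod. Qed.

Lemma iter_resid_lin r (I : Type) (s : seq I) (P : pred I) (c : I -> {poly {poly K}}) (F : I -> mx) :
  iter r (resid f) (\sum_(i <- s | P i) c i *: F i) = \sum_(i <- s | P i) c i *: iter r (resid f) (F i).
Proof.
elim: r => //= r ->; rewrite resid_sum; apply: eq_bigr => i _.
by rewrite -resid_scale.
Qed.

Lemma iter_residZ r c Z : iter r (resid f) (c *: Z) = c *: iter r (resid f) Z.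
Proof. by elim: r => //= r ->; rewrite resid_scale. Qed.

End EpsDivisible.

Section ResidInj.
Variables (K : idomainType) (n : nat) (f : {poly {poly K}}).
Hypotheses (mf : f \is monic) (sf : size f = n.+2).
Notation mx := 'M[{poly {poly K}}]_n.+1.
Local Notation mm := (mulmodmx n f).
Hypothesis sepf : \det (mm f^`()) != 0.

Lemma mulmx_det_eq0 (R : idomainType) m (P Q : 'M[R]_m) : \det P != 0 -> P *m Q = 0 -> Q = 0.
Proof.
move=> dP PQ; apply/eqP; have : \det P *: Q == 0 by rewrite -mul_scalar_mx -mul_adj_mx -mulmxA PQ mulmx0.
by rewrite scalemx_eq0 (negPf dP).
Qed.

Lemma mulmodmx_iter_resid M (Z : mx) :
  mm (spec (eps0 K) 'X (iter M (resid f) Z)) = mm (f^`() ^+ M * spec (eps0 K) 'X Z).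
Proof.
elim: M => [|M IH]; first by rewrite expr0 mul1r.
by rewrite iterS spec_resid // mulmodmxM // IH -mulmodmxM // mulrA -exprS.
Qed.

(** Divide [Y] by the lowest power of [eps] in it, set [eps = 0] and restrict to the diagonal: there
    [resid] is multiplication by the derivative of [f], which is no zero divisor. A matrix supported
    in column 0 is determined by its restriction, since [1, ..., T ^ n] are independent modulo
    [f]. *)
Lemma resid_epsdvd_inj M r (Y : mx) :
  (forall j k, k != 0 -> Y j k = 0) -> (forall j i, (M <= i)%N -> (Y j 0)`_i = 0) ->
  epsdvd M (iter r (resid f) Y) -> Y = 0.
Proof.
move=> Yk YM Yd; apply/eqP/negPn/negP => Y0.
have ex : exists i, [exists j, (Y j 0)`_i != 0].
  have [j [k jk]] : exists j k, Y j k != 0.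
    by have /matrix0Pn := Y0.
  have k0 : k = 0 by apply/eqP/negPn/negP => k0; rewrite Yk ?eqxx in jk.
  rewrite k0 in jk; exists (size (Y j 0)).-1; apply/existsP; exists j.
  by rewrite -[_`__]/(lead_coef _) lead_coef_eq0.
have [i0 /existsP[j0 ji0] mini] := ex_minnP ex.
have i0M : (i0 < M)%N by rewrite ltnNge; apply/negP => /YM E; rewrite E eqxx in ji0.
have Yi0 : epsdvd i0 Y.
  move=> j k i ii0; have [->|k0] := eqVneq k 0; last by rewrite Yk // coef0.
  apply/eqP/negPn/negP => H; have : (i0 <= i)%N by apply: mini; apply/existsP; exists j.
  by rewrite leqNgt ii0.
set Y1 := epsdiv i0 Y; have YE : Y = 'X^i0 *: Y1 := epsdivK Yi0.
have Y1c j k : (Y1 j k)`_0 = (Y j k)`_i0 by rewrite mxE coef_drop_poly.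
have d0 : spec (eps0 K) 'X (iter r (resid f) Y1) = 0.
  apply: big1 => j _; apply: big1 => k _.
  have := Yd j k i0 i0M; rewrite YE iter_residZ mxE coefXnM ltnn subnn => E.
  by rewrite /eps0 /= /horner_eval horner_coef0 E !mul0r.
have := mulmodmx_iter_resid r Y1; rewrite d0 -(mulmodE mf sf 0) rmorph0 mulmodmxM //.
move=> /esym; rewrite -[_ * _]/(_ *m _); move/mulmx_det_eq0.
have -> : \det (mm (f^`() ^+ r)) != 0.
  elim: (r) => [|r' IH]; first by rewrite expr0 -(mulmodE mf sf) rmorph1 det1 oner_neq0.
  by rewrite exprS mulmodmxM // det_mulmx mulf_neq0.
move=> /(_ isT) /(mulmodmx_eq0 mf sf).
have sE : spec (eps0 K) 'X Y1 = \poly_(j < n.+1) (if insub j is Some i then (Y1 i 0)`_0 else 0).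
  rewrite poly_def; apply: eq_bigr => j _; rewrite (bigD1 0) //= big1 ?addr0.
    by rewrite expr0 mulr1 mul_polyC valK /eps0 /= /horner_eval horner_coef0.
  by move=> k k0; rewrite mxE Yk // /drop_poly size_poly0 poly_def big_ord0 rmorph0 polyC0 !mul0r.
rewrite (rmodf_small sf); last by rewrite sE size_poly.
move/polyP/(_ j0); rewrite sE coef_poly ltn_ord valK coef0 Y1c => E.
by rewrite E eqxx in ji0.
Qed.

End ResidInj.

Section Count.
Variables (K : fieldType) (n : nat) (f : {poly {poly K}}) (M : nat).
Notation mx := 'M[{poly {poly K}}]_n.+1.
Notation idx H := ('I_H * 'I_M * 'I_n.+1 * 'I_n.+1)%type.
Local Notation cc c := (c%:P%:P).

Definition coef_at H (y : idx H) (Z : mx) : K := ((Z y.1.2 y.2)`_(y.1.1.2))`_(y.1.1.1).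

Definition coefz H (Z : mx) : 'rV[K]_#|{: idx H}| := \row_x coef_at (enum_val x : idx H) Z.

Definition monz H (y : idx H) : mx := (('X^(y.1.1.1))%:P * 'X^(y.1.1.2)) *: delta_mx y.1.2 y.2.

Definition unvecz H (w : 'rV[K]_#|{: idx H}|) : mx :=
  \sum_(y : idx H) cc (w 0 (enum_rank y)) *: monz y.

Lemma coef_at_lin H y (I : Type) (s : seq I) (P : pred I) (c : I -> K) (F : I -> mx) :
  @coef_at H y (\sum_(i <- s | P i) cc (c i) *: F i) = \sum_(i <- s | P i) c i * coef_at y (F i).
Proof.
rewrite /coef_at summxE !coef_sum; apply: eq_bigr => z _.
by rewrite mxE !coefCM.
Qed.

Lemma coefz_lin H (I : Type) (s : seq I) (P : pred I) (c : I -> K) (F : I -> mx) :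
  coefz H (\sum_(i <- s | P i) cc (c i) *: F i) = \sum_(i <- s | P i) c i *: coefz H (F i).
Proof.
apply/rowP=> x; rewrite mxE coef_at_lin summxE; apply: eq_bigr => y _.
by rewrite !mxE.
Qed.

Lemma coef_unvecz H w j k i a : ((@unvecz H w) j k)`_i`_a =
  if insub a is Some a' then if insub i is Some i' then w 0 (enum_rank (a', i', j, k)) else 0 else 0.
Proof.
have monE (y : idx H) : ((monz y) j k)`_i`_a =
    ((y.1.1.1 == a :> nat) && (y.1.1.2 == i :> nat) && (y.1.2 == j) && (y.2 == k))%:R.
  rewrite !mxE [y.1.2 == j]eq_sym [y.2 == k]eq_sym; case: (j == _); case: (k == _); rewrite /= ?andbF ?mulr0 ?coef0 //.
  rewrite mulr1 !andbT coefCM coefXn eq_sym; case: (_ == i) => /=; rewrite ?mulr1 ?mulr0 ?andbT ?andbF ?coef0 //.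
  by rewrite coefXn eq_sym.
rewrite summxE !coef_sum (eq_bigr (fun y : idx H => w 0 (enum_rank y) * ((monz y) j k)`_i`_a)); last first.
  by move=> y _; rewrite mxE !coefCM.
case: insubP => [a' _ ea|na]; last first.
  apply: big1 => y _; rewrite monE; case: eqP => [E|]; rewrite ?mulr0 //.
  by rewrite -E ltn_ord in na.
case: insubP => [i' _ ei|ni]; last first.
  apply: big1 => y _; rewrite monE andbC; case: (y.1.1.2 =P i :> nat) => [E|]; rewrite ?andbF ?mulr0 //.
  by rewrite -E ltn_ord in ni.
rewrite (bigD1 (a', i', j, k)) //= monE /= ea ei !eqxx mulr1 big1 ?addr0 // => y ne.
rewrite monE; case E : (_ && _); rewrite ?mulr0 //; case/eqP: ne; move: E.
case: y => [[[a1 i1] j1] k1] /= /andP[/andP[/andP[/eqP E1 /eqP E2] /eqP -> /eqP ->]].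
by congr (_, _, _, _); apply: val_inj; rewrite /= ?ea ?ei.
Qed.

Definition tbounded H (Z : mx) := forall j k i a, (i < M)%N -> (H <= a)%N -> (Z j k)`_i`_a = 0.

Lemma unvecz_coefz H Z : tbounded H Z -> epsdvd M (Z - unvecz (coefz H Z)).
Proof.
move=> ZH j k i iM; apply/polyP=> a; rewrite !mxE !coefB coef_unvecz coef0.
case: insubP => [a' _ ea|na]; last by rewrite subr0 ZH // leqNgt.
rewrite insubT //= mxE enum_rankK /coef_at /= ea subrr //.
Qed.

Lemma coefz_epsdvd H Z : epsdvd M Z -> coefz H Z = 0.
Proof. by move=> ZM; apply/rowP=> x; rewrite !mxE /coef_at ZM ?coef0. Qed.

Lemma coefzB H Y Z : coefz H (Y - Z) = coefz H Y - coefz H Z.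
Proof. by apply/rowP=> x; rewrite !mxE /coef_at !mxE !coefB. Qed.

Lemma coefz_eq0 H Z : tbounded H Z -> coefz H Z = 0 -> epsdvd M Z.
Proof.
move=> ZH Z0; have := unvecz_coefz ZH; rewrite Z0.
suff -> : @unvecz H 0 = 0 by rewrite subr0.
by rewrite /unvecz big1 // => y _; rewrite mxE !polyC0 scale0r.
Qed.

Lemma tbounded_lin H (I : Type) (s : seq I) (P : pred I) (c : I -> K) (F : I -> mx) :
  (forall i, P i -> tbounded H (F i)) -> tbounded H (\sum_(i <- s | P i) cc (c i) *: F i).
Proof.
move=> FH j k i a iM Ha; rewrite summxE !coef_sum big1 // => y Py.
by rewrite mxE !coefCM (FH y) ?mulr0.
Qed.

(** Modulo [eps ^ M], multiplication by [(T - T') ^ M] is linear on a space of dimension [#|idx H|].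
    Its kernel contains the independent [ZU u], so its rank is at most [#|idx H| - #|U| < #|V|], and
    some combination of the [ZV v] is killed. *)
Lemma eps_kernel H (V U : finType) (ZV : V -> mx) (ZU : U -> mx) :
  (forall v, tbounded H (ZV v)) -> (forall u, tbounded H (ZU u)) ->
  (forall u, epsdvd M (iter M (ad f) (ZU u))) ->
  (forall c : U -> K, epsdvd M (\sum_u cc (c u) *: ZU u) -> forall u, c u = 0) ->
  (#|{: idx H}| < #|V| + #|U|)%N ->
  exists c : V -> K, (exists v, c v != 0) /\ epsdvd M (iter M (ad f) (\sum_v cc (c v) *: ZV v)).
Proof.
move=> VH UH UM Ui lt.
pose adm (y : idx H) := iter M (ad f) (monz y).
(* Multiplication raises the degree in [t]; a larger common bound [H1] makes the target finite
   dimensional. *)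
have [H1 H1P] : exists H1, forall y, tbounded H1 (adm y).
  exists (\max_(y : idx H) \max_(j < n.+1) \max_(k < n.+1) \max_(i < M) size ((adm y j k)`_i)%R).
  move=> y j k i a iM Ha; apply: nth_default; apply: leq_trans Ha.
  apply: leq_trans (leq_bigmax y); apply: leq_trans (leq_bigmax j); apply: leq_trans (leq_bigmax k).
  exact: (leq_bigmax (Ordinal iM)).
pose P := \matrix_(x < #|{: idx H}|) coefz H1 (adm (enum_val x)).
have PE w : w *m P = coefz H1 (iter M (ad f) (unvecz w)).
  rewrite /unvecz iter_ad_lin coefz_lin mulmx_sum_row [RHS](reindex_onto enum_val enum_rank) /=; last by move=> ? _; exact: enum_rankK.
  by apply: eq_big => [x|x _]; rewrite ?enum_valK ?eqxx // rowK.
have coefzE Z : tbounded H Z -> coefz H Z *m P = coefz H1 (iter M (ad f) Z).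
  move=> ZH; rewrite PE; apply/esym/eqP; rewrite -subr_eq0 -coefzB -iter_ad_sub coefz_epsdvd //.
  by apply: epsdvd_iter_ad; apply: unvecz_coefz.
pose A := \matrix_(x < #|V|) coefz H (ZV (enum_val x)).
pose B := \matrix_(x < #|U|) coefz H (ZU (enum_val x)).
have BP0 : B *m P = 0.
  by apply/row_matrixP => x; rewrite row_mul rowK coefzE // row0 coefz_epsdvd.
have Bfree : row_free B.
  apply: inj_row_free => v vB.
  have E : coefz H (\sum_u cc (v 0 (enum_rank u)) *: ZU u) = 0.
    rewrite coefz_lin -[RHS]vB mulmx_sum_row [LHS](reindex_onto enum_val enum_rank) /=; last by move=> ? _; exact: enum_rankK.
    by apply: eq_big => [x|x _]; rewrite ?enum_valK ?eqxx // rowK.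
  have v0 : forall u, v 0 (enum_rank u) = 0.
    by apply: (Ui (fun u => v 0 (enum_rank u))); apply: coefz_eq0 E; apply: tbounded_lin => u _; exact: UH.
  by apply/rowP=> x; have := v0 (enum_val x); rewrite enum_valK mxE.
have rP : (#|U| + \rank P <= #|{: idx H}|)%N.
  by move: Bfree; rewrite /row_free => /eqP {1}<-; apply: mulmx0_rank_max.
have [v v0 vAP] : exists2 v : 'rV_#|V|, v != 0 & v *m (A *m P) = 0.
  have : kermx (A *m P) != 0.
    rewrite kermx_eq0 /row_free; apply: contraTneq lt => rA.
    rewrite -leqNgt -rA addnC; apply: leq_trans rP.
    by rewrite leq_add2l mxrankM_maxr.
  move=> /rowV0Pn[v /sub_kermxP vk v0]; by exists v.
pose Z := \sum_u cc (v 0 (enum_rank u)) *: ZV u.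
have ZH : tbounded H Z by apply: tbounded_lin => u _; exact: VH.
have vA : v *m A = coefz H Z.
  rewrite /Z coefz_lin mulmx_sum_row [RHS](reindex_onto enum_val enum_rank) /=; last by move=> ? _; exact: enum_rankK.
  by apply: eq_big => [x|x _]; rewrite ?enum_valK ?eqxx // rowK.
exists (fun u => v 0 (enum_rank u)); split.
  by have /rV0Pn[x vx] := v0; exists (enum_val x); rewrite enum_valK.
rewrite -/Z; move: vAP; rewrite mulmxA vA PE => E.
have E2 : epsdvd M (iter M (ad f) (unvecz (coefz H Z))).
  apply: coefz_eq0 E; rewrite /unvecz iter_ad_lin; apply: tbounded_lin => y _; exact: H1P.
have := epsdvdD (epsdvd_iter_ad f M (unvecz_coefz ZH)) E2.
by rewrite iter_ad_sub subrK.
Qed.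

End Count.

Section Frob.
Variables (K : fieldType) (p : nat).
Hypothesis chK : p \in [pchar K].

Lemma pchar_polyK : p \in [pchar {poly K}].
Proof. exact: (rmorph_pchar (@polyC K)). Qed.

Lemma pchar_poly2K : p \in [pchar {poly {poly K}}].
Proof. exact: (rmorph_pchar (@polyC {poly K}) pchar_polyK). Qed.

Lemma comp_polyXp (g : {poly K}) : (forall i, g`_i ^+ p = g`_i) -> g \Po 'X^p = g ^+ p.
Proof.
move=> gp; rewrite -[RHS](pFrobenius_autE pchar_polyK) {2}[g](_ : _ = \sum_(i < size g) g`_i *: 'X^i); last first.
  by rewrite -[LHS]coefK poly_def.
rewrite rmorph_sum comp_polyE; apply: eq_bigr => i _.
by rewrite /= pFrobenius_autE exprZn gp -!exprM mulnC.
Qed.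

(** Restriction to the graph of Frobenius, where [t' = t ^ p] and hence [eps = t ^ p - t]. *)
Definition eps1 : {rmorphism {poly {poly K}} -> {poly K}} := horner_eval ('X^p - 'X).

Lemma eps1C c : eps1 c%:P = c. Proof. by rewrite /eps1 /= /horner_eval hornerC. Qed.

Lemma eps1X : eps1 'X = 'X^p - 'X. Proof. by rewrite /eps1 /= /horner_eval hornerX. Qed.

Lemma eps1_shift c : eps1 (shift K c) = c \Po 'X^p.
Proof.
rewrite rmorph_shift_horner eps1C eps1X subrK /comp_poly; congr _.[_].
by apply: eq_map_poly => x; rewrite /= -[horner_eval _ _]/(eps1 _) eps1C.
Qed.

(** The point [(t ^ p, T ^ p)] lies on the curve again because Frobenius fixes the coefficients of
    [f]. *)
Lemma spec1_root (f : {poly {poly K}}) : (forall k i, f`_k`_i ^+ p = f`_k`_i) ->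
  (map_poly (polyC \o eps1 \o shift K) f).['X^p] = f ^+ p.
Proof.
move=> fp; rewrite -[RHS](pFrobenius_autE pchar_poly2K) {2}[f](_ : _ = \sum_(i < size f) f`_i *: 'X^i); last first.
  by rewrite -[LHS]coefK poly_def.
rewrite rmorph_sum (@horner_coef_wide _ (size f)); last exact: size_poly.
apply: eq_bigr => i _; rewrite coef_map /= -[horner_eval _ _]/(eps1 _) eps1_shift comp_polyXp //.
by rewrite pFrobenius_autE exprZn -!exprM mulnC -mul_polyC rmorphXn.
Qed.

End Frob.

Section Exists.
Variables (K : fieldType) (n : nat) (f : {poly {poly K}}).
Hypotheses (mf : f \is monic) (sf : size f = n.+2) (tf : tdeg_le n.+1 f).
Hypothesis sepf : \det (mulmodmx n f f^`()) != 0.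
Notation mx := 'M[{poly {poly K}}]_n.+1.
Local Notation cc c := (c%:P%:P).
Local Notation sh := (shift K).
Variables (m1 l M : nat).

Definition simplex := {x : 'I_l.+1 * 'I_n.+1 | (x.1 + x.2 <= l)%N}.

Lemma card_simplex : #|{: simplex}| = (\sum_(j < n.+1) (l.+1 - j))%N.
Proof.
rewrite card_sig -sum1_card -(pair_big_dep xpredT (fun (k : 'I_l.+1) (j : 'I_n.+1) => (k + j <= l)%N) (fun _ _ => 1%N)) /=.
rewrite (exchange_big_dep xpredT) //=; apply: eq_bigr => j _.
rewrite sum1_card; have [lt|le] := ltnP l j.
  rewrite (_ : _ - _ = 0)%N; last by lia.
  by apply: eq_card0 => k; rewrite unfold_in -/(leq _ _); apply/negP => ?; lia.
have e : (l.+1 - j <= l.+1)%N by lia.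
rewrite -[RHS]card_ord -(card_image (f := widen_ord e)); last by move=> x y /(congr1 val) /= /val_inj.
apply: eq_card => k; rewrite unfold_in -/(leq _ _); apply/idP/imageP => [kj|[x _ ->]].
  have klt : (k < l.+1 - j)%N by lia.
  by exists (Ordinal klt) => //; apply: val_inj.
by have := ltn_ord x; rewrite /=; lia.
Qed.

Notation V := ('I_m1 * 'I_n.+1 * simplex)%type.

(** The monomial [t ^ i T ^ j t' ^ a T' ^ b] with [i < m1] and [a + b <= l]. On the graph of
    Frobenius its last two factors become a [p]-th power. *)
Definition auxmx (v : V) : mx :=
  (('X^(v.1.1))%:P * sh 'X^((val v.2).1)) *: delta_mx v.1.2 (val v.2).2.

(** The dimension count of [eps_kernel]. [H] exceeds the degree in [t] of every auxiliary monomial;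
    the left side counts the monomials [t ^ a eps ^ i T ^ j T' ^ k] with [a < H] and [i < M], and
    the last summand counts the solutions known from [iter_ad_iter_resid]. *)
Lemma stepanov_aux : (0 < m1)%N ->
  let H := (m1 + l)%N in
  (H * M * n.+1 * n.+1 < m1 * n.+1 * \sum_(j < n.+1) (l.+1 - j) + (H - (n + M * n)) * M * n.+1)%N ->
  exists c : V -> K, (exists v, c v != 0) /\ epsdvd M (iter M (ad f) (\sum_v cc (c v) *: auxmx v)).
Proof.
move=> m10 H lt.
(* The factor [T'] is absent (column 0), so that [resid_epsdvd_inj] makes these solutions
   independent. The range of [a] leaves room for the weight of [T ^ j], at most [n], and for the
   [M n] added by [resid]. *)
pose ZU (u : 'I_(H - (n + M * n)) * 'I_M * 'I_n.+1) : mx :=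
  iter M (resid f) ((('X^(u.1.1))%:P * 'X^(u.1.2)) *: delta_mx u.2 0).
apply: (@eps_kernel _ _ f M H _ _ auxmx ZU); last 1 first.
- by rewrite !card_prod !card_ord card_simplex.
- move=> [[i j] [[k k'] /= kk]] j1 k1 i1 a i1M Ha; rewrite !mxE /=.
  case: (_ && _); last by rewrite mulr0 !coef0.
  rewrite mulr1 coefCM coefXnM; case: ifP => // ai.
  rewrite (@tdeg_le_shift _ k) ?size_polyXn //; have := ltn_ord i; rewrite /H in Ha; move: Ha kk; clear; lia.
- move=> [[a i] j] j1 k1 i1 a1 i1M Ha; rewrite /ZU /= iter_residZ mxE -mulrA coefCM coefXnM.
  have ltH := ltn_ord a; case: ifP => // aa; rewrite coefXnM; case: ifP => [_|ii]; first by rewrite coef0.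
  have dw : @wt_le K n j (delta_mx j 0).
    move=> j2 k2 i2 a2; rewrite mxE; case: eqP => [->|_] /=; last by rewrite !coef0.
    case: eqP => [->|_] /=; last by rewrite !coef0.
    rewrite coef1; case: eqP => [->|_]; rewrite ?coef0 //= coef1; case: eqP => // -> /=; lia.
  have wd := wt_le_iter_resid mf sf tf (M := M) dw; apply: wd.
  by have := ltn_ord j; move: Ha ltH aa ii; rewrite /H; clear; lia.
- move=> [[a i] j]; rewrite /ZU iter_ad_iter_resid //; exact: epsdvdX.
move=> c cM.
pose Y : mx := \sum_(u : 'I_(H - (n + M * n)) * 'I_M * 'I_n.+1) cc (c u) *: ((('X^(u.1.1))%:P * 'X^(u.1.2)) *: delta_mx u.2 0).
have YE j k i a : (Y j k)`_i`_a = \sum_(u : 'I_(H - (n + M * n)) * 'I_M * 'I_n.+1)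
    c u * ((u.1.1 == a :> nat) && (u.1.2 == i :> nat) && (u.2 == j) && (0 == k))%:R.
  rewrite summxE !coef_sum; apply: eq_bigr => u _; rewrite mxE !coefCM !mxE [u.2 == j]eq_sym [0 == k]eq_sym.
  congr (_ * _); case: (j == _); case: (k == _); rewrite /= ?andbF ?mulr0 ?coef0 //.
  rewrite mulr1 !andbT coefCM coefXn eq_sym; case: (_ == i) => /=; rewrite ?mulr1 ?mulr0 ?andbT ?andbF ?coef0 //.
  by rewrite coefXn eq_sym.
have Y0 : Y = 0.
  apply: (@resid_epsdvd_inj _ _ f mf sf sepf M M).
  - move=> j k k0; apply/polyP=> i; apply/polyP=> a; rewrite YE !coef0 big1 // => u _.
    by rewrite [0 == k]eq_sym (negPf k0) andbF mulr0.
  - move=> j i iM; apply/polyP=> a; rewrite YE coef0 big1 // => u _.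
    by have := ltn_ord u.1.2; case: eqP => // [_|]; case: (_ =P i) => [->|]; rewrite ?andbF ?mulr0 // ltnNge iM.
  - by move: cM; rewrite /Y iter_resid_lin.
move=> [[a i] j]; have := YE j 0 i a; rewrite Y0 mxE !coef0 (bigD1 (a, i, j)) //= !eqxx mulr1 big1 ?addr0 //.
move=> [[a' i'] j'] /= ne; case E : (_ && _); rewrite ?mulr0 //; case/eqP: ne.
by move: E => /andP[/andP[/andP[/eqP E1 /eqP E2] /eqP ->] _]; congr (_, _, _); apply: val_inj.
Qed.

End Exists.

(** * Power series roots with graded coefficients *)

Section Hensel.
Variables (R : comNzRingType) (f : {poly {poly R}}) (b0 u : R).
Hypothesis f0 : (map_poly (horner_eval 0) f).[b0] = 0.
Hypothesis f1 : u * (map_poly (horner_eval 0) f^`()).[b0] = 1.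
(* [P i] bounds the coefficients of [t ^ i]. *)
Variable P : nat -> R -> Prop.
Hypotheses (P0 : forall i, P i 0) (PD : forall i x y, P i x -> P i y -> P i (x + y))
  (PN : forall i x, P i x -> P i (- x))
  (PM : forall i j x y, P i x -> P j y -> P (i + j)%N (x * y)).
Hypotheses (P1 : P 0%N 1) (Pb : P 0%N b0) (Pu : P 0%N u) (Pf : forall k i, P i f`_k`_i).

Definition coefP (g : {poly R}) := forall i, P i g`_i.

Lemma coefP_sum (I : Type) (r : seq I) (Q : pred I) (F : I -> {poly R}) :
  (forall i, Q i -> coefP (F i)) -> coefP (\sum_(i <- r | Q i) F i).
Proof.
move=> H; elim/big_ind: _ => //; first by move=> i; rewrite coef0.
by move=> x y Hx Hy i; rewrite coefD; apply: PD.
Qed.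

Lemma coefPM g h : coefP g -> coefP h -> coefP (g * h).
Proof.
move=> Hg Hh i; rewrite coefM; elim/big_ind: _ => //; first exact: PD.
by move=> j _; have := PM (Hg j) (Hh (i - j)%N); rewrite subnKC // -ltnS.
Qed.

Lemma coefPX g k : coefP g -> coefP (g ^+ k).
Proof.
move=> Hg; elim: k => [|k IH]; last by rewrite exprS; apply: coefPM.
by move=> i; rewrite expr0 coef1; case: eqP => [->|_] /=.
Qed.

Lemma coefP_horner (g : {poly {poly R}}) h : (forall k, coefP g`_k) -> coefP h -> coefP g.[h].
Proof. by move=> Hg Hh; rewrite horner_coef; apply: coefP_sum => k _; apply: coefPM => //; exact: coefPX. Qed.

(** Newton's method, one coefficient at a time. Every correction divides by the same value of the
    derivative, with inverse [u] in degree 0, so the coefficients stay in the graded family [P]; on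
    the generic line this bounds their degrees in the direction. *)
Lemma hensel N : exists b : {poly R}, [/\ b.[0] = b0, coefP b & forall i, (i < N)%N -> (f.[b])`_i = 0].
Proof.
have ev0 (g : {poly {poly R}}) (b : {poly R}) : (g.[b])`_0 = (map_poly (horner_eval 0) g).[b.[0]].
  by rewrite -horner_coef0 -[LHS]/(horner_eval 0 g.[b]) -horner_map.
elim: N => [|[|N] IH].
- exists b0%:P; split=> //; first by rewrite hornerC.
  by move=> i; rewrite coefC; case: eqP => [->|_] /=.
- exists b0%:P; split=> //; first by rewrite hornerC.
    by move=> i; rewrite coefC; case: eqP => [->|_] /=.
  by move=> [|//] _; rewrite ev0 hornerC.
have [b [bb Pbb fb]] := IH.
pose c := - u * (f.[b])`_N.+1; pose h : {poly R} := c%:P * 'X^(N.+1).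
have Pc : P N.+1 c.
  by rewrite /c mulNr; apply: PN; rewrite -[N.+1]add0n; apply: PM => //; apply: coefP_horner.
exists (b + h); split.
- by rewrite hornerD bb /h hornerM hornerXn expr0n mulr0 addr0.
- move=> i; rewrite coefD; apply: PD => //; rewrite coefCM coefXn.
  by case: eqP => [->|_]; rewrite ?mulr1 ?mulr0.
(* The remainder of Taylor's formula is divisible by [t ^ (2 (N + 1))] and leaves the coefficients
   up to [N + 1] alone. *)
have [r E] : exists r, f.[b + h] = f.[b] + f^`().[b] * h + r * h ^+ 2.
  rewrite (nderiv_taylor_wide (mulrC b h) (leqW (leqnSn (size f)))) !big_ord_recl /=.
  exists (\sum_(i < size f) f^`N(i.+2).[b] * h ^+ i).
  rewrite nderivn0 poly.nderivn1 expr0 expr1 mulr1 addrA; congr (_ + _).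
  by rewrite mulr_suml; apply: eq_bigr => i _; rewrite -mulrA -exprD addn2.
move: E; have -> : h ^+ 2 = c%:P ^+ 2 * 'X^(N.+1.*2) by rewrite /h exprMn -exprM muln2.
move=> E i; rewrite ltnS => iN; rewrite E /h [_ * (c%:P * _)]mulrA [r * _]mulrA !coefD !coefMXn.
have -> : (i < N.+1.*2)%N by move: iN; clear; lia.
rewrite addr0; move: iN; rewrite leq_eqVlt => /orP[/eqP ->|lt]; last by rewrite lt addr0 fb.
rewrite ltnn subnn coefMC ev0 bb /c; move: f1; set v := (_).[b0] => uv.
by rewrite mulNr mulrN mulrA [v * u]mulrC uv mul1r subrr.
Qed.

End Hensel.

Section NonVanish.
Variables (K : fieldType) (n : nat) (f : {poly {poly K}}).
Hypotheses (mf : f \is monic) (sf : size f = n.+2) (tf : tdeg_le n.+1 f).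
Hypothesis df : domainp n f.
Variables (p : nat).
Hypothesis chK : p \in [pchar K].
Hypothesis rootp : forall x : K, exists y, y ^+ p = x.
Local Notation cc c := (c%:P%:P).

Section Place.
Variables (a : K) (b : {poly K}).

(* Restriction to the formal branch [s |-> (a + s, b(s))]. *)
Definition branch : {rmorphism {poly {poly K}} -> {poly K}} :=
  (horner_eval b \o map_poly (comp_poly ('X + a%:P)))%FUN.

Lemma branchE g : branch g = (map_poly (comp_poly ('X + a%:P)) g).[b]. Proof. by []. Qed.

Lemma branchC c : branch (cc c) = c%:P.
Proof. by rewrite branchE map_polyC hornerC /= comp_polyC. Qed.

(** The norm of [g] lies in the ideal [(f, g)], so it vanishes at [t = a] to the order [k] that [f]
    and [g] share along the branch, while its degree is at most [n.+1 * w]. *)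
Lemma branch_order k w (g : {poly {poly K}}) : g != 0 -> (size g <= n.+1)%N -> tdeg_le w g ->
  'X^k %| branch f -> 'X^k %| branch g -> (k <= n.+1 * w)%N.
Proof.
move=> g0 sg gw kf kg.
have [u [v E]] := det_mulmodmx_ideal mf sf (comp_poly ('X + a%:P)) b g.
have d0 : \det (mulmodmx n f g) != 0 by exact: df.
have c0 : \det (mulmodmx n f g) \Po ('X + a%:P) != 0.
  by rewrite -size_poly_eq0 size_comp_poly2 ?size_poly_eq0 // size_XaddC.
have: 'X^k %| \det (mulmodmx n f g) \Po ('X + a%:P).
  by rewrite E dvdp_add // dvdp_mull.
move=> /(dvdp_leq c0); rewrite size_polyXn size_comp_poly2 ?size_XaddC // => kd.
by rewrite -ltnS; apply: leq_trans kd (size_det_mulmodmx mf sf tf gw).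
Qed.

Lemma dvdpXn_coef k (g : {poly K}) : reflect (forall i, (i < k)%N -> g`_i = 0) ('X^k %| g).
Proof.
apply: (iffP idP) => [/dvdpP[q ->] i ik|g0]; first by rewrite coefMXn ik.
rewrite -[g](poly_take_drop k); apply: dvdp_add; last exact: dvdp_mull.
suff -> : take_poly k g = 0 by rewrite dvdp0.
by apply/polyP=> i; rewrite coef_take_poly coef0; case: ifP => // /g0.
Qed.

Lemma frob_poly (g : {poly K}) W : (size g <= W)%N ->
  g ^+ p = \sum_(i < W) (g`_i ^+ p)%:P * 'X^(p * i).
Proof.
move=> gW; rewrite -[LHS](pFrobenius_autE (pchar_polyK chK)) {1}(_ : g = \sum_(i < W) g`_i *: 'X^i); last first.
  by rewrite -poly_def; apply/polyP=> i; rewrite coef_poly; case: ltnP => // Wi; rewrite nth_default // (leq_trans gW).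
rewrite rmorph_sum; apply: eq_bigr => i _; rewrite /= pFrobenius_autE exprZn -exprM mulnC.
by rewrite mul_polyC.
Qed.

(* Bombieri's argument: since every function of degree below [p / n.+1] vanishes to order below [p]
   on the branch, the lowest term of [\sum F E ^ p] cannot cancel. *)
Lemma frob_independent (S : finType) (F E : S -> {poly {poly K}}) w l :
  (n.+1 * w < p)%N -> (forall s, tdeg_le w (F s)) -> (forall s, (size (F s) <= n.+1)%N) ->
  (forall s, tdeg_le l (E s)) -> (forall s, (size (E s) <= n.+1)%N) ->
  (forall c : S -> K, \sum_s cc (c s) * E s = 0 -> forall s, c s = 0) ->
  'X^(p * (n.+1 * l).+1) %| branch f ->
  (exists s, F s != 0) ->
  mulmodmx n f (\sum_s F s * E s ^+ p) != 0.
Proof.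
move=> wp Fw sF El sE Ei fN [s0 Fs0]; apply/negP => /eqP /(mulmodmx_eq0 mf sf) phi0.
have p0 : (0 < p)%N by apply: leq_ltn_trans wp.
pose e s i := (branch (E s))`_i.
pose C i : {poly {poly K}} := \sum_s cc (e s i ^+ p) * F s.
have Cw i : tdeg_le w (C i).
  apply: tdeg_le_sum => s _ k j kj; rewrite !coefCM Fw ?mulr0 //.
have sC i : (size (C i) <= n.+1)%N.
  apply: leq_trans (size_sum _ _ _) _; apply/bigmax_leqP => s _.
  by rewrite mul_polyC; apply: leq_trans (size_scale_leq _ _) (sF s).
(* If all these [C i] were zero, the [p]-th roots [g s] of one fixed coefficient of the [F s] would
   give a combination of the [E s] vanishing on the branch beyond the order that [branch_order]
   allows, against their independence. *)
have [i1 i1l Ci1] : exists2 i, (i < (n.+1 * l).+1)%N & C i != 0.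
  have [H|] := boolP [exists i : 'I_(n.+1 * l).+1, C i != 0].
    by have /existsP[i Hi] := H; exists i.
  rewrite negb_exists => /forallP C0; exfalso.
  have [k Fk] : exists k, (F s0)`_k != 0.
    by exists (size (F s0)).-1; rewrite -[_`__]/(lead_coef _) lead_coef_eq0.
  have [j Fj] : exists j, (F s0)`_k`_j != 0.
    by exists (size (F s0)`_k).-1; rewrite -[_`__]/(lead_coef _) lead_coef_eq0.
  have [g gE] : exists g : S -> K, forall s, g s ^+ p = (F s)`_k`_j.
    have H s : exists y, y ^+ p == (F s)`_k`_j by have [y <-] := rootp (F s)`_k`_j; exists y.
    by exists (fun s => xchoose (H s)) => s; apply/eqP; exact: (xchooseP (H s)).
  pose G := \sum_s cc (g s) * E s.
  have Ge i : (i < (n.+1 * l).+1)%N -> (branch G)`_i = 0.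
    move=> il; suff : (branch G)`_i ^+ p == 0 by rewrite expf_eq0 p0 => /eqP.
    rewrite -[_ ^+ p](pFrobenius_autE chK) /G rmorph_sum coef_sum rmorph_sum; apply/eqP.
    have := C0 (Ordinal il); rewrite negbK => /eqP /(congr1 (fun h : {poly {poly K}} => h`_k`_j)).
    rewrite !coef0 !coef_sum => EC; rewrite -[RHS]EC; apply: eq_bigr => s _.
    by rewrite rmorphM branchC !coefCM rmorphM /= !pFrobenius_autE gE mulrC.
  have G0 : G = 0.
    apply/eqP/negPn/negP => Gn; have := @branch_order (n.+1 * l).+1 l G Gn.
    rewrite ltnn => H; suff : false by []. apply: H.
    - apply: leq_trans (size_sum _ _ _) _; apply/bigmax_leqP => s _.
      by rewrite mul_polyC; apply: leq_trans (size_scale_leq _ _) (sE s).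
    - by apply: tdeg_le_sum => s _ k' j' kj; rewrite !coefCM El ?mulr0.
    - apply: dvdp_trans fN; apply: dvdp_exp2l; rewrite -{1}[_.+1]mul1n leq_mul2r p0 orbT //.
    - exact/dvdpXn_coef.
  by move: Fj; rewrite -gE (Ei _ G0) expr0n gtn_eqF // eqxx.
have ex : exists i, C i != 0 by exists i1.
have [i0 Ci0 mini] := ex_minnP ex.
have i0l : (i0 < (n.+1 * l).+1)%N by apply: leq_ltn_trans i1l; exact: mini.
pose W := (i0.+1 + \max_s size (branch (E s)))%N.
have bphi : branch (\sum_s F s * E s ^+ p) = \sum_(i < W) 'X^(p * i) * branch (C i).
  rewrite rmorph_sum; under eq_bigr => s _.
    rewrite rmorphM rmorphXn (@frob_poly _ W); last by apply: leq_trans (leq_bigmax s) (leq_addl _ _).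
    rewrite mulr_sumr; over.
  rewrite exchange_big; apply: eq_bigr => i _; rewrite /C rmorph_sum mulr_sumr; apply: eq_bigr => s _.
  by rewrite rmorphM branchC; ring.
have bphiX : 'X^(p * i0.+1) %| branch (\sum_s F s * E s ^+ p).
  have := rdivp_eq mf (\sum_s F s * E s ^+ p); rewrite phi0 addr0 => ->.
  rewrite rmorphM; apply: dvdp_mull; apply: dvdp_trans fN; apply: dvdp_exp2l.
  by rewrite leq_mul2l i0l orbT.
have : 'X^p %| branch (C i0).
  rewrite -(@dvdp_mul2l _ 'X^(p * i0)) ?monic_neq0 ?monicXn // -exprD -mulnSr.
  have -> : 'X^(p * i0) * branch (C i0) = branch (\sum_s F s * E s ^+ p) -
     \sum_(i < W | i != i0 :> nat) 'X^(p * i) * branch (C i).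
    have i0W : (i0 < W)%N by rewrite /W addSn ltnS leq_addr.
    by rewrite bphi (bigD1 (Ordinal i0W)) //= addrK.
  apply: dvdp_sub => //; apply: (big_ind (fun h => 'X^(p * i0.+1) %| h)); first exact: dvdp0.
    by move=> x y; exact: dvdp_add.
  move=> i ne; have [lt|ge] := ltnP i i0.
    have -> : C i = 0 by apply/eqP/negPn/negP => /mini; rewrite leqNgt lt.
    by rewrite rmorph0 mulr0 dvdp0.
  apply: dvdp_mulr; apply: dvdp_exp2l; rewrite leq_mul2l; apply/orP; right.
  by rewrite ltn_neqAle eq_sym ne.
move=> Xp; have := @branch_order p w (C i0) Ci0 (sC i0) (Cw i0) _ Xp.
rewrite leqNgt wp => H; suff : false by [].
apply: H; apply: dvdp_trans fN; apply: dvdp_exp2l.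
by rewrite -{1}[p]muln1 leq_mul2l orbT.
Qed.

End Place.
End NonVanish.

Section Roots.
Variable K : closedFieldType.

Definition rootseq (q : {poly K}) : seq K := sval (closed_field_poly_normal q).

Lemma rootseqE q : q = lead_coef q *: \prod_(z <- rootseq q) ('X - z%:P).
Proof. exact: (svalP (closed_field_poly_normal q)). Qed.

Lemma rootseqP (q : {poly K}) : q != 0 -> forall x, (x \in rootseq q) = root q x.
Proof.
move=> q0 x; rewrite {2}[q]rootseqE rootZ ?lead_coef_eq0 //.
by rewrite root_prod_XsubC.
Qed.

Lemma size_rootseq (q : {poly K}) : q != 0 -> size q = (size (rootseq q)).+1.
Proof. by move=> q0; rewrite {1}[q]rootseqE size_scale ?lead_coef_eq0 // size_prod_XsubC. Qed.

Lemma uniq_rootseq (q : {poly K}) : q != 0 -> coprimep q q^`() -> uniq (rootseq q).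
Proof.
move=> q0; rewrite {1 2}[q]rootseqE derivZ coprimepZl ?lead_coef_eq0 // coprimepZr ?lead_coef_eq0 //.
elim: (rootseq q) => //= x s IH; rewrite big_cons derivM derivXsubC mul1r.
rewrite coprimepMl => /andP[cx cs]; apply/andP; split.
  apply: contraTN cx => xs; rewrite coprimep_sym coprimep_XsubC negbK rootE hornerD hornerM !hornerXsubC subrr mul0r addr0.
  by have := root_prod_XsubC s x; rewrite xs rootE.
apply: IH; move: cs; rewrite -[X in coprimep _ (X + _)]mul1r coprimep_addl_mul.
by rewrite coprimepMr => /andP[].
Qed.

Lemma sum_lt_size (s : seq K) (q : {poly K}) (e : K -> nat) : uniq s -> q != 0 ->
  (forall a, a \in s -> ('X - a%:P) ^+ e a %| q) -> (\sum_(a <- s) e a < size q)%N.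
Proof.
elim: s q => [|a s IH] q; first by rewrite big_nil size_poly_gt0.
move=> /= /andP[as_ us] q0 H; have /dvdpP[q' qE] := H a (mem_head _ _).
have q'0 : q' != 0 by apply: contraNneq q0 => E; rewrite qE E mul0r.
have aX : ('X - a%:P) ^+ e a != 0 by rewrite expf_neq0 // polyXsubC_eq0.
have lt : (\sum_(b <- s) e b < size q')%N.
  apply: IH => // b bs; have := H b; rewrite inE bs orbT qE => /(_ isT).
  rewrite Gauss_dvdpl // coprimep_expl // coprimep_expr // coprimep_XsubC root_XsubC.
  by apply: contraNneq as_ => ->.
by rewrite big_cons qE size_mul // size_exp_XsubC addnS /= addnC ltn_add2r.
Qed.

Lemma closed_rootn (p : nat) (x : K) : (0 < p)%N -> exists y : K, y ^+ p = x.
Proof.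
move=> p0; have [y] := solve_monicpoly (fun i : nat => if i is 0%N then x else 0) p0.
move=> E; exists y; rewrite E {E}; case: p p0 => // p _; rewrite big_ord_recl expr0 mulr1 big1 ?addr0 // => i _.
by rewrite mul0r.
Qed.

End Roots.

(** The discriminant lies in the ideal generated by [f] and its derivative. Evaluating that
    membership at the indeterminate itself gives a Bezout identity over [K] with a nonzero
    constant. *)
Lemma separable_spec (R : comNzRingType) (K : closedFieldType) (n : nat) (f : {poly R}) (phi : {rmorphism R -> K}) :
  f \is monic -> size f = n.+2 -> phi (\det (mulmodmx n f f^`())) != 0 ->
  uniq (rootseq (map_poly phi f)) /\ size (rootseq (map_poly phi f)) = n.+1.
Proof.
move=> mf sf da; have s2 : size (map_poly phi f) = n.+2.
  by rewrite size_map_poly_id0 ?sf // (monicP mf) rmorph1 oner_neq0.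
have n0 : map_poly phi f != 0 by rewrite -size_poly_eq0 s2.
split; last by apply: succn_inj; rewrite -size_rootseq.
apply: uniq_rootseq => //.
pose psi : {rmorphism R -> {poly K}} := (polyC \o phi)%FUN.
have [u [v E]] := det_mulmodmx_ideal mf sf psi 'X f^`().
apply/Bezout_coprimepP; exists (v, u) => /=.
have hX (g : {poly R}) : (map_poly psi g).['X] = map_poly phi g.
  by rewrite map_poly_comp -[RHS]comp_polyXr.
move: E; rewrite !hX -deriv_map addrC => <- /=.
by rewrite -alg_polyC -[X in _ %= X]alg_polyC scale1r; apply: eqp_scale.
Qed.

Section Local.
Variables (K : closedFieldType) (n : nat) (f : {poly {poly K}}).
Hypotheses (mf : f \is monic) (sf : size f = n.+2).
Local Notation mm := (mulmodmx n f).
Variable a : K.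
Local Notation fa := (map_poly (horner_eval a) f).

Lemma size_fa : size fa = n.+2.
Proof. by rewrite size_map_poly_id0 ?sf // (monicP mf) rmorph1 oner_neq0. Qed.

Lemma fa_neq0 : fa != 0. Proof. by rewrite -size_poly_eq0 size_fa. Qed.

Lemma separable_fa : (\det (mm f^`())).[a] != 0 -> uniq (rootseq fa).
Proof. by move=> da; have [] := separable_spec mf sf (phi := horner_eval a) da. Qed.

(* The divisibility is read off a basis adapted to the decomposition of [W(a)] into eigenspaces. *)
Lemma dvdp_det_local (g h : {poly {poly K}}) M :
  (\det (mm f^`())).[a] != 0 ->
  (exists G : 'M[{poly K}]_n.+1, mm (h * g) = ('X - a%:P) ^+ M *: G) ->
  ('X - a%:P) ^+ (M * count (fun b => (map_poly (horner_eval a) h).[b] != 0) (rootseq fa)) %| \det (mm g).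
Proof.
move=> da [G GE]; set w := fun b => _.
have ur := separable_fa da; pose s := rootseq fa.
have ss : size s = n.+1 by apply: succn_inj; rewrite -size_rootseq ?fa_neq0 // size_fa.
pose b (j : 'I_n.+1) := s`_j.
pose V : 'M[K]_n.+1 := \matrix_(i, j) b j ^+ i.
have br j : fa.[b j] = 0.
  by apply/eqP; rewrite -[_ == _]/(root _ _) -rootseqP ?fa_neq0 // mem_nth // -/s ss.
have Veig q : map_mx (horner_eval a) (mm q) *m V = V *m diag_mx (\row_j (map_poly (horner_eval a) q).[b j]).
  apply/trmx_inj/row_matrixP => j; rewrite -!tr_col; congr trmx.
  have cV : col j V = \col_i b j ^+ i by apply/colP=> i; rewrite !mxE.
  rewrite colE -mulmxA -colE cV (mulmodmx_eigen mf sf) //.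
  by apply/colP=> i; rewrite mul_mx_diag !mxE mulrC.
have Vu : V \in unitmx.
  rewrite -row_free_unit; apply: inj_row_free => u uV.
  have r0 : rVpoly u = 0.
    apply: (@roots_geq_poly_eq0 _ _ s) => //; last by rewrite ss size_poly.
    apply/allP => x xs; have jx : (index x s < n.+1)%N by rewrite -ss index_mem.
    have := congr1 (fun z : 'rV_n.+1 => z 0 (Ordinal jx)) uV; rewrite !mxE /= => E.
    rewrite rootE -[X in _ == X]E (@horner_coef_wide _ n.+1) ?size_poly //.
    apply/eqP/eq_bigr => i _; rewrite coef_rVpoly_ord mxE /b /= nth_index //.
  by rewrite -[u]rVpolyK r0 linear0.
pose E1 : 'M[{poly K}]_n.+1 := diag_mx (\row_j (w (b j))%:R).
pose E0 : 'M[{poly K}]_n.+1 := diag_mx (\row_j (~~ w (b j))%:R).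
pose Vp := map_mx polyC V.
(* Column [j] is multiplied by [h] exactly where [h] is nonzero at the root [b j]. There [h g] makes
   the column of [mm g *m Z] divisible by [(t - a) ^ M]; at [t = a] the column of [Z] is only
   rescaled by a nonzero scalar, so [\det Z] survives. *)
pose Z := mm h *m Vp *m E1 + Vp *m E0.
pose Dg : 'M[{poly K}]_n.+1 := diag_mx (\row_j (if w (b j) then ('X - a%:P) ^+ M else 1)).
have PZ : mm g *m Z = (G *m Vp *m E1 + mm g *m Vp *m E0) *m Dg.
  rewrite /Z mulmxDr !mulmxA -[mm g *m mm h]/(mm g * mm h) -mulmodmxM // mulrC GE mulmxDl.
  rewrite -!scalemxAl; congr (_ + _).
    rewrite /E1 /Dg; move: (G *m Vp) => X; rewrite !mul_mx_diag; apply/matrixP=> i j; rewrite !mxE.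
    by case: (w (b j)); rewrite ?mulr1 ?mulr0 ?mul0r ?mulr0 // mulrC.
  rewrite /E0 /Dg; move: (mm g *m Vp) => X; rewrite !mul_mx_diag; apply/matrixP=> i j; rewrite !mxE.
  by case: (w (b j)) => /=; rewrite ?mulr0 ?mul0r ?mulr1.
have Za : (\det Z).[a] != 0.
  rewrite -[_.[a]]/(horner_eval a _) -det_map_mx.
  have -> : map_mx (horner_eval a) Z = V *m diag_mx (\row_j (if w (b j) then (map_poly (horner_eval a) h).[b j] else 1)).
    rewrite map_mxD !map_mxM.
    have -> : map_mx (horner_eval a) Vp = V by apply/matrixP=> i j; rewrite !mxE /horner_eval hornerC.
    rewrite Veig /E1 /E0 !map_diag_mx !mul_mx_diag; apply/matrixP=> i j; rewrite !mxE.
    by case: (w (b j)); rewrite /= ?rmorph1 ?rmorph0 ?mulr1 ?mulr0 ?addr0 ?add0r.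
  rewrite det_mulmx det_diag mulf_neq0 //; first by rewrite -unitfE -unitmxE.
  by apply/prodf_neq0 => j _; rewrite mxE; case: ifP => // _; exact: oner_neq0.
have cop : coprimep (('X - a%:P) ^+ (M * count w s)) (\det Z).
  by apply: coprimep_expl; rewrite coprimep_sym coprimep_XsubC.
rewrite -(Gauss_dvdpl _ cop) -det_mulmx PZ det_mulmx dvdp_mull //.
rewrite det_diag -/s.
have -> : (\prod_i (\row_j (if w (b j) then ('X - a%:P) ^+ M else 1 : {poly K})) 0 i) = ('X - a%:P) ^+ (M * count w s).
  under eq_bigr do rewrite mxE.
  rewrite -(big_mkord xpredT (fun i => if w s`_i then ('X - a%:P) ^+ M else 1)) -ss.
  rewrite -(big_nth 0 xpredT (fun x => if w x then ('X - a%:P) ^+ M else 1)).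
  elim: (s) => [|x s' IH]; first by rewrite big_nil muln0 expr0.
  by rewrite big_cons IH /=; case: (w x); rewrite ?mul1r // mulnDr muln1 exprD.
exact: dvdpp.
Qed.

End Local.

Section Stepanov.
Variables (K : closedFieldType) (n : nat) (f : {poly {poly K}}) (p : nat).
Hypotheses (mf : f \is monic) (sf : size f = n.+2) (tf : tdeg_le n.+1 f).
Hypothesis df : domainp n f.
Hypothesis chK : p \in [pchar K].
Hypothesis frobf : forall k i, f`_k`_i ^+ p = f`_k`_i.
Hypothesis sepf : \det (mulmodmx n f f^`()) != 0.
Local Notation mm := (mulmodmx n f).
Local Notation fib a := (map_poly (horner_eval a) f).
Variables (m1 l M : nat).
Local Notation cc c := (c%:P%:P).

Lemma coefCC (c : K) (h : {poly {poly K}}) k i : (cc c * h)`_k`_i = c * h`_k`_i.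
Proof. by rewrite !coefCM. Qed.

Lemma spec_auxmx (v : 'I_m1 * 'I_n.+1 * simplex n l) :
  spec (eps1 K p) 'X^p (auxmx K v) =
  (('X^(v.1.1))%:P * 'X^(v.1.2)) * (('X^((val v.2).1))%:P * 'X^((val v.2).2)) ^+ p.
Proof.
case: v => [[i j] [[k k'] kk]]; rewrite /spec /auxmx /= (bigD1 j) //= (bigD1 k') //= !big1 ?addr0.
- have e1 : eps1 K p (('X^i)%:P * shift K 'X^k) = 'X^i * 'X^p ^+ k.
    by rewrite rmorphM eps1C eps1_shift comp_Xn_poly.
  rewrite !mxE !eqxx mulr1 e1 polyCM exprMn.
  have -> : ('X^p ^+ k)%:P = ('X^k)%:P ^+ p :> {poly {poly K}} by rewrite -exprM mulnC exprM rmorphXn.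
  by rewrite -[X in _ * X = _]exprM mulnC exprM; ring.
- by move=> i' ne; apply: big1 => k1 _; rewrite !mxE (negPf ne) mulr0 rmorph0 !mul0r.
- by move=> i' ne; rewrite !mxE eqxx (negPf ne) mulr0 rmorph0 !mul0r.
Qed.

Lemma hensel_branch (a b : K) N : (fib a).[b] = 0 -> (fib a)^`().[b] != 0 ->
  exists beta, 'X^N %| branch a beta f.
Proof.
move=> fab dab.
pose g := map_poly (comp_poly ('X + a%:P)) f.
have g0 (h : {poly {poly K}}) : map_poly (horner_eval 0) (map_poly (comp_poly ('X + a%:P)) h) = map_poly (horner_eval a) h.
  rewrite -map_poly_comp; apply: eq_map_poly => x /=.
  by rewrite /horner_eval horner_comp hornerD hornerX hornerC add0r.
have H0 : (map_poly (horner_eval 0) g).[b] = 0 by rewrite g0.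
have H1 : ((fib a)^`().[b])^-1 * (map_poly (horner_eval 0) g^`()).[b] = 1.
  by rewrite /g -deriv_map g0 mulVf.
have [beta [_ _ H]] := hensel H0 H1 (P := fun _ _ => True) (fun=> I) (fun _ _ _ _ _ => I)
  (fun _ _ _ => I) (fun _ _ _ _ _ _ => I) I I I (fun _ _ => I) N.
by exists beta; apply/dvdpXn_coef.
Qed.

(** The degree of a norm is compared with its zeros. The auxiliary function [g] on the graph of
    Frobenius has nonzero norm by [frob_independent], which needs [n.+1 * (m1 + n).-1 < p]; each
    irrational [b] above [a] adds [M] to the order of the norm at [a] by [dvdp_det_local]. *)
Theorem stepanov (s : seq K) :
  (0 < m1)%N -> (n.+1 * (m1 + n).-1 < p)%N ->
  (let H := m1 + l in
   H * M * n.+1 * n.+1 < m1 * n.+1 * \sum_(j < n.+1) (l.+1 - j) + (H - (n + M * n)) * M * n.+1)%N ->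
  uniq s -> (forall a, a \in s -> a ^+ p = a /\ (\det (mm f^`())).[a] != 0) ->
  (M * \sum_(a <- s) count (fun b => b ^+ p != b) (rootseq (fib a)) <= n.+1 * ((m1 + n).-1 + l * p))%N.
Proof.
move=> m10 m1p lt us sP.
have p0 : (0 < p)%N by apply: leq_ltn_trans m1p.
have [c [[v0 cv0] cM]] := stepanov_aux mf sf tf sepf m10 lt.
set Z := \sum_v _ in cM.
pose F (t : simplex n l) : {poly {poly K}} := \sum_(ij : 'I_m1 * 'I_n.+1) cc (c (ij, t)) * (('X^(ij.1))%:P * 'X^(ij.2)).
pose E (t : simplex n l) : {poly {poly K}} := ('X^((val t).1))%:P * 'X^((val t).2).
pose g := \sum_t F t * E t ^+ p.
have gE : spec (eps1 K p) 'X^p Z = g.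
  rewrite /Z spec_sum /g; under [RHS]eq_bigr do rewrite /F mulr_suml.
  rewrite [RHS]exchange_big [RHS]pair_big; apply: eq_big => [//|[ij t] _].
  by rewrite specZ eps1C spec_auxmx /= mulrA.
have tmon i j : tdeg_le (i + j) (('X^i)%:P * 'X^j : {poly {poly K}}).
  move=> k a lt'; rewrite coefCM coefXn; case: eqP => [kj|]; rewrite ?mulr0 ?coef0 // mulr1 coefXn.
  by case: eqP => // ai; move: lt'; rewrite kj ai ltnn.
have Fw t : tdeg_le (m1 + n).-1 (F t).
  apply: tdeg_le_sum => -[i j] _ k a lt' /=; rewrite coefCC.
  rewrite (@tmon i j) ?mulr0 //; have := ltn_ord i; have := ltn_ord j; move: lt'; clear; lia.
have sF t : (size (F t) <= n.+1)%N.
  apply: leq_trans (size_sum _ _ _) _; apply/bigmax_leqP => -[i j] _ /=.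
  rewrite mulrA -polyCM mul_polyC; apply: leq_trans (size_scale_leq _ _) _.
  by rewrite size_polyXn.
have Ew t : tdeg_le l (E t) by case: t => [[k k'] /= kk]; apply: tdeg_leW (tmon _ _).
have sE t : (size (E t) <= n.+1)%N.
  by rewrite /E mul_polyC; apply: leq_trans (size_scale_leq _ _) _; rewrite size_polyXn.
have coefE t (a k : nat) : (E t)`_k`_a = ((val t).1 == a :> nat)%:R * ((val t).2 == k :> nat)%:R.
  rewrite /E coefCM coefXn [k == _]eq_sym; case: (_ == k); rewrite ?mulr0 ?coef0 // !mulr1 coefXn eq_sym //.
have Ei (u : simplex n l -> K) : \sum_t cc (u t) * E t = 0 -> forall t, u t = 0.
  move=> u0 t; have := congr1 (fun h : {poly {poly K}} => h`_((val t).2)`_((val t).1)) u0.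
  rewrite !coef0 !coef_sum (bigD1 t) //= coefCC coefE !eqxx !mulr1 big1 ?addr0 // => t' ne.
  rewrite coefCC coefE; case: eqP => [E1|]; rewrite ?mul0r ?mulr0 //; case: eqP => [E2|]; rewrite ?mulr0 //.
  case/eqP: ne; apply: val_inj; rewrite (surjective_pairing (val t')) (surjective_pairing (val t)).
  by congr (_, _); apply: val_inj.
have [a [b [fab dab]]] : exists a b : K, (fib a).[b] = 0 /\ (fib a)^`().[b] != 0.
  have [a da] : exists a : K, (\det (mm f^`())).[a] != 0.
    by have /closed_nonrootP[a] := sepf; exists a.
  exists a; have fa0 := fa_neq0 mf sf a.
  have [b bf] : exists b, root (fib a) b by apply/closed_rootP; rewrite (size_fa mf sf).
  exists b; split; first exact/eqP.
  apply: contraNneq da => db; have [u [w E0]] := det_mulmodmx_ideal mf sf (horner_eval a) b f^`().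
  by rewrite -[_.[a]]/(horner_eval a _) E0 -deriv_map db (eqP bf) !mulr0 addr0.
have [beta fN] := hensel_branch (p * (n.+1 * l).+1) fab dab.
have mg0 : mm g != 0.
  apply: (@frob_independent _ _ _ mf sf tf df p chK _ a beta _ F E (m1 + n).-1 l) => //.
    by move=> x; exact: closed_rootn.
  exists v0.2; apply: contraNneq cv0 => F0.
  have := congr1 (fun h : {poly {poly K}} => h`_(v0.1.2)`_(v0.1.1)) F0.
  rewrite !coef0 !coef_sum (bigD1 v0.1) //= coefCC -surjective_pairing coefCM coefXn eqxx mulr1 coefXn eqxx mulr1.
  rewrite big1 ?addr0 => [->//|[i j] /= ne]; rewrite coefCC coefCM coefXn.
  case: eqP => [E1|]; rewrite ?mulr0 ?coef0 ?mulr0 // mulr1 coefXn; case: eqP => [E2|]; rewrite ?mulr0 //.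
  case/eqP: ne; rewrite [v0.1]surjective_pairing; congr (_, _); exact: val_inj.
have dg0 : \det (mm g) != 0.
  apply: domainp_det => //; apply: contraNneq mg0 => g0.
  by rewrite -mulmodmx_mod // g0 -(mulmodE mf sf) rmorph0.
have fe : mm ((map_poly (polyC \o eps1 K p \o shift K) f).['X^p]) = 0.
  rewrite spec1_root // -mulmodmx_mod //.
  have -> : rmodp (f ^+ p) f = 0.
    by case: (p) p0 => // q _; rewrite exprSr rmodp_mull.
  by rewrite -(mulmodE mf sf) rmorph0.
have key : mm (('X - 'X^p) ^+ M * g) = ('X^p - 'X) ^+ M *: mm (spec (eps1 K p) 'X^p (epsdiv M (iter M (ad f) Z))).
  rewrite -gE -(spec_iter_ad mf sf (@eps1C K p) fe) {1}(epsdivK cM) specZ rmorphXn /= -/(eps1 K p).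
  by rewrite -[X in X ^+ M]/(eps1 K p 'X) eps1X mulmodmxM // mulmodmxC // -[LHS]/(_ *m _) mul_scalar_mx.
have loc a' : a' \in s -> ('X - a'%:P) ^+ (M * count (fun b => b ^+ p != b) (rootseq (fib a'))) %| \det (mm g).
  move=> a's; have [a'p da'] := sP _ a's.
  (* For [M = 0] the power [(T - T ^ p) ^ M] is 1 and does not single out the irrational [b]. *)
  have [->|M0] := posnP M; first by rewrite mul0n expr0 dvd1p.
  rewrite (@eq_count _ _ (fun b => (map_poly (horner_eval a') (('X - 'X^p) ^+ M)).[b] != 0)); last first.
    move=> x; rewrite rmorphXn rmorphB /= map_polyX map_polyXn horner_exp expf_eq0 M0 /=.
    by rewrite hornerD hornerN hornerX hornerXn subr_eq0 eq_sym.
  apply: dvdp_det_local => //; rewrite key.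
  have /factor_theorem[r rE] : root ('X^p - 'X) a' by rewrite rootE hornerD hornerN hornerX hornerXn a'p subrr.
  by rewrite rE [r * _]mulrC exprMn -scalerA; eexists.
have := sum_lt_size us dg0 (e := fun a => (M * count (fun b => b ^+ p != b) (rootseq (fib a)))%N) loc.
rewrite -big_distrr /= => lts.
have := size_det_mulmodmx mf sf tf (w := (m1 + n).-1 + l * p) (g := g).
move=> H; rewrite -ltnS; apply: leq_trans lts (H _) => {H}.
apply: tdeg_le_sum => t _; apply: tdeg_leM => //.
rewrite /E exprMn -exprM -rmorphXn /= -exprM; case: t => [[k k'] /= kk].
by apply: tdeg_leW (tmon _ _); rewrite -mulnDl leq_mul2r kk orbT.
Qed.

End Stepanov.

(** * Factorization, and zeros of polynomials *)

(** The common form in which Gauss's lemma serves [K[t]] and [K[t_1, ..., t_r]]: a divisor of a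
    constant multiple of a monic polynomial becomes monic on division by its leading coefficient. *)
Definition gauss (R : idomainType) := forall (S Q F : {poly R}) (b : R),
  F \is monic -> b != 0 -> S * Q = b%:P * F -> exists S1, S = (lead_coef S)%:P * S1.

Lemma dvd_coef_root (K : fieldType) (z : K) (S : {poly {poly K}}) :
  map_poly (horner_eval z) S = 0 -> exists S', S = ('X - z%:P)%:P * S'.
Proof.
move=> S0; exists (map_poly (fun c => c %/ ('X - z%:P)) S); apply/polyP=> i.
rewrite coefCM coef_map_id0 ?div0p // mulrC divpK // dvdp_XsubCl rootE.
by have := congr1 (fun h : {poly K} => h`_i) S0; rewrite coef_map coef0 => /eqP.
Qed.

(** Induction on the degree of [b]: at a root [z] of [b] one of [S], [Q] vanishes identically, so
    [t - z] can be cancelled. *)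
Lemma gauss_poly (K : closedFieldType) : gauss {poly K}.
Proof.
move=> S Q F b mF; have [m] := ubnP (size b); elim: m S Q b => // m IH S Q b; rewrite ltnS => sb b0 E.
have [sb1|] := boolP (size b == 1%N).
  have [c c0 bE] := size_poly1P _ sb1.
  have lE : lead_coef S * lead_coef Q = c%:P.
    by rewrite -lead_coefM E lead_coefM (monicP mF) mulr1 lead_coefC bE.
  exists ((lead_coef Q * (c^-1)%:P)%:P * S).
  by rewrite mulrA -polyCM mulrA lE -polyCM divff // mul1r.
move=> sb1; have [z bz] := closed_rootP _ sb1.
have /factor_theorem[b' bE] := bz.
have b'0 : b' != 0 by apply: contraNneq b0 => b'0; rewrite bE b'0 mul0r.
have sb' : (size b' < m)%N.
  by move: sb; rewrite bE size_Mmonic ?monicXsubC // size_XsubC addn2.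
have nz : ('X - z%:P)%:P != 0 :> {poly {poly K}} by rewrite polyC_eq0 polyXsubC_eq0.
have E0 : map_poly (horner_eval z) S * map_poly (horner_eval z) Q = 0.
  have bz0 : horner_eval z b = 0 by exact/eqP.
  have E1 : map_poly (horner_eval z) b%:P = 0 by rewrite map_polyC /= bz0.
  by have := congr1 (map_poly (horner_eval z)) E; rewrite !rmorphM => ->; rewrite [X in X * _]E1 mul0r.
have /orP[/eqP/dvd_coef_root[S' SE]|/eqP/dvd_coef_root[Q' QE]] :
    (map_poly (horner_eval z) S == 0) || (map_poly (horner_eval z) Q == 0).
- by rewrite -mulf_eq0 E0.
- have [|S1 S1E] := IH S' Q b' sb' b'0.
    by apply: (mulfI nz); rewrite mulrA -SE E bE polyCM; ring.
  exists S1; rewrite {1}SE {1}S1E SE lead_coefM lead_coefC polyCM; ring.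
- apply: (IH S Q' b') => //.
  by apply: (mulfI nz); rewrite mulrCA -QE E bE polyCM; ring.
Qed.

(** Euclid's algorithm by pseudo-division inside the ideal [J]. The last nonzero remainder divides a
    constant multiple of [f], and Gauss's lemma turns it into a constant times a monic factor of
    [f]. *)
Lemma mono_factor (R : idomainType) (J : {poly R} -> Prop) (f g : {poly R}) : gauss R ->
  (forall a x y, J x -> J y -> J (x + a * y)) -> f \is monic -> J f ->
  g != 0 -> J g -> (size g < size f)%N ->
  exists c S1 Q1, [/\ c != 0, S1 \is monic, f = S1 * Q1, J (c%:P * S1) & (size S1 <= size g)%N].
Proof.
move=> gR JD mf Jf; have [m] := ubnP (size g); elim: m g => // m IH g; rewrite ltnS => sg g0 Jg ltg.
have E := Pdiv.Idomain.divp_eq f g.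
have JN a x : J x -> J (a * x) by move=> Jx; have := JD (a - 1) x x Jx Jx; rewrite mulrBl mul1r addrC subrK.
have [r0|r0] := eqVneq (f %% g) 0; last first.
  have lr : (size (f %% g)%R < size g)%N by rewrite Pdiv.Idomain.ltn_modp.
  have [||||c [S1 [Q1 [h1 h2 h3 h4 h5]]]] := IH (f %% g); last by exists c, S1, Q1; split=> //; apply: leq_trans h5 (ltnW lr).
  - by apply: leq_trans sg; rewrite Pdiv.Idomain.ltn_modp.
  - exact: r0.
  - have -> : f %% g = (lead_coef g ^+ scalp f g)%:P * f + (- (f %/ g)) * g.
      by rewrite mul_polyC E mulNr addrC addKr.
    by apply: JD => //; apply: JN.
  - by apply: ltn_trans ltg; rewrite Pdiv.Idomain.ltn_modp.
set b := _ ^+ _ in E; have b0 : b != 0 by rewrite expf_neq0 // lead_coef_eq0.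
move: E; rewrite r0 addr0 -mul_polyC mulrC => E.
have [|S1 S1E] := gR g (f %/ g) f b mf b0; first by rewrite mulrC -E mulrC.
have lg0 : lead_coef g != 0 by rewrite lead_coef_eq0.
have mS1 : S1 \is monic.
  apply/eqP; apply: (mulfI lg0); rewrite mulr1 -[in LHS](lead_coefC (lead_coef g)) -lead_coefM -S1E //.
have sS1 : size S1 = size g by rewrite [in RHS]S1E mul_polyC size_scale.
exists (lead_coef g), S1, (rdivp f S1); split=> //; last 2 first.
- by rewrite -S1E.
- by rewrite sS1.
have fE := rdivp_eq mS1 f; rewrite mulrC.
suff r10 : rmodp f S1 = 0 by rewrite {1}fE r10 addr0.
apply/eqP; apply: contraTT isT => r1.
have X : ((f %/ g) * (lead_coef g)%:P - b%:P * rdivp f S1) * S1 = b%:P * rmodp f S1.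
  rewrite mulrBl -mulrA -S1E -[X in X - _]E -mulrA.
  by rewrite {1}fE; ring.
have : b%:P * rmodp f S1 != 0 by rewrite mulf_neq0 // polyC_eq0.
rewrite -X mulf_eq0 negb_or => /andP[X0 S10].
have := congr1 (fun h : {poly R} => size h) X; have sz : size (b%:P * rmodp f S1) = size (rmodp f S1) by rewrite mul_polyC size_scale.
rewrite /= sz size_Mmonic //.
have := ltn_rmodp f S1; rewrite S10 => l1 l2; move: X0; rewrite -size_poly_gt0.
by move: l1; rewrite -l2; case: (size _) => // k; rewrite addSn /= ltnNge leq_addl.
Qed.

(** If [g] had norm zero, some [h g] with [h] of small degree would be a multiple of [f]. The monic
    factor of [f] found in the ideal [(f, g)] is 1 by irreducibility, so a constant [c] lies in that
    ideal, and [c h] is a multiple of [f] of smaller degree. *)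
Lemma domainp_irreducible (R : idomainType) n (f : {poly R}) : gauss R ->
  f \is monic -> size f = n.+2 ->
  (forall g h : {poly R}, g \is monic -> h \is monic -> f = g * h ->
    (1 < size g)%N -> (1 < size h)%N -> False) -> domainp n f.
Proof.
move=> gR mf sf irr g g0 sg; apply/negP => /eqP d0.
have [h h0 [sh hg]] := det_mulmodmx_eq0 mf sf d0.
pose J (x : {poly R}) := exists u v, x = u * f + v * g.
have [|||||c [S1 [Q1 [c0 mS fE [u [v cE]] sS]]]] := @mono_factor R J f g gR _ mf.
- by move=> a _ _ [u [v ->]] [u' [v' ->]]; exists (u + a * u'), (v + a * v'); ring.
- by exists 1, 0; ring.
- exact: g0.
- by exists 0, 1; ring.
- by rewrite sf.
have sSf : (size S1 < size f)%N by rewrite sf ltnS (leq_trans sS).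
have mQ : Q1 \is monic by move: mf; rewrite fE monicMl.
have S11 : S1 = 1.
  have [l|] := ltnP 1 (size S1); last first.
    move=> s1; have := monicP mS; rewrite (size1_polyC s1) lead_coefC => -> //.
  exfalso; apply: (irr S1 Q1 mS mQ fE l); move: sSf; rewrite fE size_Mmonic ?monic_neq0 //.
  by case: (size Q1) => [|[|//]]; lia.
have hgE := rdivp_eq mf (h * g); move: hgE; rewrite hg addr0 => hgE.
have X : (u * h + v * rdivp (h * g) f) * f = c%:P * h.
  have -> : c%:P * h = u * f * h + v * (h * g) by rewrite -[c%:P]mulr1 -S11 cE; ring.
  by move: hgE; set q := rdivp _ _ => hgE; rewrite hgE; ring.
have : c%:P * h != 0 by rewrite mulf_neq0 // polyC_eq0.
rewrite -X mulf_eq0 negb_or => /andP[X0 _].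
have := congr1 (fun h : {poly R} => size h) X; rewrite size_Mmonic // mul_polyC size_scale // sf => l2.
move: sh; rewrite -l2; move: X0; rewrite -size_poly_gt0; case: (size _) => // k _.
by rewrite addSn /= addnS /= ltnNge leq_addl.
Qed.

Lemma rmorph_mpoly_eq (K : comNzRingType) n (S : comNzRingType) (g1 g2 : {rmorphism {mpoly K[n]} -> S}) :
  (forall c, g1 c%:MP = g2 c%:MP) -> (forall i, g1 'X_i = g2 'X_i) -> g1 =1 g2.
Proof.
move=> hC hX p; rewrite [p]mpolyE !rmorph_sum; apply: eq_bigr => m _.
rewrite -mul_mpolyC !rmorphM hC mpolyXE_id !rmorph_prod; congr (_ * _).
by apply: eq_bigr => i _; rewrite !rmorphXn /= hX.
Qed.

(* [msize] bounds the degree plus one, so [pihomog mdeg e p] is the leading form when [msize p = e.+1]. *)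
Lemma pihomog_top_neq0 (K : idomainType) n (p : {mpoly K[n]}) : p != 0 ->
  pihomog mdeg (msize p).-1 p != 0.
Proof.
move=> p0; apply: contraTneq (mlead_supp p0) => E; rewrite -mcoeff_eq0.
have pE := pihomog_partitionE (mf := mdeg) (leqnn (msize p)).
have -> : p@_(mlead p) = (\sum_(d < msize p) pihomog mdeg d p)@_(mlead p) by rewrite -pE.
rewrite raddf_sum /= big1 // => i _; have [/eqP iE|ne] := boolP (i == (msize p).-1 :> nat).
  by rewrite iE E mcoeff0.
apply: memN_msupp_eq0; apply: contra ne => /(dhomogP _ _ _ (pihomogP mdeg i p)) <-.
by rewrite -(mlead_deg p0).
Qed.

Lemma coefM_top (S : nzRingType) (p q : {poly S}) a b : (size p <= a.+1)%N -> (size q <= b.+1)%N ->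
  (p * q)`_(a + b) = p`_a * q`_b.
Proof.
move=> s1 s2; rewrite coefM (bigD1 (inord a)) //= inordK ?ltnS ?leq_addr // addKn big1 ?addr0 // => i ne.
have [lt|le] := ltnP a i; first by rewrite (nth_default _ (leq_trans s1 lt)) mul0r.
rewrite [X in _ * X]nth_default ?mulr0 // (leq_trans s2) //.
have ne' : (i != a :> nat) by apply: contraNneq ne => ia; rewrite -val_eqE /= ia inordK ?ltnS ?leq_addr.
by have := ltn_ord i; move: ne' le; rewrite ltnS; move: (nat_of_ord i) => {ne}i; clear; lia.
Qed.

Section Line.
Variables (K : comNzRingType) (S : comNzRingType) (iota : {rmorphism K -> S}) (n : nat).
Variables a b : 'I_n -> S.

Definition onto_line : {mpoly K[n]} -> {poly S} :=
  mmap (polyC \o iota) (fun i => (a i)%:P + (b i)%:P * 'X).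

HB.instance Definition _ := GRing.RMorphism.on onto_line.

Lemma onto_lineC c : onto_line c%:MP = (iota c)%:P.
Proof. by rewrite /onto_line mmapC. Qed.

Lemma onto_lineX i : onto_line 'X_i = (a i)%:P + (b i)%:P * 'X.
Proof. by rewrite /onto_line mmapX mmap1U. Qed.

Let lead_is (e : nat) (c : S) (q : {poly S}) := (size q <= e.+1)%N /\ q`_e = c.

Let lead_isM e c q e' c' q' : lead_is e c q -> lead_is e' c' q' -> lead_is (e + e') (c * c') (q * q').
Proof.
move=> [s1 c1] [s2 c2]; split.
  by have := size_mul_leq q q'; move: s1 s2; lia.
by rewrite coefM_top // c1 c2.
Qed.

Let lead_isX e c q k : lead_is e c q -> lead_is (e * k) (c ^+ k) (q ^+ k).
Proof.
move=> h; elim: k => [|k IH]; first by rewrite muln0 !expr0; split; rewrite ?size_poly1 // coef1.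
by rewrite mulnS !exprS; apply: lead_isM.
Qed.

Let lead_is_mmap1 (m : 'X_{1..n}) :
  lead_is (mdeg m) (mmap1 b m) (mmap1 (fun i => (a i)%:P + (b i)%:P * 'X) m).
Proof.
rewrite mdegE /mmap1; elim/big_rec3: _ => [|i q c e _ h].
  by split; rewrite ?size_poly1 // coef1.
apply: lead_isM h; rewrite -[X in lead_is X]mul1n; apply: lead_isX; split.
  rewrite addrC mul_polyC.
  apply: leq_trans (size_polyD _ _) _; rewrite geq_max; apply/andP; split.
    by apply: leq_trans (size_scale_leq _ _) _; rewrite size_polyX.
  by apply: leq_trans (size_polyC_leq1 _) _.
by rewrite coefD coefC coefCM coefX mulr1 add0r.
Qed.

Lemma size_onto_line p : (size (onto_line p) <= msize p)%N.
Proof.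
apply: leq_trans (size_sum _ _ _) _; apply/bigmax_leqP_seq => m mp _ /=.
apply: leq_trans (msize_mdeg_lt mp); rewrite mul_polyC.
by apply: leq_trans (size_scale_leq _ _) _; case: (lead_is_mmap1 m).
Qed.

(** Only monomials of the top degree reach [X ^ e], where they contribute their value at the
    direction [b]. *)
Lemma coef_onto_line p e : (msize p <= e.+1)%N ->
  (onto_line p)`_e = mmap iota b (pihomog mdeg e p).
Proof.
move=> sp; rewrite pihomogE raddf_sum /= /onto_line /mmap coef_sum [RHS]big_mkcond /=.
rewrite big_seq [RHS]big_seq; apply: eq_bigr => m mp; rewrite coefCM.
have [sm cm] := lead_is_mmap1 m.
have [<-|ne] := eqVneq (mdeg m) e; first by rewrite cm -/(mmap iota b _) mmapZ mmapX.
rewrite nth_default ?mulr0 // (leq_trans sm) // ltn_neqAle ne /=.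
by rewrite -ltnS (leq_trans (msize_mdeg_lt mp)).
Qed.

End Line.

Lemma mpoly_alg_ind (K : comNzRingType) n (P : {mpoly K[n]} -> Prop) :
  (forall c, P c%:MP) -> (forall i, P 'X_i) -> (forall p q, P p -> P q -> P (p + q)) ->
  (forall p q, P p -> P q -> P (p * q)) -> forall p, P p.
Proof.
move=> PC PX PD PM p; rewrite [p]mpolyE; elim/big_ind: _ => [||m _]; [by rewrite -mpolyC0|by []|].
rewrite -mul_mpolyC; apply: (PM) => //; rewrite mpolyXE_id; elim/big_ind: _ => [||i _]; [by rewrite -mpolyC1|by []|].
by elim: (m i) => [|k IH]; [rewrite expr0 -mpolyC1|rewrite exprS; apply: PM].
Qed.

Lemma muni_max (K : comNzRingType) n : muni ('X_ord_max : {mpoly K[n.+1]}) = 'X.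
Proof.
rewrite /muni mmapX mmap1U; case: splitP => // j /= E.
by have := ltn_ord j; rewrite -E ltnn.
Qed.

Lemma muni_lift (K : comNzRingType) n (i : 'I_n) : muni ('X_(lift ord_max i) : {mpoly K[n.+1]}) = ('X_i)%:P.
Proof.
rewrite /muni mmapX mmap1U; case: splitP => j /=; rewrite /bump leqNgt ltn_ord add0n => E.
  by congr (('X__)%:P); apply: val_inj.
by have := ltn_ord i; rewrite E ltnNge leq_addr.
Qed.

Lemma muni_neq0 (K : idomainType) n (p : {mpoly K[n.+1]}) : p != 0 -> muni p != 0.
Proof.
move=> p0; apply/negP => /eqP E; have mp := mlead_supp p0; set m := mlead p in mp.
have : ((muni p)`_(m ord_max))@_[multinom (m (widen_ord (leqnSn n) i)) | i < n] = p@_m.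
  rewrite muniE coef_sum raddf_sum /= (bigD1_seq m) //= ?msupp_uniq //.
  rewrite coefZ coefXn eqxx mulr1 mcoeffZ mcoeffX eqxx mulr1 big1 ?addr0 // => m' ne.
  rewrite coefZ coefXn; case: eqP => [e1|]; rewrite ?mulr0 ?mcoeff0 // mulr1 mcoeffZ mcoeffX.
  case: eqP => [e2|]; rewrite ?mulr0 //; case/eqP: ne; apply/mnmP => i.
  have [j ->|->] := unliftP ord_max i; last by rewrite e1.
  have := congr1 (fun z : 'X_{1..n} => z j) e2; rewrite !mnmE.
  suff -> : widen_ord (leqnSn n) j = lift ord_max j by [].
  by apply: val_inj; rewrite /= /bump leqNgt ltn_ord.
by rewrite E coef0 mcoeff0 => /esym/eqP; rewrite mcoeff_eq0 mp.
Qed.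

(** * The Schwartz-Zippel bound over a finite subset of the ring *)

Section SchwartzZippel.
Variables (K : idomainType) (F : finType) (e : F -> K).
Hypothesis e_inj : injective e.

Local Notation ev a p := (meval (fun i => e (a i)) p).

Let wid n (i : 'I_n) : 'I_n.+1 := lift ord_max i.
Let ext n (v : {ffun 'I_n -> F} * F) : {ffun 'I_n.+1 -> F} :=
  [ffun i => if unlift ord_max i is Some j then v.1 j else v.2].

Let ext_bij n : bijective (@ext n).
Proof.
exists (fun w : {ffun 'I_n.+1 -> F} => ([ffun i => w (wid i)] : {ffun 'I_n -> F}, w ord_max)) => [[v x]|w].
  congr (_, _); last by rewrite ffunE unlift_none.
  by apply/ffunP=> i; rewrite !ffunE /wid liftK.
by apply/ffunP=> i; rewrite !ffunE; case: unliftP => [j ->|->]; rewrite ?ffunE.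
Qed.

Let muni_ext n (p : {mpoly K[n.+1]}) v :
  ev (ext v) p = (map_poly (meval (fun i => e (v.1 i))) (muni p)).[e v.2].
Proof.
rewrite muniE mevalE rmorph_sum horner_sum; apply: eq_bigr => m _.
rewrite -mul_polyC rmorphM /= map_polyXn map_polyC /= hornerM hornerC hornerXn mevalZ mevalX big_ord_recr /= -mulrA.
rewrite ffunE unlift_none; congr (_ * (_ * _)); apply: eq_bigr => i _; rewrite mnmE.
suff -> : widen_ord (leqnSn n) i = wid i by rewrite ffunE /wid liftK.
by apply: val_inj; rewrite /= /bump leqNgt ltn_ord.
Qed.

Let msize_muni n (p : {mpoly K[n.+1]}) j : (muni p)`_j != 0 -> (msize (muni p)`_j + j <= msize p)%N.
Proof.
move=> q0; set q := (muni p)`_j in q0 *; have mq := mlead_supp q0.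
rewrite -(mlead_deg q0); move: (mlead q) mq => m; rewrite /q muniE coef_sum => /msupp_sum_le /flattenP[/= ms].
case/mapP => m'; rewrite filter_predT => m'p ->.
rewrite coefZ coefXn; case: eqP => [e1|_]; last by rewrite mulr0 msupp0.
rewrite mulr1 => /msuppZ_le; rewrite msuppX inE => /eqP ->.
apply: leq_trans (msize_mdeg_lt m'p); rewrite addSn ltnS !mdegE big_ord_recr /= e1 leq_add2r.
by apply: leq_sum => i _; rewrite mnmE.
Qed.

Lemma card_roots_le (q : {poly K}) : q != 0 -> (#|[pred x | root q (e x)]| <= (size q).-1)%N.
Proof.
move=> q0; rewrite -ltnS prednK ?size_poly_gt0 //.
rewrite cardE -(size_map e); apply: max_poly_roots => //.
  by apply/allP => z /mapP[x]; rewrite mem_enum => xr ->.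
by rewrite map_inj_uniq ?enum_uniq.
Qed.

(** Induction on [n], with [p] read as a polynomial in the last variable: either its leading
    coefficient [l] vanishes, or the number of roots is at most its degree, and the degree of [l]
    and this degree add up to at most that of [p]. The factor [#|F|] on the left avoids an exponent
    [n - 1]. *)
Theorem schwartz_zippel n (p : {mpoly K[n]}) : p != 0 ->
  (#|[pred v : {ffun 'I_n -> F} | ev v p == 0%R]| * #|F| <= (msize p).-1 * #|F| ^ n)%N.
Proof.
elim: n p => [|n IH] p p0.
  rewrite (eq_card (B := pred0)) ?card0 // => v; rewrite !inE.
  by move: p0; rewrite [p]nvar0_mpolyC mevalC mpolyC_eq0 => /negPf.
set u := muni p; have u0 : u != 0 by apply: muni_neq0.
pose l := lead_coef u; have l0 : l != 0 by rewrite lead_coef_eq0.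
have sl : (msize l + (size u).-1 <= msize p)%N by apply: msize_muni.
have cE : #|[pred v : {ffun 'I_n.+1 -> F} | ev v p == 0%R]| =
    \sum_(v : {ffun 'I_n -> F}) #|[pred x | ev (ext (v, x)) p == 0%R]|.
  rewrite -sum1_card big_mkcond (reindex (@ext n)) /=; last by apply: onW_bij; exact: ext_bij.
  under [RHS]eq_bigr do rewrite -sum1_card big_mkcond /=.
  by rewrite pair_bigA /=; apply: eq_bigr => -[v x] _.
pose bad (v : {ffun 'I_n -> F}) := ev v l == 0.
have le : (#|[pred v : {ffun 'I_n.+1 -> F} | ev v p == 0%R]| <=
    #|bad| * #|F| + #|{: {ffun 'I_n -> F}}| * (size u).-1)%N.
  rewrite cE -!sum_nat_const [X in (_ <= X + _)%N]big_mkcond -big_split /=.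
  apply: leq_sum => v _; rewrite unfold_in; case: ifP => [_|bv].
    by apply: leq_trans (leq_addr _ _); apply: max_card.
  rewrite add0n; set q := map_poly (meval (fun i => e (v i))) u.
  have sq : size q = size u by rewrite size_map_poly_id0 // -/l; move: bv; rewrite /bad => ->.
  rewrite -sq; apply: leq_trans (card_roots_le _); last by rewrite -size_poly_gt0 sq size_poly_gt0.
  by apply/subset_leq_card/subsetP => x; rewrite !inE muni_ext.
rewrite card_ffun card_ord in le.
apply: leq_trans (leq_mul le (leqnn _)) _.
rewrite mulnDl -mulnA [X in (_ <= _ * X)%N]expnS.
have := leq_mul (IH l l0) (leqnn #|F|); rewrite -/bad.
have : (0 < msize l)%N by rewrite lt0n msize_poly_eq0.
move: sl; set B := #|_|; set sF := #|F|; set N := (sF ^ n)%N; set d := (size u).-1; move: (msize l) (msize p) => x y.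
clearbody B sF N d => xdy x0 BN; apply: leq_trans (_ : (x.-1 + d) * (sF * N) <= _)%N; last first.
  by rewrite leq_mul2r; apply/orP; right; move: xdy x0; clear; lia.
by move: BN; rewrite mulnDl !mulnA -[(_ * sF * N)%N]mulnA [(sF * N)%N]mulnC mulnA => BN; apply: leq_add => //; rewrite [(N * d)%N]mulnC -!mulnA [(N * sF)%N]mulnC.
Qed.

Lemma exists_nonroot n (p : {mpoly K[n]}) : p != 0 -> ((msize p).-1 < #|F|)%N ->
  exists v : {ffun 'I_n -> F}, ev v p != 0.
Proof.
move=> p0 sp; apply/existsP; apply: contraLR sp; rewrite negb_exists => /forallP h; rewrite -leqNgt.
have := schwartz_zippel p0; rewrite (eq_card (B := predT)) => [|v]; last by rewrite !inE; have := h v; rewrite negbK.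
rewrite card_ffun card_ord mulnC; have [F0|F0] := posnP #|F|; first by rewrite F0.
by rewrite leq_pmul2r // expn_gt0 F0.
Qed.

End SchwartzZippel.

Lemma infinite_nonroot (K : closedFieldType) n (p : {mpoly K[n]}) : p != 0 ->
  exists v : 'I_n -> K, p.@[v] != 0.
Proof.
move=> p0; pose N := msize p.
have [s us ss] : exists2 s : seq K, uniq s & (N < size s)%N.
  elim: (N.+1) => [|k [s us ks]]; first by exists [::].
  have [x xs] : exists x, x \notin s.
    have [x] := closed_nonrootP (\prod_(z <- s) ('X - z%:P)) (monic_neq0 (monic_prod_XsubC _ _ _)).
    by rewrite root_prod_XsubC; exists x.
  by exists (x :: s) => //=; rewrite xs.
have [|v vP] := @exists_nonroot K (seq_sub s) val val_inj n p p0.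
  by rewrite card_seq_sub // (leq_ltn_trans (leq_pred _)).
by exists (fun i => val (v i)).
Qed.

(** * Generic points and specialization *)

Section LiftStep.
Variables (K : closedFieldType) (L : fieldType) (A : comNzRingType).
Variables (H : {rmorphism A -> L}) (eta : {rmorphism A -> K}) (kC : {rmorphism K -> A}).
Hypothesis kCK : forall c, eta (kC c) = c.
Hypothesis kerH : forall a, H a = 0 -> eta a = 0.
Variable z : L.

(* Were the specialisation impossible, a relation [g] of [z] would specialise to [1]; reducing [g]
   modulo [h] and [h] modulo the reversal of [g] lowers the degrees until a constant kills [H]. *)
Let no_unit_relation (g h : {poly A}) : (map_poly H h).[z] = 0 -> eta (lead_coef h) != 0 ->
  (map_poly H g).[z] = 0 -> map_poly eta g = 1 -> False.
Proof.
have [z0|z0] := eqVneq z 0.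
  move=> _ _ gz g1; have g0 : H g`_0 = 0 by move: gz; rewrite z0 horner_coef0 coef_map.
  have e0 : eta g`_0 = 1 by rewrite -coef_map g1 coef1.
  by move: e0; rewrite (kerH g0) => /esym/eqP; rewrite oner_eq0.
have [m] := ubnP (size g + size h); elim: m g h => // m IH g h sm hz eta_lead gz g1.
have g00 : eta g`_0 = 1 by rewrite -coef_map g1 coef1.
have h0 : h != 0 by apply: contraNneq eta_lead => ->; rewrite lead_coef0 rmorph0.
have g0 : g != 0 by apply/eqP => E; move/eqP: g00; rewrite E coef0 rmorph0 eq_sym oner_eq0.
have [le|lt] := leqP (size h) (size g).
- have [sg|sg] := leqP (size g) 1.
    move: gz; rewrite (size1_polyC sg) map_polyC hornerC => /kerH E.
    by move: g00; rewrite E => /esym/eqP; rewrite oner_eq0.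
  pose c := lead_coef h; pose k := (size g - size h)%N.
  (* The leading terms cancel. As [eta] kills the leading coefficient of [g], the image of the
     combination is the constant [eta c], which is scaled back to 1. *)
  pose g' := (kC (eta c)^-1)%:P * (c%:P * g - (lead_coef g)%:P * h * 'X^k).
  have etag : eta (lead_coef g) = 0.
    by rewrite -coef_map g1 coef1; case: (size g) sg => // -[].
  apply: (IH g' h) => //.
  + suff : (size g' < size g)%N by move: sm; clear; lia.
    apply: leq_ltn_trans (_ : ((size g).-1 < size g)%N); last by rewrite prednK ?size_poly_gt0.
    apply/leq_sizeP => j; rewrite leq_eqVlt => /orP[/eqP <-|jg]; rewrite coefCM coefB !coefCM -mulrA coefCM coefMXn.
      have -> : ((size g).-1 < k)%N = false by apply/negbTE; rewrite -leqNgt /k; move: le h0 g0; rewrite -!size_poly_gt0; clear; lia.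
      have -> : ((size g).-1 - k = (size h).-1)%N by rewrite /k; move: le h0 g0; rewrite -!size_poly_gt0; clear; lia.
      by rewrite -[g`_ _]/(lead_coef g) -[h`_ _]/(lead_coef h) -/c [c * _]mulrC subrr mulr0.
    rewrite [g`_j]nth_default; last by rewrite -(prednK (_ : 0 < size g)%N) // ltnW.
    case: ifP => _; first by rewrite !mulr0 subrr mulr0.
    suff jk : (size h <= j - k)%N by rewrite [h`_ _]nth_default // !mulr0 subrr mulr0.
    have {}sg : (0 < size g)%N by rewrite size_poly_gt0.
    rewrite leq_subRL; last by rewrite /k; move: jg; clear; lia.
    by rewrite /k subnK // -(prednK sg).
  + by rewrite rmorphM rmorphB !rmorphM !hornerE gz hz; ring.
  + rewrite rmorphM rmorphB !rmorphM /= !map_polyC /= g1 etag kCK polyC0 !mul0r subr0 mulr1.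
    by rewrite -polyCM mulVf.
- have [sh|sh] := leqP (size h) 1.
    move: hz; rewrite (size1_polyC sh) map_polyC hornerC => /kerH E.
    by move: eta_lead; rewrite (size1_polyC sh) lead_coefC E eqxx.
  (* Here the constant terms cancel, and [X] can be divided out because [z] is nonzero; [eta] maps
     the constant term of [g] to 1, so the leading coefficient of [h] keeps its image. *)
  pose q := (g`_0)%:P * h - (h`_0)%:P * g.
  have q0 : q`_0 = 0 by rewrite coefB !coefCM mulrC subrr.
  pose h' := \poly_(i < (size h).-1) q`_i.+1.
  have qE : q = h' * 'X.
    apply/polyP=> -[|i]; rewrite coefMX //= coef_poly; case: ltnP => // le.
    rewrite nth_default //; apply: leq_trans (_ : (size h <= _)%N); last by move: le; clear; lia.
    apply: leq_trans (size_polyD _ _) _; rewrite size_polyN geq_max; apply/andP; split.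
      by rewrite mul_polyC size_scale_leq.
    by rewrite mul_polyC (leq_trans (size_scale_leq _ _)) // ltnW.
  have ls : eta h'`_(size h).-2 = eta (lead_coef h).
    rewrite coef_poly; have -> : ((size h).-2 < (size h).-1)%N by move: sh; clear; lia.
    have -> : ((size h).-2.+1 = (size h).-1)%N by move: sh; clear; lia.
    rewrite coefB !coefCM rmorphB !rmorphM g00 mul1r.
    have -> : eta g`_(size h).-1 = 0.
      by rewrite -coef_map g1 coef1; case: (size h) sh => // -[].
    by rewrite mulr0 subr0.
  have sh' : size h' = (size h).-1.
    apply/eqP; rewrite eqn_leq size_poly /= leqNgt; apply/negP => l.
    move: ls; rewrite nth_default ?rmorph0; first by move=> /esym/eqP; rewrite (negPf eta_lead).
    by move: l sh; case: (size h) => [|[|k]] //=.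
  apply: (IH g h') => //.
  + by rewrite sh'; move: sm sh; clear; case: (size h) => [|k] //=; rewrite addnS.
  + have : (map_poly H q).[z] = 0 by rewrite rmorphB !rmorphM !hornerE gz hz; ring.
    by rewrite qE rmorphM /= map_polyX hornerMX => /eqP; rewrite mulf_eq0 (negPf z0) orbF => /eqP.
  + by rewrite /lead_coef sh' ls.
Qed.

Variable h : {poly A}.
Hypotheses (hz : (map_poly H h).[z] = 0) (eta_lead : eta (lead_coef h) != 0).

(** The images under [eta] of the relations of [z] form an ideal of [K[X]], nonzero because of [h]
    and proper by [no_unit_relation]; any root of its generator is a value for [z]. *)
Lemma lift_step : exists rho : K, forall g : {poly A}, (map_poly H g).[z] = 0 -> (map_poly eta g).[rho] = 0.
Proof.
pose J (q : {poly K}) := exists g : {poly A}, (map_poly H g).[z] = 0 /\ map_poly eta g = q.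
have JM a q : J q -> J (a * q).
  move=> [g [gz <-]]; exists (map_poly kC a * g); split; first by rewrite rmorphM hornerM gz mulr0.
  rewrite rmorphM /=; congr (_ * _); rewrite -map_poly_comp (eq_map_poly (g := id)) ?map_poly_id // => x /=; exact: kCK.
have JB q q' : J q -> J q' -> J (q - q').
  by move=> [g [gz <-]] [g' [gz' <-]]; exists (g - g'); rewrite !rmorphB hornerD hornerN gz gz' subrr.
have Jh : J (map_poly eta h) by exists h.
have h0 : map_poly eta h != 0 by rewrite map_poly_eq0_id0 //; apply: contraNneq eta_lead => ->; rewrite lead_coef0 rmorph0.
have [d [d0 Jd dmin]] : exists d, [/\ d != 0, J d & forall q, J q -> q != 0 -> (size d <= size q)%N].
  move: (map_poly eta h) h0 Jh => q; have [m] := ubnP (size q); elim: m q => // m IH q sq q0 Jq.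
  have [[q' [Jq' q'0 lt]]|no] := classic (exists q', [/\ J q', q' != 0 & (size q' < size q)%N]).
    by apply: (IH q') => //; apply: leq_trans lt _.
  exists q; split=> // q' Jq' q'0; rewrite leqNgt; apply/negP => lt; apply: no; exists q'; by split.
have dJ q : J q -> d %| q.
  move=> Jq; apply/negPn/negP => nd.
  have Jr : J (q %% d).
    have -> : q %% d = q - q %/ d * d by rewrite [X in X - _](divp_eq q d) addrC addKr.
    by apply: JB => //; exact: JM.
  by have := dmin _ Jr nd; rewrite leqNgt ltn_modp d0.
have [|rho rd] := closed_rootP d _.
  apply: contraTN isT => /size_poly1P[c c0 dE]; have [g [gz g1]] : J 1.
    by rewrite (_ : 1 = (c^-1)%:P * d); [exact: JM | rewrite dE -polyCM mulVf].
  by case: (no_unit_relation hz eta_lead gz g1).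
exists rho => g gz; have /dvdpP[q ->] : d %| map_poly eta g by apply: dJ; exists g.
by rewrite hornerM (eqP rd) mulr0.
Qed.

End LiftStep.

(* [B] is the subring of [L] generated by [A] and finitely many algebraic elements, presented. *)
Theorem lift_seq (K : closedFieldType) (L : fieldType) (A : comNzRingType)
  (H : {rmorphism A -> L}) (eta : {rmorphism A -> K}) (kC : {rmorphism K -> A}) (zs : seq L) :
  (forall c, eta (kC c) = c) -> (forall a, H a = 0 -> eta a = 0) ->
  (forall z, z \in zs -> exists h : {poly A}, (map_poly H h).[z] = 0 /\ eta (lead_coef h) != 0) ->
  exists (B : comNzRingType) (HB : {rmorphism B -> L}) (etaB : {rmorphism B -> K}) (i : {rmorphism A -> B}),
    [/\ forall a, HB (i a) = H a, forall a, etaB (i a) = eta a, forall b, HB b = 0 -> etaB b = 0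
      & forall z, z \in zs -> exists b, HB b = z].
Proof.
elim: zs A H eta kC => [|z zs IH] A H eta kC kCK kerH Hz.
  by exists A, H, eta, idfun; split.
have [h [hz hl]] := Hz z (mem_head _ _).
have [rho rhoP] := lift_step kCK kerH hz hl.
pose H' : {rmorphism {poly A} -> L} := (horner_eval z \o map_poly H)%FUN.
pose eta' : {rmorphism {poly A} -> K} := (horner_eval rho \o map_poly eta)%FUN.
pose kC' : {rmorphism K -> {poly A}} := (polyC \o kC)%FUN.
have C1 a : H' a%:P = H a by rewrite /= map_polyC /horner_eval hornerC.
have C2 a : eta' a%:P = eta a by rewrite /= map_polyC /horner_eval hornerC.
have [||y yzs|B [HB [eB [i [H1 H2 H3 H4]]]]] := IH {poly A} H' eta' kC'.
- by move=> c; rewrite -[kC' c]/((kC c)%:P) C2.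
- by move=> g; exact: rhoP.
- have yz : y \in z :: zs by rewrite inE yzs orbT.
  have [g [gy gl]] := Hz y yz.
  exists (map_poly polyC g); split.
    by rewrite -map_poly_comp (eq_map_poly (g := H)).
  by rewrite lead_coef_map_inj ?C2 //; exact: polyC_inj.
exists B, HB, eB, (i \o polyC)%FUN; split=> //.
- by move=> a; rewrite /= H1 C1.
- by move=> a; rewrite /= H2 C2.
- move=> y; rewrite inE => /orP[/eqP ->|/H4 //].
  by exists (i 'X); rewrite H1 /= map_polyX /horner_eval hornerX.
Qed.

(** * Residue fields of prime ideals *)

Section PrimeIdeals.
Local Open Scope quotient_scope.

Section Fraction.
Variables (R : idomainType) (L : fieldType) (H : {rmorphism R -> L}).
Hypothesis injH : forall x, H x = 0 -> x = 0.
Local Notation "x %:F" := (@FracField.tofrac R x).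

Let fracE (x : {fraction R}) : x = (\n_(generic_quotient.repr x))%:F / (\d_(generic_quotient.repr x))%:F.
Proof.
have d0 : (\d_(generic_quotient.repr x))%:F != 0 by rewrite tofrac_eq0 denom_ratioP.
apply: (mulIf d0); rewrite divfK // -{1}[x]reprK !piE.
apply/eqmodP; rewrite /= /FracField.equivf /= /FracField.mulf.
by rewrite !numden_Ratio ?oner_neq0 ?mulr1 ?denom_ratioP // mulrC.
Qed.

Lemma fraction_numden (x : {fraction R}) : exists n d : R, d != 0 /\ x = n%:F / d%:F.
Proof.
by exists (\n_(generic_quotient.repr x)), (\d_(generic_quotient.repr x)); rewrite -fracE denom_ratioP.
Qed.

Let HF n d n' d' : d != 0 -> d' != 0 -> n%:F / d%:F = n'%:F / d'%:F -> H n / H d = H n' / H d'.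
Proof.
move=> d0 d'0 E; have Hn z : z != 0 -> H z != 0 by apply: contra_neq; apply: injH.
apply/eqP; rewrite eqr_div ?Hn // -!rmorphM; apply/eqP; congr (H _); apply/eqP.
by rewrite -tofrac_eq !tofracM -eqr_div ?tofrac_eq0 //; apply/eqP.
Qed.

Lemma fraction_lift : exists G : {rmorphism {fraction R} -> L}, forall x, G x%:F = H x.
Proof.
pose g (x : {fraction R}) : L := H \n_(generic_quotient.repr x) / H \d_(generic_quotient.repr x).
have gE x n d : d != 0 -> x = n%:F / d%:F -> g x = H n / H d.
  by move=> d0 xE; apply: HF => //; [exact: denom_ratioP | rewrite -fracE].
have Hn z : z != 0 -> H z != 0 by apply: contra_neq; apply: injH.
have gB : zmod_morphism g.
  move=> x y; have [n [d [d0 xE]]] := fraction_numden x; have [m [e [e0 yE]]] := fraction_numden y.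
  rewrite (gE x n d) // (gE y m e) // (gE (x - y) (n * e - m * d) (d * e)) ?mulf_neq0 //.
    by rewrite rmorphB !rmorphM /= -[in RHS]mulNr addf_div ?Hn // mulNr.
  by rewrite xE yE tofracB !tofracM -[in LHS]mulNr addf_div ?tofrac_eq0 // mulNr.
have gM : monoid_morphism g.
  split; first by rewrite (gE 1 1 1) ?oner_neq0 ?rmorph1 ?divr1 // tofrac1 divr1.
  move=> x y; have [n [d [d0 xE]]] := fraction_numden x; have [m [e [e0 yE]]] := fraction_numden y.
  rewrite (gE x n d) // (gE y m e) // (gE (x * y) (n * m) (d * e)) ?mulf_neq0 //.
    by rewrite !rmorphM /= mulf_div.
  by rewrite xE yE !tofracM mulf_div.
pose G : {rmorphism {fraction R} -> L} := HB.pack g (GRing.isZmodMorphism.Build _ _ g gB) (GRing.isMonoidMorphism.Build _ _ g gM).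
exists G => x; rewrite /= (gE _ x 1) ?oner_neq0 ?rmorph1 ?divr1 //.
Qed.

Lemma clear_denominators (p : {poly {fraction R}}) :
  exists2 d : R, d != 0 & exists h : {poly R}, map_poly (@FracField.tofrac R) h = d%:F *: p.
Proof.
elim/poly_ind: p => [|p c [d d0 [h hE]]].
  by exists 1; rewrite ?oner_neq0 //; exists 0; rewrite rmorph0 scaler0.
have [n [e [e0 cE]]] := fraction_numden c.
exists (d * e); first by rewrite mulf_neq0.
exists (e *: h * 'X + (d * n)%:P).
rewrite rmorphD rmorphM /= map_polyZ map_polyX map_polyC /= hE cE tofracM scalerDr; congr (_ + _).
  by rewrite scalerA scalerAl tofracM [_%:F * _]mulrC.
rewrite -mul_polyC -polyCM !tofracM; congr (_%:P).
by rewrite -mulrA; congr (_ * _); rewrite mulrC divfK // tofrac_eq0.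
Qed.

End Fraction.

(** [L] is the fraction field of the quotient by [I]. Excluded middle turns membership in [I] into a
    boolean predicate and picks the inverses that the quotient needs as a unit ring. *)
Lemma prime_field (R : comNzRingType) (I : R -> Prop) :
  I 0 -> (forall a x y, I x -> I y -> I (a * x + y)) -> ~ I 1 ->
  (forall x y, I (x * y) -> I x \/ I y) ->
  exists (L : fieldType) (H : {rmorphism R -> L}), forall x, H x = 0 <-> I x.
Proof.
move=> I0 IL I1 IM; pose S : {pred R} := fun x => if excluded_middle_informative (I x) then true else false.
have SP x : reflect (I x) (x \in S).
  by rewrite unfold_in; case: excluded_middle_informative => h; constructor.
have Sid : idealr_closed S.
  split; first exact/SP.
    by apply/SP.
  by move=> a u v /SP Iu /SP Iv; apply/SP; exact: IL.
have Spr : prime_idealr_closed S.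
  by move=> u v /SP /IM[h|h]; apply/orP; [left|right]; apply/SP.
pose P : prime_idealr R := HB.pack S (isIdealr.Build R S Sid) (isPrimeIdealrClosed.Build R S Spr).
pose Q : comNzRingType := {ideal_quot P}.
pose pi : {rmorphism R -> Q} := \pi_Q.
have piE x : pi x = 0 <-> I x.
  rewrite -[0](rmorph0 pi); split=> [/eqP|/SP Ix].
    by rewrite -Quotient.idealrBE subr0 => /SP.
  by apply/eqP; rewrite -Quotient.idealrBE subr0.
pose unitQ : pred Q := fun x => if excluded_middle_informative (exists y, y * x = 1) then true else false.
pose invQ (x : Q) : Q := if excluded_middle_informative (exists y, y * x = 1) is left e
  then proj1_sig (constructive_indefinite_description _ e) else x.
have mulVx : {in unitQ, left_inverse 1 invQ *%R}.
  move=> x; rewrite unfold_in /unitQ /invQ; case: excluded_middle_informative => // e _.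
  by case: constructive_indefinite_description.
have unitP : forall x y : Q, y * x = 1 -> unitQ x.
  by move=> x y e; rewrite /unitQ; case: excluded_middle_informative => // -[]; exists y.
have invQout : {in [predC unitQ], invQ =1 id}.
  by move=> x; rewrite inE unfold_in /unitQ /invQ; case: excluded_middle_informative.
pose U : comUnitRingType := HB.pack (Q : Type) (GRing.ComNzRing.on Q)
  (GRing.ComNzRing_hasMulInverse.Build Q mulVx unitP invQout).
have dom : GRing.integral_domain_axiom U.
  move=> x y; rewrite -[x](reprK (x : Q)) -[y](reprK (y : Q)) => E.
  have /IM[/piE h|/piE h] : I (repr (x : Q) * repr (y : Q)) by apply/piE; rewrite rmorphM.
    by apply/orP; left; apply/eqP.
  by apply/orP; right; apply/eqP.
pose Dm : idomainType := HB.pack (U : Type) (GRing.ComUnitRing.on U) (GRing.ComUnitRing_isIntegral.Build U dom).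
exists {fraction Dm}, (@FracField.tofrac Dm \o (pi : {rmorphism R -> Dm}))%FUN => x.
rewrite /= -piE; split=> [/eqP|->]; last by rewrite tofrac0.
by rewrite tofrac_eq0 => /eqP.
Qed.

(* An ideal disjoint from a multiplicative set lies in a prime ideal disjoint from it: take a maximal one. *)
Lemma prime_avoidance (R : comNzRingType) (I S : R -> Prop) :
  I 0 -> (forall a x y, I x -> I y -> I (a * x + y)) ->
  S 1 -> (forall x y, S x -> S y -> S (x * y)) -> (forall x, I x -> S x -> False) ->
  exists P : R -> Prop, [/\ (forall x, I x -> P x),
    forall a x y, P x -> P y -> P (a * x + y), forall x, P x -> S x -> False
    & forall x y, P (x * y) -> P x \/ P y].
Proof.
move=> I0 IL S1 SM IS.
pose good (P : R -> Prop) := [/\ (forall x, I x -> P x),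
    (forall a x y, P x -> P y -> P (a * x + y)) & forall x, P x -> S x -> False].
have gI : good I by split.
have [|||M Mmax] := @classical_sets.ZL_preorder {P | good P} (exist good I gI)
    (fun P Q => boolp.asbool (forall x, sval P x -> sval Q x)).
- by move=> P; apply/boolp.asboolP.
- by move=> P Q T /boolp.asboolP h1 /boolp.asboolP h2; apply/boolp.asboolP => x /h1/h2.
- move=> C Ctot; have [[P0 CP0]|no] := classic (exists P, C P); last first.
    by exists (exist good I gI) => P CP; case: no; exists P.
  pose U x := exists P, C P /\ sval P x.
  have gU : good U.
    split.
    - by move=> x Ix; exists P0; split=> //; case: (svalP P0) => h _ _; exact: h.
    - move=> a x y [P [CP Px]] [Q [CQ Qy]].
      have [/boolp.asboolP h|/boolp.asboolP h] := Ctot P Q CP CQ.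
        by exists Q; split=> //; case: (svalP Q) => _ L _; apply: L => //; exact: h.
      by exists P; split=> //; case: (svalP P) => _ L _; apply: L => //; exact: h.
    - by move=> x [P [_ Px]]; case: (svalP P) => _ _; apply.
  by exists (exist good U gU) => P CP; apply/boolp.asboolP => x Px; exists P.
have [IP PL PS] := svalP M; set P := sval M in IP PL PS.
have P0 : P 0 by exact: IP.
have ext z : ~ P z -> exists a b, [/\ P a & S (a + b * z)].
  move=> nPz; apply: NNPP => no; apply: nPz.
  pose Q x := exists a b, P a /\ x = a + b * z.
  have gQ : good Q.
    split.
    - by move=> x Ix; exists x, 0; rewrite mul0r addr0; split=> //; exact: IP.
    - move=> c _ _ [a [b [Pa ->]]] [a' [b' [Pa' ->]]]; exists (c * a + a'), (c * b + b'); split; first exact: PL.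
      by ring.
    - by move=> x [a [b [Pa xE]]] Sx; apply: no; exists a, b; rewrite -xE.
  have /boolp.asboolP : boolp.asbool (forall x, Q x -> P x).
    by apply: (Mmax (exist good Q gQ)); apply/boolp.asboolP => x /= Px; exists x, 0; rewrite mul0r addr0.
  apply.
  by exists 0, 1; rewrite mul1r add0r.
exists P; split=> // x y Pxy; apply: NNPP => /not_or_and[nx ny].
have [a [b [Pa Sa]]] := ext x nx; have [a' [b' [Pa' Sa']]] := ext y ny.
apply: (PS _ _ (SM _ _ Sa Sa')).
have -> : (a + b * x) * (a' + b' * y) = (a' + b' * y) * a + ((b * x) * a' + ((b * b') * (x * y) + 0)) by ring.
exact: (PL _ _ _ Pa (PL _ _ _ Pa' (PL _ _ _ Pxy P0))).
Qed.

End PrimeIdeals.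

Definition msub (K : comNzRingType) n r (t : 'I_r -> {mpoly K[n]}) : {mpoly K[r]} -> {mpoly K[n]} :=
  mmap (@mpolyC n K) t.
HB.instance Definition _ (K : comNzRingType) n r (t : 'I_r -> {mpoly K[n]}) := GRing.RMorphism.on (msub t).

Lemma msubC (K : comNzRingType) n r (t : 'I_r -> {mpoly K[n]}) c : msub t c%:MP = c%:MP.
Proof. exact: mmapC. Qed.

Lemma msubX (K : comNzRingType) n r (t : 'I_r -> {mpoly K[n]}) i : msub t 'X_i = t i.
Proof. by rewrite /msub mmapX mmap1U. Qed.

Lemma meval_msub (K : comNzRingType) n r (t : 'I_r -> {mpoly K[n]}) v q :
  (msub t q).@[v] = q.@[fun i => (t i).@[v]].
Proof.
rewrite -[LHS]/((meval v \o msub t)%FUN q); apply: rmorph_mpoly_eq => [c|i] /=.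
  by rewrite msubC !mevalC.
by rewrite msubX mevalXU.
Qed.

(** * Transcendence bases and the Nullstellensatz *)

Section Generic.
Variables (K : closedFieldType) (n : nat) (L : fieldType) (H : {rmorphism {mpoly K[n]} -> L}).

(** A generic point is encoded as a morphism [H] into a field: its kernel is a prime ideal, and this
    is the variety of that ideal. *)
Definition zeros (x : 'rV[K]_n) := forall g, H g = 0 -> g.@[x 0] = 0.

Definition indep r (t : 'I_r -> {mpoly K[n]}) := forall q, H (msub t q) = 0 -> q = 0.

Definition alg r (t : 'I_r -> {mpoly K[n]}) (z : L) :=
  exists2 h : {poly {mpoly K[r]}}, h != 0 & (map_poly (H \o msub t) h).[z] = 0.

Lemma constH c : H c%:MP = 0 -> c = 0.
Proof. by move/eqP; rewrite -[H _]/((H \o @mpolyC n K)%FUN c) fmorph_eq0 => /eqP. Qed.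

Section Closure.
Variables (r : nat) (t : 'I_r -> {mpoly K[n]}).
Hypothesis it : indep t.

(** Clearing denominators identifies [alg] with algebraicity over the fraction field, whose closure
    properties are then inherited. *)
Lemma algP : exists G : {rmorphism {fraction {mpoly K[r]}} -> L},
  (forall q, G (FracField.tofrac q) = H (msub t q)) /\ forall z, alg t z <-> algebraicOver G z.
Proof.
have [G GE] := @fraction_lift _ _ (H \o msub t)%FUN it.
have mE h : map_poly G (map_poly (@FracField.tofrac _) h) = map_poly (H \o msub t) h.
  by rewrite -map_poly_comp; apply: eq_map_poly => x /=; exact: GE.
exists G; split=> // z; split=> [[h h0 hz]|[p p0 pz]].
  exists (map_poly (@FracField.tofrac _) h); last by rewrite mE rootE hz.
  by rewrite map_poly_eq0_id0 // tofrac_eq0 lead_coef_eq0.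
have [d d0 [h hE]] := clear_denominators p; exists h.
  apply: contraTneq isT => h0; move: hE; rewrite h0 rmorph0 => /esym/eqP.
  by rewrite scaler_eq0 tofrac_eq0 (negPf d0) (negPf p0).
by rewrite -mE hE map_polyZ hornerZ (eqP pz) mulr0.
Qed.

Lemma alg_msub q : alg t (H (msub t q)).
Proof. by have [G [GE ->]] := algP; rewrite -GE; exact: algebraic_id. Qed.

Lemma alg_const c : alg t (H c%:MP). Proof. by have := alg_msub c%:MP; rewrite msubC. Qed.

Lemma alg_add x y : alg t x -> alg t y -> alg t (x + y).
Proof. by have [G [_ E]] := algP; rewrite !E; exact: algebraic_add. Qed.

Lemma alg_sub x y : alg t x -> alg t y -> alg t (x - y).
Proof. by have [G [_ E]] := algP; rewrite !E; exact: algebraic_sub. Qed.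

Lemma alg_mul x y : alg t x -> alg t y -> alg t (x * y).
Proof. by have [G [_ E]] := algP; rewrite !E; exact: algebraic_mul. Qed.

Lemma alg_root (p : {poly L}) z : p != 0 -> root p z -> (forall i, alg t p`_i) -> alg t z.
Proof.
have [G [_ E]] := algP; rewrite E => p0 pz h; apply/integral_algebraic; apply: integral_root p0 pz _.
by move=> x /(nthP 0)[i _ <-]; apply/integral_algebraic/E.
Qed.

Lemma alg_all : (forall j, alg t (H 'X_j)) -> forall g, alg t (H g).
Proof.
move=> h; apply: mpoly_alg_ind => [c|//|p q|p q]; first exact: alg_const.
  by rewrite rmorphD; exact: alg_add.
by rewrite rmorphM; exact: alg_mul.
Qed.

(** Powers of [X] can be divided out because [z] is nonzero. The constant term is then a nonzero
    polynomial in the parameters that vanishes wherever a function with value [z] does. *)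
Lemma alg_constant_term z : z != 0 -> alg t z ->
  exists2 h : {poly {mpoly K[r]}}, h`_0 != 0 & (map_poly (H \o msub t) h).[z] = 0.
Proof.
move=> z0 [h]; have [m] := ubnP (size h); elim: m h => // m IH; elim/poly_ind=> [|q c _]; first by rewrite eqxx.
move=> sz q0 E; have [c0|c0] := eqVneq c 0; last by exists (q * 'X + c%:P); rewrite // coefD coefMX coefC add0r.
have {}q0 : q != 0 by apply: contraNneq q0 => ->; rewrite c0 mul0r addr0.
apply: (IH q) => //; first by move: sz; rewrite c0 addr0 size_mulX.
move: E; rewrite c0 addr0 rmorphM /= map_polyX hornerMX => /eqP.
by rewrite mulf_eq0 (negPf z0) orbF => /eqP.
Qed.

End Closure.

(** The coordinates [H 'X_j] are adjoined to [A] by [lift_seq]; their specialised values are the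
    coordinates of [x], and every relation among the generic coordinates specialises with them. *)
Lemma lift_points (A : comNzRingType) (al : {rmorphism A -> {mpoly K[n]}})
  (eta : {rmorphism A -> K}) (kC : {rmorphism K -> A}) :
  (forall c, eta (kC c) = c) -> (forall c, al (kC c) = c%:MP) -> (forall a, H (al a) = 0 -> eta a = 0) ->
  (forall j, exists h : {poly A}, (map_poly (H \o al) h).[H 'X_j] = 0 /\ eta (lead_coef h) != 0) ->
  exists2 x, zeros x & forall a, (al a).@[x 0] = eta a.
Proof.
move=> kCK alK ker rel.
have [//|//|z|B [HB [eB [i [H1 H2 H3 H4]]]]] :=
    @lift_seq K L A (H \o al)%FUN eta kC [seq H 'X_j | j <- enum 'I_n].
  by case/mapP => j _ ->; exact: rel.
have /fin_all_exists[b bE] : forall j : 'I_n, exists b, HB b = H 'X_j.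
  by move=> j; apply: H4; apply: map_f; rewrite mem_enum.
pose x : 'rV[K]_n := \row_j eB (b j).
pose S : {rmorphism {mpoly K[n]} -> B} := mmap (i \o kC) b.
have SC c : S c%:MP = i (kC c) by rewrite /S /= mmapC.
have SX j : S 'X_j = b j by rewrite /S /= mmapX mmap1U.
have HS g : HB (S g) = H g.
  rewrite -[LHS]/((HB \o S)%FUN g); apply: rmorph_mpoly_eq => [c|j]; first by rewrite [LHS]/= SC H1 /= alK.
  by rewrite [LHS]/= SX bE.
have eS g : eB (S g) = g.@[x 0].
  rewrite -[LHS]/((eB \o S)%FUN g) -[RHS]/(meval (x 0) g); apply: rmorph_mpoly_eq => [c|j]; first by rewrite /= SC H2 kCK mevalC.
  by rewrite /= SX mevalXU mxE.
exists x => [g Hg|a]; first by rewrite -eS; apply: H3; rewrite HS.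
rewrite -eS -H2; apply/eqP; rewrite -subr_eq0 -rmorphB; apply/eqP/H3.
by rewrite rmorphB HS H1 subrr.
Qed.

Lemma lift_generic r (t : 'I_r -> {mpoly K[n]}) : indep t -> (forall j, alg t (H 'X_j)) ->
  exists2 l : {mpoly K[r]}, l != 0 &
    forall v, l.@[v] != 0 -> exists2 x, zeros x & forall i, (t i).@[x 0] = v i.
Proof.
move=> it /fin_all_exists2[h h0 hz]; exists (\prod_j lead_coef (h j)).
  by apply/prodf_neq0 => j _; rewrite lead_coef_eq0.
move=> v; rewrite rmorph_prod => /prodf_neq0 lv.
have [c|c|q /it ->|j|x Vx xE] := @lift_points _ (msub t) (meval v) (@mpolyC r K).
- exact: mevalC.
- exact: msubC.
- exact: meval0.
- by exists (h j); split; [exact: hz|apply: lv].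
by exists x => // i; have /= := xE 'X_i; rewrite msubX mevalXU.
Qed.

Definition coords r (s : 'I_r -> 'I_n) : 'I_r -> {mpoly K[n]} := fun i => 'X_(s i).

Lemma indep_inj r (s : 'I_r -> 'I_n) : indep (coords s) -> injective s.
Proof.
move=> is_ i j E; apply/eqP; apply: contraTT isT => ne.
have /is_ /mpolyP/(_ U_(i)%MM) : H (msub (coords s) ('X_i - 'X_j)) = 0.
  by rewrite rmorphB /= !msubX /coords E subrr rmorph0.
by rewrite mcoeffB !mcoeffXU eqxx eq_sym (negPf ne) subr0 mcoeff0 => /eqP; rewrite oner_eq0.
Qed.

Lemma indep_size r (s : 'I_r -> 'I_n) : indep (coords s) -> (r <= n)%N.
Proof. by move/indep_inj/leq_card; rewrite !card_ord. Qed.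

Definition coords_basis r (s : 'I_r -> 'I_n) := indep (coords s) /\ forall j, alg (coords s) (H 'X_j).

(** A relation among the chosen coordinates and ['X_j], read as a polynomial in the last variable,
    is an equation for ['X_j]. *)
Lemma maximal_basis r (s : 'I_r -> 'I_n) : indep (coords s) ->
  (forall s' : 'I_r.+1 -> 'I_n, ~ indep (coords s')) -> coords_basis s.
Proof.
move=> is_ mx; split=> // j.
pose s' (i : 'I_r.+1) := if unlift ord_max i is Some k then s k else j.
apply: NNPP => nalg; apply: (mx s') => q E; apply: NNPP => /eqP q0; apply: nalg.
exists (muni q); first exact: muni_neq0.
rewrite -[RHS]E -[LHS]/((horner_eval (H 'X_j) \o map_poly (H \o msub (coords s)) \o @muni r K)%FUN q).
rewrite -[RHS]/((H \o msub (coords s'))%FUN q).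
apply: rmorph_mpoly_eq => [c|i] /=; first by rewrite muniC map_polyC /horner_eval hornerC /= !msubC.
have [k ->|->] := unliftP ord_max i.
  by rewrite muni_lift map_polyC /horner_eval hornerC /= !msubX /coords /s' liftK.
by rewrite muni_max map_polyX /horner_eval hornerX msubX /coords /s' unlift_none.
Qed.

Lemma indep0 (s : 'I_0 -> 'I_n) : indep (coords s).
Proof. by move=> q; rewrite [q]nvar0_mpolyC msubC => /constH ->; rewrite mpolyC0. Qed.

Lemma basis_above r (s : 'I_r -> 'I_n) : indep (coords s) ->
  exists m (s' : 'I_m -> 'I_n), (r <= m)%N /\ coords_basis s'.
Proof.
move=> is_; have [k] := ubnP (n - r)%N; elim: k r s is_ => // k IH r s is_ lt.
have [[s' is']|no] := classic (exists s' : 'I_r.+1 -> 'I_n, indep (coords s')).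
  have [|m [s2 [le b2]]] := IH _ s' is'; first by have := indep_size is'; move: lt; clear; lia.
  by exists m, s2; split=> //; apply: ltnW.
by exists r, s; split=> //; apply: maximal_basis => // s' is'; apply: no; exists s'.
Qed.

(** The Nullstellensatz for a prime ideal. Parameters [v] are chosen off the zeros of [l], so that a
    point lies above them, and off the zeros of the constant term of an equation for [H g]; at that
    point [g] cannot vanish. *)
Lemma nonvanishing (g : {mpoly K[n]}) : H g != 0 -> exists2 x, zeros x & g.@[x 0] != 0.
Proof.
move=> g0; have [m [s [_ [is_ alg_s]]]] := basis_above (@indep0 (fun i => match notF (ltn_ord i) with end)).
have [h h0 hg] := alg_constant_term g0 (alg_all is_ alg_s g).
have [l l0 lP] := lift_generic is_ alg_s.
have [v] := infinite_nonroot (mulf_neq0 l0 h0); rewrite mevalM mulf_eq0 negb_or => /andP[lv hv].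
have [x Vx xE] := lP v lv; exists x => //; apply: contra hv => /eqP gx.
pose P := horner (map_poly (msub (coords s)) h) g.
have : H P = 0 by rewrite /P -horner_map -map_poly_comp.
move/Vx; rewrite /P -horner_map /= gx horner_coef0 !coef_map /= meval_msub => <-.
by apply/eqP; apply: meval_eq => i; rewrite xE.
Qed.

End Generic.

Lemma meval_muni (K : comNzRingType) n (p : {mpoly K[n.+1]}) (w : 'I_n.+1 -> K) :
  p.@[w] = (map_poly (meval (fun i => w (lift ord_max i))) (muni p)).[w ord_max].
Proof.
rewrite -[LHS]/(meval w p) -[RHS]/((horner_eval (w ord_max) \o map_poly (meval (fun i => w (lift ord_max i))) \o @muni n K)%FUN p).
apply: rmorph_mpoly_eq => [c|i] /=; first by rewrite muniC map_polyC /horner_eval hornerC /= !mevalC.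
have [k ->|->] := unliftP ord_max i; first by rewrite muni_lift map_polyC /horner_eval hornerC /= !mevalXU.
by rewrite muni_max map_polyX /horner_eval hornerX mevalXU.
Qed.

Section Lists.
Variables (R : Type) (K : comNzRingType) (n : nat).

Definition mpoly_of (f : R -> K) (P : Defs.mpoly R n) : {mpoly K[n]} :=
  \sum_(m <- P) f m.1 *: 'X_[[multinom m.2 i | i < n]].

Lemma meval_mpoly_of f P x : Defs.meval f P x = (mpoly_of f P).@[x 0].
Proof.
rewrite /Defs.meval /mpoly_of raddf_sum /=; apply: eq_bigr => m _; rewrite mevalZ mevalX.
by congr (_ * _); apply: eq_bigr => i _; rewrite mnmE.
Qed.

Definition list_of (g : {mpoly K[n]}) : Defs.mpoly K n := [seq (g@_m, [ffun i => m i]) | m <- msupp g].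

Lemma meval_list_of g x : Defs.meval id (list_of g) x = g.@[x 0].
Proof.
rewrite /Defs.meval /list_of big_map mevalE; apply: eq_bigr => m _.
by congr (_ * _); apply: eq_bigr => i _; rewrite ffunE.
Qed.

End Lists.

(** * Chains of irreducible sets and transcendence degree *)

Section Sets.
Variables (K : closedFieldType) (n : nat).
Implicit Types Z : 'rV[K]_n -> Prop.

Definition ideal_of Z (g : {mpoly K[n]}) := forall x : 'rV[K]_n, Z x -> g.@[x 0] = 0.

Lemma Zclosed_mpoly (T : {mpoly K[n]} -> Prop) : Zclosed (fun x : 'rV[K]_n => forall g, T g -> g.@[x 0] = 0).
Proof.
exists (fun P => T (mpoly_of id P)) => x; split=> h; first by move=> P /h; rewrite meval_mpoly_of.
move=> g Tg; rewrite -meval_list_of; apply: h.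
suff -> : mpoly_of id (list_of g) = g by [].
rewrite [RHS]mpolyE /mpoly_of /list_of big_map; apply: eq_bigr => m _; congr (_ *: 'X_[_]).
by apply/mnmP => i; rewrite mnmE ffunE.
Qed.

Lemma Zclosed_ideal Z : Zclosed Z -> forall x : 'rV[K]_n, (forall g, ideal_of Z g -> g.@[x 0] = 0) -> Z x.
Proof.
move=> [T TP] x h; apply/TP => P TPP; rewrite meval_mpoly_of; apply: h => y /TP/(_ _ TPP).
by rewrite meval_mpoly_of.
Qed.

Lemma generic_point Z : irreducible_set Z ->
  exists (L : fieldType) (H : {rmorphism {mpoly K[n]} -> L}), forall g, H g = 0 <-> ideal_of Z g.
Proof.
move=> [[x0 Zx0] irr]; apply: prime_field.
- by move=> x _; rewrite meval0.
- by move=> a g h Ig Ih x Zx; rewrite mevalD mevalM Ig // Ih // mulr0 addr0.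
- by move=> /(_ _ Zx0); rewrite meval1 => /eqP; rewrite oner_eq0.
move=> g h Igh; have cl (f : {mpoly K[n]}) : Zclosed (fun x : 'rV[K]_n => f.@[x 0] = 0).
  have [T TP] := Zclosed_mpoly (fun g => g = f); exists T => x; rewrite -TP.
  by split=> [E _ -> //|/(_ _ erefl)].
have [x Zx|h1|h1] := irr _ _ (cl g) (cl h); last 2 first.
- by left.
- by right.
have /eqP := Igh x Zx; rewrite mevalM mulf_eq0 => /orP[] /eqP ->; by [left|right].
Qed.

Lemma zeros_closed (L : fieldType) (H : {rmorphism {mpoly K[n]} -> L}) : Zclosed (zeros H).
Proof. exact: Zclosed_mpoly. Qed.

Lemma ideal_of_zeros (L : fieldType) (H : {rmorphism {mpoly K[n]} -> L}) g :
  ideal_of (zeros H) g <-> H g = 0.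
Proof.
split=> [Ig|Hg x Vx]; last exact: Vx.
by apply/eqP/negPn/negP => /nonvanishing[x Vx]; rewrite Ig // eqxx.
Qed.

Lemma zeros_irreducible (L : fieldType) (H : {rmorphism {mpoly K[n]} -> L}) : irreducible_set (zeros H).
Proof.
split.
  by have [|x Vx _] := @nonvanishing _ _ _ H 1; [rewrite rmorph1 oner_neq0 | exists x].
move=> Z1 Z2 c1 c2 cov; apply: NNPP => /not_or_and[n1 n2].
have wit Z' : Zclosed Z' -> ~ (forall x, zeros H x -> Z' x) -> exists2 g, ideal_of Z' g & H g != 0.
  move=> c' n'; apply: NNPP => no; apply: n' => x Vx; apply: Zclosed_ideal => // g Ig.
  have [/Vx //|Hg] := eqVneq (H g) 0; by case: no; exists g.
have [g1 I1 h1] := wit _ c1 n1; have [g2 I2 h2] := wit _ c2 n2.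
have : H (g1 * g2) = 0.
  apply/ideal_of_zeros => x Vx; rewrite mevalM.
  by have [/I1 ->|/I2 ->] := cov x Vx; rewrite ?mul0r ?mulr0.
by rewrite rmorphM; apply/eqP; rewrite mulf_neq0.
Qed.

Definition indep_on Z r (s : 'I_r -> 'I_n) :=
  forall q : {mpoly K[r]}, (forall x : 'rV[K]_n, Z x -> q.@[fun i => x 0 (s i)] = 0) -> q = 0.

Lemma indep_onP Z (L : fieldType) (H : {rmorphism {mpoly K[n]} -> L}) r (s : 'I_r -> 'I_n) :
  (forall g, H g = 0 <-> ideal_of Z g) -> indep_on Z s <-> indep H (coords K s).
Proof.
move=> HE; have E q : H (msub (coords K s) q) = 0 <-> (forall x : 'rV[K]_n, Z x -> q.@[fun i => x 0 (s i)] = 0).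
  rewrite HE; split=> h x Zx; have := h x Zx; rewrite ?meval_msub => <-; [symmetry|];
    rewrite ?meval_msub; apply: meval_eq => i; by rewrite /coords mevalXU.
by split=> h q /E; apply: h.
Qed.

Lemma indep_widen Z r m (s : 'I_m -> 'I_n) (le : (r <= m)%N) : indep_on Z s -> indep_on Z (fun i => s (widen_ord le i)).
Proof.
move=> is_ q h; pose w : 'I_r -> {mpoly K[m]} := fun i => 'X_(widen_ord le i).
pose u : 'I_m -> {mpoly K[r]} := fun i => if insub (val i) is Some j then 'X_j else 0.
have uw : msub u (msub w q) = q.
  rewrite -[LHS]/((msub u \o msub w)%FUN q) -[RHS]/(idfun q); apply: rmorph_mpoly_eq => [c|i] /=.
    by rewrite !msubC.
  by rewrite !msubX /u (_ : insub _ = Some i) //; exact: (valK i).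
rewrite -uw; suff -> : msub w q = 0 by rewrite rmorph0.
apply: is_ => x Zx; rewrite meval_msub -[RHS](h x Zx); apply: meval_eq => i.
by rewrite mevalXU.
Qed.

(* Evaluate on [Z] an equation with nonzero constant term satisfied on [Z'] by a function vanishing on [Z]. *)
Lemma indep_extend Z Z' m (s : 'I_m -> 'I_n) : Zclosed Z -> irreducible_set Z' ->
  (forall x, Z x -> Z' x) -> (exists x, Z' x /\ ~ Z x) -> indep_on Z s ->
  exists s' : 'I_m.+1 -> 'I_n, indep_on Z' s'.
Proof.
move=> cZ irr sub [x0 [Zx0 nZx0]] is_; have [L [H HE]] := generic_point irr.
have is' : indep H (coords K s) by apply/indep_onP; [exact: HE | move=> q h; apply: is_ => x /sub; exact: h].
apply: NNPP => no; have [_ alg_s] := maximal_basis is' (fun s' is' => no (ex_intro _ s' (proj2 (indep_onP s' HE) is'))).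
have [g Ig gx] : exists2 g, ideal_of Z g & g.@[x0 0] <> 0.
  apply: NNPP => nog; apply: nZx0; apply: Zclosed_ideal => // g Ig.
  by apply: NNPP => gx; apply: nog; exists g.
have Hg : H g != 0 by apply/eqP => /HE/(_ _ Zx0).
have [h h0 hg] := alg_constant_term Hg (alg_all is' alg_s g).
case/eqP: h0; apply: is_ => x Zx.
have /HE/(_ x (sub _ Zx)) : H (map_poly (msub (coords K s)) h).[g] = 0 by rewrite -horner_map -map_poly_comp.
rewrite -horner_map /= (Ig x Zx) horner_coef0 !coef_map /= meval_msub => <-.
by apply: meval_eq => i; rewrite /coords mevalXU.
Qed.

Lemma chain_indep Z k : has_chain Z k -> exists s : 'I_k -> 'I_n, indep_on Z s.
Proof.
move=> [C [C1 C2]].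
have ex i : (i <= k)%N -> exists s : 'I_i -> 'I_n, indep_on (C i) s.
  elim: i => [|i IH] le.
    have [_ irr _] := C1 0%N le; have [L [H HE]] := generic_point irr.
    exists (fun i : 'I_0 => match notF (ltn_ord i) with end); apply/indep_onP; [exact: HE|exact: indep0].
  have [s is_] := IH (ltnW le); have [c _ _] := C1 i (ltnW le); have [_ irr _] := C1 i.+1 le.
  have [sub str] := C2 i le; exact: indep_extend c irr sub str is_.
have [s is_] := ex k (leqnn k); exists s => q h; apply: is_ => x Cx; apply: h.
by have [_ _ sub] := C1 k (leqnn k); apply: sub.
Qed.

(** Cut [Z] by a hyperplane on which one basis coordinate has a constant value [c], at which the
    other basis coordinates still lift generically. A prime ideal containing the ideal of the
    section and avoiding all nonzero polynomials in those other coordinates defines [Z']. *)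
Lemma indep_hyperplane Z m (s : 'I_m.+1 -> 'I_n) : Zclosed Z -> irreducible_set Z -> indep_on Z s ->
  exists Z' : 'rV[K]_n -> Prop, [/\ Zclosed Z', irreducible_set Z', (forall x, Z' x -> Z x),
    (exists x, Z x /\ ~ Z' x) & exists s' : 'I_m -> 'I_n, indep_on Z' s'].
Proof.
move=> cZ irr is_; have [L [H HE]] := generic_point irr.
have [M [s1 [leM [is1 alg1]]]] := basis_above (proj1 (indep_onP s HE) is_).
case: M leM s1 is1 alg1 => // M leM s1 is1 alg1.
have [l l0 lP] := lift_generic is1 alg1.
have [v0 lv0] := infinite_nonroot l0; pose c := v0 ord_max.
pose t := s1 \o lift ord_max.
pose y : {mpoly K[n]} := 'X_(s1 ord_max) - c%:MP.
pose lc := (muni l).[c%:MP].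
have lcE v : lc.@[v] = l.@[fun i => if unlift ord_max i is Some j then v j else c].
  rewrite meval_muni unlift_none -[LHS]/(meval v _) /lc -horner_map /= mevalC; congr (_.[_]).
  apply: eq_map_poly => q; apply: meval_eq => i; by rewrite liftK.
have lc0 : lc != 0.
  apply: contraNneq lv0 => lc0; have := lcE (v0 \o lift ord_max); rewrite lc0 meval0 => /esym E.
  by rewrite -E; apply/eqP; apply: meval_eq => i; case: unliftP => [j ->|->].
pose I a := exists g b, ideal_of Z g /\ a = g + y * b.
pose S a := exists2 q : {mpoly K[M]}, q != 0 & a = msub (coords K t) q.
have [||||a [g [b [Ig ->]]] [q q0 E]|P [IP PL PS PM]] := @prime_avoidance {mpoly K[n]} I S.
- by exists 0, 0; rewrite mulr0 addr0; split=> // x _; rewrite meval0.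
- move=> a _ _ [g [b [Ig ->]]] [g' [b' [Ig' ->]]]; exists (a * g + g'), (a * b + b'); split; last by ring.
  by move=> x Zx; rewrite mevalD mevalM Ig // Ig' // mulr0 addr0.
- by exists 1; rewrite ?oner_neq0 ?rmorph1.
- by move=> _ _ [q q0 ->] [q' q'0 ->]; exists (q * q'); rewrite ?mulf_neq0 // rmorphM.
(* Disjointness: at a point of [Z] above [v] with last coordinate [c] both [g] and [y] vanish, while
   [q] does not. *)
- have [v] := infinite_nonroot (mulf_neq0 lc0 q0); rewrite mevalM mulf_eq0 negb_or lcE => /andP[lv qv].
  have [x Vx xE] := lP _ lv; case/eqP: qv.
  have Zx : Z x by apply: Zclosed_ideal => // g' /HE /Vx.
  have := congr1 (meval (x 0)) E; rewrite mevalD mevalM Ig // add0r mevalB mevalC.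
  have := xE ord_max; rewrite /coords unlift_none => ->.
  rewrite subrr mul0r meval_msub => ->; apply: meval_eq => i.
  by have := xE (lift ord_max i); rewrite /coords liftK => ->.
have P0 : P 0 by apply: IP; exists 0, 0; rewrite mulr0 addr0; split=> // x _; rewrite meval0.
have P1 : ~ P 1 by move=> /PS; apply; exists 1; rewrite ?oner_neq0 ?rmorph1.
have [L2 [H2 H2E]] := prime_field P0 PL P1 PM.
exists (zeros H2); split.
- exact: zeros_closed.
- exact: zeros_irreducible.
- move=> x Vx; apply: Zclosed_ideal => // g Ig; apply: Vx; apply/H2E/IP.
  by exists g, 0; rewrite mulr0 addr0.
- apply: NNPP => no; have sub x : Z x -> zeros H2 x by move=> Zx; apply: NNPP => nV; apply: no; exists x.
  have : H (msub (coords K s1) ('X_ord_max - c%:MP)) = 0.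
    apply/HE => x /sub Vx; rewrite rmorphB /= msubX msubC; apply: Vx; apply/H2E/IP.
    by exists 0, 1; rewrite mulr1 add0r; split=> // z _; rewrite meval0.
  move=> /is1 /mpolyP/(_ U_(ord_max)%MM); rewrite mcoeffB mcoeffXU eqxx mcoeffC mnm1_eq0 mulr0 subr0 mcoeff0.
  by move/eqP; rewrite oner_eq0.
exists (fun i => t (widen_ord (leM : (m <= M)%N) i)); apply: indep_widen.
apply/(indep_onP t (fun g => iff_sym (ideal_of_zeros H2 g))) => q /H2E Pq.
by apply/eqP/negPn/negP => q0; apply: (PS _ Pq); exists q.
Qed.

Lemma indep_chain Z m (s : 'I_m -> 'I_n) : Zclosed Z -> irreducible_set Z -> indep_on Z s -> has_chain Z m.
Proof.
elim: m Z s => [|m IH] Z s cZ irr is_; first by exists (fun=> Z); split.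
have [Z' [c' irr' sub str [s' is']]] := indep_hyperplane cZ irr is_.
have [C [C1 C2]] := IH _ _ c' irr' is'.
exists (fun i => if (i <= m)%N then C i else Z); split=> i.
  by move=> _; case: (leqP i m) => [/C1[? ? h]|_]; split=> // x /h/sub.
move=> im; have /orP[/eqP E|lt] : (i == m) || (i < m)%N by rewrite -leq_eqVlt.
  rewrite E leqnn ltnn; have [_ _ h] := C1 m (leqnn m); split; first by move=> x /h/sub.
  by have [x [Zx nZx]] := str; exists x; split=> // /h.
by rewrite lt ltnW //; exact: C2.
Qed.

(** A chain of length [r] yields [r] independent coordinates, and [r + 1] of them would yield a
    chain of length [r + 1]; so those [r] coordinates form a transcendence basis. *)
Theorem dim_basis Z r : abs_irreducible Z -> var_dim Z r ->
  exists (L : fieldType) (H : {rmorphism {mpoly K[n]} -> L}) (s : 'I_r -> 'I_n),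
    (forall x, Z x <-> zeros H x) /\ coords_basis H s.
Proof.
move=> [cZ irr] [chn nchn]; have [L [H HE]] := generic_point irr; have [s is_] := chain_indep chn.
exists L, H, s; split; last first.
  apply: maximal_basis; first exact/indep_onP.
  by move=> s' is'; apply: nchn; exact: indep_chain cZ irr (proj2 (indep_onP s' HE) is').
move=> x; split=> [Zx g /HE|Vx]; first exact.
by apply: Zclosed_ideal => // g /HE; exact: Vx.
Qed.

End Sets.

(** * Total degree and shears *)

Lemma rmorph_poly_eq (R S : nzRingType) (g1 g2 : {rmorphism {poly R} -> S}) :
  (forall c, g1 c%:P = g2 c%:P) -> g1 'X = g2 'X -> g1 =1 g2.
Proof.
move=> hC hX p; rewrite -[p]coefK poly_def !rmorph_sum; apply: eq_bigr => i _.
by rewrite -mul_polyC !rmorphM !rmorphXn /= hC hX.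
Qed.

Section TotalDegree.
Variables (K : idomainType) (r : nat).
Local Notation P := {poly {mpoly K[r]}}.
Implicit Types (g h : P) (q : {mpoly K[r]}) (v : 'I_r -> K).

(* Total degree at most [D]; the truncated subtraction forces [h`_k = 0] for [k > D]. *)
Definition tdm D h := forall k, (msize h`_k <= D.+1 - k)%N.

Lemma tdmW D E h : (D <= E)%N -> tdm D h -> tdm E h.
Proof. by move=> le t k; apply: leq_trans (t k) _; rewrite leq_sub2r. Qed.

Lemma tdm0 D : tdm D 0. Proof. by move=> k; rewrite coef0 mmeasure0. Qed.

Lemma tdmD D g h : tdm D g -> tdm D h -> tdm D (g + h).
Proof. by move=> tg th k; rewrite coefD (leq_trans (msizeD_le _ _)) // geq_max tg th. Qed.

Lemma tdm_sum D (I : Type) (s : seq I) (Q : pred I) (F : I -> P) :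
  (forall i, Q i -> tdm D (F i)) -> tdm D (\sum_(i <- s | Q i) F i).
Proof. by move=> h; elim/big_ind: _ => //; [exact: tdm0 | exact: tdmD]. Qed.

Lemma msizeM_leW q q' a b : (msize q <= a.+1)%N -> (msize q' <= b.+1)%N -> (msize (q * q') <= (a + b).+1)%N.
Proof.
have [->|q0] := eqVneq q 0; first by rewrite mul0r mmeasure0.
have [->|q'0] := eqVneq q' 0; first by rewrite mulr0 mmeasure0.
by rewrite msizeM // => h1 h2; move: (leq_add h1 h2); rewrite addSn addnS; case: (_ + _)%N.
Qed.

Lemma tdmM D E g h : tdm D g -> tdm E h -> tdm (D + E) (g * h).
Proof.
move=> tg th k; rewrite coefM; apply: leq_trans (msize_sum _ _ _) _; apply/bigmax_leqP => -[i /= ik] _.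
have [lt|le] := ltnP D i.
  have /eqP : msize g`_i == 0%N by rewrite -leqn0 (leq_trans (tg i)) // leqn0 subn_eq0.
  by move/eqP; rewrite msize_poly_eq0 => /eqP ->; rewrite mul0r mmeasure0.
have [lt|le'] := ltnP E (k - i).
  have /eqP : msize h`_(k - i) == 0%N by rewrite -leqn0 (leq_trans (th _)) // leqn0 subn_eq0.
  by move/eqP; rewrite msize_poly_eq0 => /eqP ->; rewrite mulr0 mmeasure0.
have := @msizeM_leW g`_i h`_(k - i) (D - i) (E - (k - i)); rewrite -!subSn // => /(_ (tg i) (th _)).
move/leq_trans; apply; move: ik le le'; clear; lia.
Qed.

Lemma tdmC D q : (msize q <= D.+1)%N -> tdm D q%:P.
Proof. by move=> sq k; rewrite coefC; case: k => [|k]; rewrite ?subn0 // mmeasure0. Qed.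

Lemma tdmXn k : tdm k 'X^k.
Proof. by move=> j; rewrite coefXn; case: eqP => [->|_]; rewrite ?mmeasure0 // msize1 subSnn. Qed.

Lemma size_tdm D h : tdm D h -> (size h <= D.+1)%N.
Proof.
move=> th; apply/leq_sizeP => k le; apply/eqP; rewrite -msize_poly_eq0 -leqn0.
by apply: leq_trans (th k) _; rewrite leqn0 subn_eq0.
Qed.

(** The part of total degree [D] with [T] set to 1. The summands have distinct degrees [D - k], so
    nothing cancels; its value at [v] is the coefficient of [T ^ D] after the shear by [v], see
    [shr_top]. *)
Definition topf D h : {mpoly K[r]} := \sum_(k < D.+1) pihomog mdeg (D - k) h`_k.

Lemma pihomog_topf D h k : (k <= D)%N -> pihomog mdeg (D - k) (topf D h) = pihomog mdeg (D - k) h`_k.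
Proof.
move=> kD; rewrite /topf raddf_sum /= (bigD1 (Ordinal (kD : (k < D.+1)%N))) //= pihomog_id big1 ?addr0 // => i ne.
apply: (pihomog_ne0 _ (pihomogP mdeg (D - i) h`_i)).
apply: contraNneq ne => E; rewrite -val_eqE /=; have := ltn_ord i; move: E kD; move: (nat_of_ord i) => {}i; lia.
Qed.

Lemma msize_pihomog d q : (msize (pihomog mdeg d q) <= d.+1)%N.
Proof.
apply/bigmax_leqP_seq => m mp _; rewrite ltnS.
by rewrite (dhomogP _ _ _ (pihomogP mdeg d q) m mp).
Qed.

Lemma msize_topf D h : (msize (topf D h) <= D.+1)%N.
Proof.
apply: leq_trans (msize_sum _ _ _) _; apply/bigmax_leqP => i _ /=.
by apply: leq_trans (msize_pihomog _ _) _; rewrite ltnS leq_subr.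
Qed.

Lemma topf_eq0 D h : tdm D h -> topf D h = 0 -> forall k, (msize h`_k <= D - k)%N.
Proof.
move=> th t0 k; have := th k; rewrite leq_eqVlt => /orP[/eqP E|lt]; last first.
  by move: lt; move: (msize _) => z; clear; lia.
have [lt|le] := ltnP D k; first by move: E; rewrite (_ : D.+1 - k = 0)%N => [->//|]; apply/eqP; rewrite subn_eq0.
have h0 : h`_k != 0 by rewrite -(msize_poly_eq0 h`_k) E subSn.
have := pihomog_top_neq0 h0; rewrite E subSn //= -pihomog_topf // t0 raddf0 eqxx //.
Qed.

Lemma exact_tdm h : h != 0 -> exists2 D, tdm D h & topf D h != 0.
Proof.
move=> h0; have ex : exists D, [forall k : 'I_(size h), msize h`_k <= D.+1 - k]%N.
  exists (\sum_(k < size h) (msize h`_k + k))%N; apply/forallP => k.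
  rewrite (bigD1 k) //=; move: (\sum_(_ < _ | _) _)%N => z; move: (nat_of_ord k) => {}k; lia.
have tP D : [forall k : 'I_(size h), msize h`_k <= D.+1 - k]%N -> tdm D h.
  move=> /forallP H k; have [lt|le] := ltnP k (size h); first exact: (H (Ordinal lt)).
  by rewrite nth_default // mmeasure0.
case: (ex_minnP ex) => D /tP tD Dmin; exists D => //; apply/negP => /eqP t0.
have H := topf_eq0 tD t0; case: D tD Dmin t0 H => [|D] tD Dmin t0 H.
  case/eqP: h0; apply/polyP=> k; apply/eqP; rewrite coef0 -msize_poly_eq0 -leqn0.
  by apply: leq_trans (H k) _.
suff : (D < D)%N by rewrite ltnn.
by apply: Dmin; apply/forallP => k; exact: H.
Qed.

Definition phi v : {mpoly K[r]} -> P := onto_line (@mpolyC r K) (fun i => 'X_i) (fun i => (v i)%:MP).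
HB.instance Definition _ v := GRing.RMorphism.on (phi v).

(* The substitution [t_i := t_i + v_i T]. *)
Definition shr v : P -> P := horner_eval 'X \o map_poly (phi v).
HB.instance Definition _ v := GRing.RMorphism.on (shr v).

Lemma shrC v q : shr v q%:P = phi v q.
Proof. by rewrite /shr /= map_polyC /horner_eval hornerC. Qed.

Lemma phiC v c : phi v c%:MP = (c%:MP)%:P. Proof. exact: onto_lineC. Qed.

Lemma phiX v i : phi v 'X_i = ('X_i)%:P + ((v i)%:MP)%:P * 'X. Proof. exact: onto_lineX. Qed.

Lemma shrX v : shr v 'X = 'X.
Proof. by rewrite /shr /= map_polyX /horner_eval hornerX. Qed.

Definition evp h (w : 'I_r -> K) (s : K) := (map_poly (meval w) h).[s].

Lemma shrK v h : shr (fun i => - v i) (shr v h) = h.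
Proof.
rewrite -[LHS]/((shr (fun i => - v i) \o shr v)%FUN h) -[RHS]/(idfun h).
apply: rmorph_poly_eq => [q|]; last by rewrite /= !shrX.
rewrite /= shrC -[LHS]/((shr (fun i => - v i) \o phi v)%FUN q) -[RHS]/(polyC q).
apply: rmorph_mpoly_eq => [c|i] /=; first by rewrite phiC shrC phiC.
by rewrite phiX rmorphD rmorphM /= !shrC shrX phiC phiX mpolyCN polyCN; ring.
Qed.

Lemma shr_eq0 v h : (shr v h == 0) = (h == 0).
Proof. by apply/eqP/eqP => [E|->]; [rewrite -(shrK v h) E rmorph0 | rewrite rmorph0]. Qed.

Lemma tdm_phi v q : tdm (msize q).-1 (phi v q).
Proof.
have t1 : tdm 0 1 by apply: (@tdmC 0 1); rewrite msize1.
have tX m k : tdm m 'X^k -> tdm m 'X^k by [].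
rewrite /phi /onto_line /mmap big_seq; apply: tdm_sum => m mq.
apply: tdmW (_ : mdeg m <= _)%N _; first by rewrite -ltnS (leq_trans (msize_mdeg_lt mq)) // leqSpred.
rewrite -[mdeg m]add0n; apply: tdmM.
  by apply: tdmC; rewrite msizeC; case: (_ != 0).
rewrite mdegE /mmap1; elim/big_rec2: _ => [|i e h _ th]; first exact: t1.
apply: tdmM => //; elim: (m i) => [|k IH]; first by rewrite expr0.
rewrite exprS -[k.+1]add1n; apply: tdmM => //; apply: tdmD; first by apply: tdmC; rewrite msizeX mdeg1.
rewrite -[1%N]add0n; apply: tdmM; last exact: (tdmXn 1).
by apply: tdmC; rewrite msizeC; case: (_ != 0).
Qed.

Lemma shrE v h N : (size h <= N)%N -> shr v h = \sum_(k < N) phi v h`_k * 'X^k.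
Proof.
move=> sN; have {1}-> : h = \poly_(k < N) h`_k.
  by apply/polyP => k; rewrite coef_poly; case: ltnP => // le; rewrite nth_default // (leq_trans sN).
rewrite poly_def rmorph_sum; apply: eq_bigr => i _.
by rewrite -mul_polyC rmorphM rmorphXn /= shrC shrX.
Qed.

Lemma tdm_shr v D h : tdm D h -> tdm D (shr v h).
Proof.
move=> th; rewrite (shrE v (leqnn _)); apply: tdm_sum => -[k kh] _ /=.
have [->|hk] := eqVneq h`_k 0; first by rewrite rmorph0 mul0r; exact: tdm0.
apply: tdmW (tdmM (tdm_phi v h`_k) (tdmXn k)).
have := th k; have : (0 < msize h`_k)%N by rewrite lt0n msize_poly_eq0.
move: (msize h`_k) => z; clear; lia.
Qed.

Lemma shr_top v D h : tdm D h -> (shr v h)`_D = ((topf D h).@[v])%:MP.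
Proof.
move=> th; rewrite (shrE v (size_tdm th)) coef_sum /topf (raddf_sum (meval v)) (raddf_sum (@mpolyC r K)).
apply: eq_bigr => -[k kD] _ /=; rewrite coefMXn ltnNge -ltnS kD /=.
rewrite coef_onto_line; last by rewrite -subSn // -ltnS.
rewrite -[LHS]/(mmap (@mpolyC r K) (fun i => (v i)%:MP) (pihomog mdeg (D - k) h`_k)).
rewrite -[RHS]/((@mpolyC r K \o meval v)%FUN (pihomog mdeg (D - k) h`_k)).
apply: rmorph_mpoly_eq => [c|i] /=; first by rewrite mmapC mevalC.
by rewrite mmapX mmap1U mevalXU.
Qed.

(** After a shear along which both top forms are nonzero the total degrees are visible as degrees in
    [T], and these add. *)
Lemma tdm_mul_exact D D1 D2 g h : tdm D1 g -> topf D1 g != 0 -> tdm D2 h -> topf D2 h != 0 ->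
  tdm D (g * h) -> (exists v, (topf D1 g * topf D2 h).@[v] != 0) -> (D1 + D2 <= D)%N.
Proof.
move=> t1 n1 t2 n2 t [v]; rewrite mevalM mulf_eq0 negb_or => /andP[v1 v2].
have s1 := size_tdm (tdm_shr v t1); have s2 := size_tdm (tdm_shr v t2).
have E : (shr v (g * h))`_(D1 + D2) = ((topf D1 g).@[v] * (topf D2 h).@[v])%:MP.
  by rewrite rmorphM mpolyCM -(shr_top v t1) -(shr_top v t2); exact: coefM_top.
rewrite -ltnS; apply: leq_trans (size_tdm (tdm_shr v t)); rewrite ltnNge; apply/negP => le.
by move: E; rewrite nth_default // => /esym/eqP; rewrite mpolyC_eq0 mulf_eq0 (negPf v1) (negPf v2).
Qed.

End TotalDegree.

Lemma deriv_rmorph (R S : comNzRingType) (F : {rmorphism R -> {poly S}}) x y dx dy :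
  (F x)^`() = F dx -> (F y)^`() = F dy ->
  (F (x + y))^`() = F (dx + dy) /\ (F (x * y))^`() = F (dx * y + x * dy).
Proof. by move=> hx hy; rewrite !(rmorphD F, rmorphM F) derivD derivM hx hy. Qed.

Section Derivative.
Variables (K : comNzRingType) (r : nat) (v : 'I_r -> K).
Local Notation phi := (onto_line (@mpolyC r K) (fun i => 'X_i) (fun i => (v i)%:MP)).

Definition dirder (q : {mpoly K[r]}) := \sum_i v i *: q^`M(i).

Lemma deriv_line q : (phi q)^`() = phi (dirder q).
Proof.
have DA x y : dirder (x + y) = dirder x + dirder y.
  by rewrite /dirder -big_split; apply: eq_bigr => i _; rewrite mderivD scalerDr.
have DM x y : dirder (x * y) = dirder x * y + x * dirder y.
  rewrite /dirder mulr_suml mulr_sumr -big_split; apply: eq_bigr => i _.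
  by rewrite mderivM scalerDr scalerAl scalerAr.
move: q; apply: mpoly_alg_ind => [c|i|x y hx hy|x y hx hy].
- by rewrite onto_lineC derivC /dirder big1 ?rmorph0 // => i _; rewrite mderivC scaler0.
- rewrite onto_lineX derivD derivC add0r derivM derivC mul0r add0r derivX mulr1.
  rewrite /dirder (bigD1 i) //= mderivX mnm1E eqxx scale1r.
  have -> : (U_(i) - U_(i) = 0 :> 'X_{1..r})%MM by apply/mnmP => j; rewrite mnmBE subnn mnm0E.
  rewrite mpolyX0 big1 ?addr0 => [|j ne]; first by rewrite -[_ *: 1]mul_mpolyC mulr1 onto_lineC.
  by rewrite mderivX mnm1E eq_sym (negPf ne) scale0r scaler0.
- rewrite DA; exact: (proj1 (deriv_rmorph hx hy)).
- rewrite DM; exact: (proj2 (deriv_rmorph hx hy)).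
Qed.

End Derivative.

Section DerivShear.
Variables (K : idomainType) (r : nat).
Local Notation P := {poly {mpoly K[r]}}.

Lemma deriv_shr v (h : P) : (shr v h)^`() = shr v (h^`() + map_poly (dirder v) h).
Proof.
have D0 : dirder v 0 = 0 by rewrite /dirder big1 // => i _; rewrite mderiv0 scaler0.
have mP (p : P) c : map_poly (dirder v) (p * 'X + c%:P) = map_poly (dirder v) p * 'X + (dirder v c)%:P.
  apply/polyP=> i; rewrite coefD coefMX coefC !coef_map_id0 // coefD coefMX coefC.
  by case: i => [|i] /=; rewrite ?add0r ?addr0.
elim/poly_ind: h => [|p c IH]; first by rewrite map_poly0 deriv0 addr0 rmorph0 deriv0.
rewrite mP !derivD !derivM !derivX !derivC addr0 !mulr1.
rewrite rmorphD rmorphM /= shrC shrX derivD derivM derivX mulr1 IH.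
have -> : (phi v c)^`() = phi v (dirder v c) by exact: deriv_line.
rewrite !rmorphD !rmorphM /= shrC shrX mulrDl.
by rewrite addrACA -!addrA [X in _ + X]addrCA.
Qed.

End DerivShear.

Lemma pchar_mpoly (K : nzRingType) (r p : nat) : p \in [pchar K] -> p \in [pchar {mpoly K[r]}].
Proof. by move=> chK; exact: (rmorph_pchar (@mpolyC r K) chK). Qed.

Lemma pchar_poly (K : nzRingType) (p : nat) : p \in [pchar K] -> p \in [pchar {poly K}].
Proof. by move=> chK; exact: (rmorph_pchar (@polyC K) chK). Qed.

(** * Vanishing derivatives and [p]-th powers *)

Section PthRoot.
Variables (K : closedFieldType) (r p : nat).
Hypothesis chK : p \in [pchar K].
Local Notation P := {poly {mpoly K[r]}}.
Let chM : p \in [pchar {mpoly K[r]}] := pchar_mpoly r chK.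
Let chP : p \in [pchar P] := pchar_poly chM.

Let p_gt0 : (0 < p)%N. Proof. exact: prime_gt0 (pcharf_prime chK). Qed.

Let frob_sum (R : comNzRingType) (chR : p \in [pchar R]) (I : Type) (s : seq I) (F : I -> R) :
  (\sum_(i <- s) F i) ^+ p = \sum_(i <- s) F i ^+ p.
Proof.
by rewrite -(pFrobenius_autE chR) rmorph_sum; apply: eq_bigr => i _; exact: pFrobenius_autE.
Qed.

Let rootK (x : K) : exists y, y ^+ p == x.
Proof.
have [y] := solve_monicpoly (fun i : nat => if i is 0%N then x else 0) p_gt0.
move=> E; exists y; apply/eqP; rewrite E {E}; case: p p_gt0 => // q _.
by rewrite big_ord_recl expr0 mulr1 big1 ?addr0 // => i _; rewrite mul0r.
Qed.

Lemma pth_root_mpoly (q : {mpoly K[r]}) : (forall i, q^`M(i) = 0) -> exists g, g ^+ p == q.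
Proof.
move=> dq; have pm m i : m \in msupp q -> (p %| m i)%N.
  move=> mq; have [->|mi] := posnP (m i); first exact: dvdn0.
  have := congr1 (fun z : {mpoly K[r]} => z@_(m - U_(i))%MM) (dq i); rewrite mcoeff_deriv mcoeff0.
  have -> : (m - U_(i) + U_(i) = m)%MM.
    apply/mnmP => j; rewrite mnmDE mnmBE mnm1E; case: eqP => [<-|_]; first by rewrite subnK.
    by rewrite subn0 addn0.
  rewrite mnmBE mnm1E eqxx subn1 prednK // -mulr_natr => /eqP.
  rewrite mulf_eq0 -(dvdn_pcharf chK) => /orP[|//].
  by rewrite mcoeff_eq0 mq.
pose rt (x : K) := xchoose (rootK x).
have rtP x : rt x ^+ p = x by exact/eqP/(xchooseP (rootK x)).
exists (\sum_(m <- msupp q) rt q@_m *: 'X_[[multinom m i %/ p | i < r]]).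
apply/eqP; rewrite (frob_sum chM) [RHS]mpolyE big_seq [RHS]big_seq; apply: eq_bigr => m mq.
rewrite exprZn rtP mpolyXn; congr (_ *: 'X_[_]); apply/mnmP => i.
by rewrite mulmnE mnmE divnK // pm.
Qed.

Lemma pth_root_poly (h : P) : h^`() = 0 -> (forall k i, h`_k^`M(i) = 0) -> exists g, g ^+ p = h.
Proof.
move=> dh dm; have pk k : h`_k != 0 -> (p %| k)%N.
  case: k => [|k] hk; first exact: dvdn0.
  have := congr1 (fun z : P => z`_k) dh; rewrite coef_deriv coef0 -mulr_natr => /eqP.
  by rewrite mulf_eq0 (negPf hk) /= -(dvdn_pcharf chM).
pose g k := xchoose (pth_root_mpoly (dm k)).
have gP k : g k ^+ p = h`_k by exact/eqP/(xchooseP (pth_root_mpoly (dm k))).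
exists (\sum_(k < size h) (g k)%:P * 'X^(k %/ p)).
rewrite (frob_sum chP) -[RHS]coefK poly_def; apply: eq_bigr => k _.
rewrite exprMn -rmorphXn /= gP -exprM mul_polyC.
by have [->|/pk/divnK ->] := eqVneq h`_k 0; rewrite ?scale0r.
Qed.

(* Were all the directional derivatives zero, [h] would be a [p]-th power. *)
Lemma generic_direction D (h : P) : tdm D h -> topf D h != 0 -> (forall g, g ^+ p = h -> False) ->
  exists2 C : {mpoly K[r]}, C != 0 & forall v, C.@[v] != 0 -> (topf D h).@[v] != 0 /\ h^`() + map_poly (dirder v) h != 0.
Proof.
move=> th t0 np.
have D0 v : dirder v (0 : {mpoly K[r]}) = 0 by rewrite /dirder big1 // => i _; rewrite mderiv0 scaler0.
have [c [k [m [c0 cE]]]] : exists c k m, c != 0 /\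
    forall v, c.@[v] = (h^`() + map_poly (dirder v) h)`_k@_m.
  pose c k m : {mpoly K[r]} := ((h^`())`_k@_m)%:MP + \sum_i (h`_k^`M(i))@_m *: 'X_i.
  have cE k m v : (c k m).@[v] = (h^`() + map_poly (dirder v) h)`_k@_m.
    rewrite mevalD mevalC raddf_sum /= coefD mcoeffD coef_map_id0 // /dirder raddf_sum /=; congr (_ + _).
    by apply: eq_bigr => i _; rewrite mevalZ mevalXU mcoeffZ mulrC.
  suff : exists k m, c k m != 0 by move=> [k [m c0]]; exists (c k m), k, m.
  apply: NNPP => no; have cz k m : c k m = 0 by apply/eqP/negPn/negP => c0; apply: no; exists k, m.
  have c0 k m : (h^`())`_k@_m = 0.
    have := congr1 (fun z : {mpoly K[r]} => z@_0%MM) (cz k m); rewrite mcoeff0 mcoeffD mcoeffC eqxx mulr1.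
    rewrite raddf_sum /= big1 ?addr0 // => i _; rewrite mcoeffZ mcoeffX; case: eqP => [E|_]; last by rewrite mulr0.
    by move/(congr1 (fun z : 'X_{1..r} => z i)): E; rewrite mnm1E eqxx mnm0E.
  have ci k m i : (h`_k^`M(i))@_m = 0.
    have := congr1 (fun z : {mpoly K[r]} => z@_U_(i)%MM) (cz k m); rewrite mcoeff0 mcoeffD mcoeffC mnm1_eq0 mulr0 add0r.
    rewrite raddf_sum /= (bigD1 i) //= big1 ?addr0 => [|j ne]; first by rewrite mcoeffZ mcoeffXU eqxx mulr1.
    by rewrite mcoeffZ mcoeffXU (negPf ne) mulr0.
  have [||g /np//] := @pth_root_poly h.
    by apply/polyP=> k; apply/mpolyP => m; rewrite c0 coef0 mcoeff0.
  by move=> k i; apply/mpolyP => m; rewrite ci mcoeff0.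
exists (topf D h * c) => [|v]; first by rewrite mulf_neq0.
rewrite mevalM mulf_eq0 negb_or => /andP[tv cv]; split=> //.
by apply: contraNneq cv => E; rewrite cE E coef0 mcoeff0.
Qed.

End PthRoot.

Lemma mpoly_eq0_eval (K : closedFieldType) r (q : {mpoly K[r]}) : (forall v, q.@[v] = 0) -> q = 0.
Proof. by move=> h; apply/eqP/negPn/negP => /infinite_nonroot[v]; rewrite h eqxx. Qed.

Lemma phi_horner0 (K : idomainType) r (w : 'I_r -> K) q : (phi w q).[0] = q.
Proof.
rewrite -[LHS]/((horner_eval 0 \o phi w)%FUN q) -[RHS]/(idfun q); apply: rmorph_mpoly_eq => [c|i] /=.
  by rewrite phiC /horner_eval hornerC.
by rewrite phiX /horner_eval !hornerE.
Qed.

(* Along a direction in which the leading coefficients stay of constant leading coefficient, the claim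
   reduces to polynomials in one variable; a remainder vanishing on every line vanishes. *)
Lemma gauss_mpoly (K : closedFieldType) r : gauss {mpoly K[r]}.
Proof.
move=> S Q F b mF b0 E.
have S0 : S != 0.
  apply: contraTneq (monic_neq0 mF) => S0; move/eqP: E.
  by rewrite S0 mul0r eq_sym mulf_eq0 polyC_eq0 (negPf b0) /= => ->.
set l := lead_coef S; have l0 : l != 0 by rewrite lead_coef_eq0.
have [w] := infinite_nonroot (mulf_neq0 (pihomog_top_neq0 l0) (pihomog_top_neq0 b0)).
rewrite mevalM mulf_eq0 negb_or => /andP[lw bw].
have phi_lead q : q != 0 -> (pihomog mdeg (msize q).-1 q).@[w] != 0 ->
    exists2 c : K, c != 0 & (size (phi w q) = msize q /\ lead_coef (phi w q) = c%:MP).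
  move=> q0 qw; exists ((pihomog mdeg (msize q).-1 q).@[w]) => //.
  have sq : (0 < msize q)%N by rewrite lt0n msize_poly_eq0.
  have cE : (phi w q)`_(msize q).-1 = ((pihomog mdeg (msize q).-1 q).@[w])%:MP.
    rewrite coef_onto_line ?prednK //.
    rewrite -[RHS]/((@mpolyC r K \o meval w)%FUN _).
    apply: (rmorph_mpoly_eq (g1 := mmap (@mpolyC r K) (fun i => (w i)%:MP))) => [c|i] /=; first by rewrite mmapC mevalC.
    by rewrite mmapX mmap1U mevalXU.
  have sE : size (phi w q) = msize q.
    apply/eqP; rewrite eqn_leq size_onto_line -(prednK sq) ltnNge /=; apply/negP => le.
    by move: cE; rewrite nth_default // => /esym/eqP; rewrite mpolyC_eq0 (negPf qw).
  by rewrite /lead_coef sE.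
have [c c0 [sl cl]] := phi_lead l l0 lw; have [d d0 [sb cb]] := phi_lead b b0 bw.
pose B : {poly {mpoly K[r]}} := (c^-1)%:MP%:P * phi w l.
have mB : B \is monic.
  by rewrite monicE lead_coefM lead_coefC cl -mpolyCM mulVf.
have lB : phi w l = (c%:MP)%:P * B by rewrite /B mulrA -polyCM -mpolyCM divff // mul1r.
(* A remainder is detected by its values: evaluating the variables at [v] on the line leaves one
   indeterminate, where [gauss_poly] applies. Setting [X = 0] afterwards recovers the coefficients
   of [S]. *)
have r0 j : rmodp (phi w S`_j) B = 0.
  set rj := rmodp _ _; apply/polyP=> i; rewrite coef0; apply: mpoly_eq0_eval => v.
  pose ev : {rmorphism {poly {mpoly K[r]}} -> {poly K}} := map_poly (meval v).
  suff : ev rj = 0 by move/(congr1 (fun z : {poly K} => z`_i)); rewrite /= coef_map coef0.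
  have nz (q : {mpoly K[r]}) e : e != 0 -> lead_coef (phi w q) = e%:MP -> ev (phi w q) != 0.
    move=> e0 ce; apply/eqP => /(congr1 (fun z : {poly K} => z`_(size (phi w q)).-1)).
    rewrite /= coef_map coef0 -[_`_ _]/(lead_coef _) ce /= mevalC; exact/eqP.
  pose ef : {rmorphism {mpoly K[r]} -> {poly K}} := (ev \o phi w)%FUN.
  have [|||S1 S1E] := @gauss_poly K (map_poly ef S) (map_poly ef Q) (map_poly ef F) (ef b).
  - exact: monic_map.
  - exact: nz cb.
  - by rewrite -rmorphM E rmorphM /= map_polyC.
  have lS : lead_coef (map_poly ef S) = ef l by apply: lead_coef_map_id0; rewrite ?rmorph0 //; exact: nz cl.
  have SjE : ef S`_j = (c *: S1`_j) * ev B.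
    rewrite -coef_map S1E lS coefCM /= lB rmorphM /= map_polyC /= mevalC mul_polyC.
    by rewrite -scalerAl mulrC -scalerAl.
  have dE : ef S`_j = ev (rdivp (phi w S`_j) B) * ev B + ev rj.
    by rewrite /ef /= {1}(rdivp_eq mB (phi w S`_j)) rmorphD rmorphM.
  have mevB : ev B \is monic by exact: monic_map.
  have X : ((c *: S1`_j) - ev (rdivp (phi w S`_j) B)) * ev B = ev rj.
    by rewrite mulrBl -SjE dE addrC addKr.
  apply/eqP; apply: contraTT (leqnn 0) => n0; rewrite -ltnNge.
  have lt : (size (ev rj) < size (ev B))%N.
    have -> : size (ev B) = size B by apply: size_map_poly_id0; rewrite (monicP mB) /= meval1 oner_neq0.
    apply: leq_ltn_trans (size_poly _ _) _; by rewrite /rj ltn_rmodp monic_neq0.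
  move: lt n0; rewrite -X; set u := _ - _; have [->|u0] := eqVneq u 0; first by rewrite mul0r eqxx.
  rewrite size_Mmonic //; move: u0; rewrite -size_poly_gt0; case: (size u) => // k _.
  by rewrite addSn /= ltnNge leq_addl.
exists (\poly_(j < size S) ((c^-1)%:MP * (rdivp (phi w S`_j) B).[0])).
apply/polyP=> j; rewrite coefCM coef_poly; case: ltnP => [_|le]; last by rewrite nth_default // mulr0.
have SE : S`_j = (rdivp (phi w S`_j) B).[0] * B.[0].
  by rewrite -{1}(phi_horner0 w S`_j) {1}(rdivp_eq mB (phi w S`_j)) r0 addr0 hornerM.
have lE : l = c%:MP * B.[0] by rewrite -{1}(phi_horner0 w l) lB hornerM hornerC.
rewrite {1}SE -/l lE; move: B.[0] (rdivp _ _).[0] => x y.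
by rewrite mulrACA -mpolyCM divff // mul1r mulrC.
Qed.

Lemma mono_factor_mpoly (K : closedFieldType) r (J : {poly {mpoly K[r]}} -> Prop) (f g : {poly {mpoly K[r]}}) :
  (forall a x y, J x -> J y -> J (x + a * y)) -> f \is monic -> J f ->
  g != 0 -> J g -> (size g < size f)%N ->
  exists c S1 Q1, [/\ c != 0, S1 \is monic, f = S1 * Q1, J (c%:P * S1) & (size S1 <= size g)%N].
Proof. exact (@mono_factor _ J f g (@gauss_mpoly K r)). Qed.

(** * Hypersurface models *)

Section Exchange.
Variables (K : closedFieldType) (n : nat) (L : fieldType) (H : {rmorphism {mpoly K[n]} -> L}).
Variables (r : nat) (k : 'I_r.+1) (w : 'I_r -> K) (t : 'I_r.+1 -> {mpoly K[n]}).

(** A linear exchange step. [Phi] and [Psi] are inverse changes of variables, so independence of [t]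
    splits into independence of the projection and transcendence of [t k] over it. *)
Definition project : 'I_r -> {mpoly K[n]} := fun i => t (lift k i) - (w i)%:MP * t k.

Let Phi : {rmorphism {mpoly K[r.+1]} -> {poly {mpoly K[r]}}} :=
  mmap (polyC \o @mpolyC r K) (fun i => if unlift k i is Some j then ('X_j)%:P + ((w j)%:MP)%:P * 'X else 'X).
Let Psi : {rmorphism {poly {mpoly K[r]}} -> {mpoly K[r.+1]}} :=
  (horner_eval 'X_k \o map_poly (msub (fun i => 'X_(lift k i) - (w i)%:MP * 'X_k)))%FUN.

Let PhiC c : Phi c%:MP = c%:MP%:P. Proof. by rewrite /Phi /= mmapC. Qed.
Let PhiX i : Phi 'X_i = if unlift k i is Some j then ('X_j)%:P + ((w j)%:MP)%:P * 'X else 'X.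
Proof. by rewrite /Phi /= mmapX mmap1U. Qed.
Let PsiC q : Psi q%:P = msub (fun i => 'X_(lift k i) - (w i)%:MP * 'X_k) q.
Proof. by rewrite /Psi /= map_polyC /horner_eval hornerC. Qed.
Let PsiX : Psi 'X = 'X_k. Proof. by rewrite /Psi /= map_polyX /horner_eval hornerX. Qed.

Let PhiK q : Psi (Phi q) = q.
Proof.
rewrite -[LHS]/((Psi \o Phi)%FUN q) -[RHS]/(idfun q); apply: rmorph_mpoly_eq => [c|i].
  by change (Psi (Phi c%:MP) = c%:MP); rewrite PhiC PsiC msubC.
change (Psi (Phi 'X_i) = 'X_i); rewrite PhiX; have [j ->|->] := unliftP k i; last exact: PsiX.
by rewrite (rmorphD Psi) (rmorphM Psi) PsiX !PsiC msubX msubC subrK.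
Qed.

Let PsiK h : Phi (Psi h) = h.
Proof.
rewrite -[LHS]/((Phi \o Psi)%FUN h) -[RHS]/(idfun h); apply: rmorph_poly_eq => [q|]; last first.
  by change (Phi (Psi 'X) = 'X); rewrite PsiX PhiX unlift_none.
change (Phi (Psi q%:P) = q%:P); rewrite PsiC -[LHS]/((Phi \o msub (fun i => 'X_(lift k i) - (w i)%:MP * 'X_k))%FUN q) -[RHS]/(polyC q).
apply: rmorph_mpoly_eq => [c|i]; rewrite [LHS]/=; first by rewrite msubC PhiC.
by rewrite msubX (rmorphB Phi) (rmorphM Phi) !PhiX PhiC unlift_none liftK addrK.
Qed.

Let Phi_eval q : H (msub t q) = (map_poly (H \o msub project) (Phi q)).[H (t k)].
Proof.
rewrite -[LHS]/((H \o msub t)%FUN q) -[RHS]/((horner_eval (H (t k)) \o map_poly (H \o msub project) \o Phi)%FUN q).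
apply: rmorph_mpoly_eq => [c|i].
  change (H (msub t c%:MP) = (map_poly (H \o msub project) (Phi c%:MP)).[H (t k)]).
  by rewrite msubC PhiC map_polyC hornerC /= msubC.
change (H (msub t 'X_i) = (map_poly (H \o msub project) (Phi 'X_i)).[H (t k)]).
rewrite msubX PhiX; have [j ->|->] := unliftP k i; last by rewrite map_polyX hornerX.
rewrite rmorphD rmorphM /= !map_polyC map_polyX !hornerE /= msubX msubC /project.
by rewrite rmorphB rmorphM subrK.
Qed.

Lemma indep_project : indep H t -> indep H project.
Proof.
move=> it q Hq; apply/eqP; rewrite -polyC_eq0 -(PsiK q%:P); apply/eqP.
suff -> : Psi q%:P = 0 by rewrite rmorph0.
by apply: it; rewrite Phi_eval PsiK map_polyC hornerC.
Qed.

Lemma indep_nalg : indep H t -> ~ alg H project (H (t k)).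
Proof.
move=> it [h h0 hz]; case/eqP: h0; rewrite -(PsiK h).
suff -> : Psi h = 0 by rewrite rmorph0.
by apply: it; rewrite Phi_eval PsiK.
Qed.

Lemma nindep_alg : ~ indep H t -> alg H project (H (t k)).
Proof.
move=> nit; apply: NNPP => nalg; apply: nit => q Hq; apply: NNPP => q0; apply: nalg.
exists (Phi q); last by rewrite -Phi_eval.
by apply/eqP => P0; apply: q0; rewrite -(PhiK q) P0 rmorph0.
Qed.

End Exchange.

Section Forms.
Variables (K : closedFieldType) (n : nat) (L : fieldType) (H : {rmorphism {mpoly K[n]} -> L}).

Definition lf (a : 'cV[K]_n) : {mpoly K[n]} := \sum_j (a j 0) *: 'X_j.

Lemma lfD a b : lf (a + b) = lf a + lf b.
Proof. by rewrite /lf -big_split; apply: eq_bigr => j _; rewrite !mxE scalerDl. Qed.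

Lemma lfZ c a : lf (c *: a) = c%:MP * lf a.
Proof. by rewrite /lf mulr_sumr; apply: eq_bigr => j _; rewrite !mxE -scalerA mul_mpolyC. Qed.

Lemma meval_lf a (x : 'rV[K]_n) : (lf a).@[x 0] = (x *m a) 0 0.
Proof. by rewrite /lf raddf_sum mxE; apply: eq_bigr => j _; rewrite /= mevalZ mevalXU mulrC. Qed.

Section Rel.
Variable r : nat.
Implicit Types (A : 'M[K]_(n, r)) (y : 'cV[K]_n) (v : 'rV[K]_r) (f g h : {poly {mpoly K[r]}}).

Definition forms A : 'I_r -> {mpoly K[n]} := fun i => lf (col i A).

Definition evr A y : {poly {mpoly K[r]}} -> {mpoly K[n]} := horner_eval (lf y) \o map_poly (msub (forms A)).
HB.instance Definition _ A y := GRing.RMorphism.on (evr A y).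

Lemma evrC A y q : evr A y q%:P = msub (forms A) q.
Proof. by rewrite /evr /= map_polyC /horner_eval hornerC. Qed.

Lemma evrX A y : evr A y 'X = lf y.
Proof. by rewrite /evr /= map_polyX /horner_eval hornerX. Qed.

Lemma meval_forms A q (x : 'rV[K]_n) : (msub (forms A) q).@[x 0] = q.@[(x *m A) 0].
Proof.
rewrite meval_msub; apply: meval_eq => i; rewrite meval_lf !mxE.
by apply: eq_bigr => j _; rewrite mxE.
Qed.

Lemma meval_evr A y h (x : 'rV[K]_n) : (evr A y h).@[x 0] = evp h ((x *m A) 0) ((x *m y) 0 0).
Proof.
rewrite -[LHS]/((meval (x 0) \o evr A y)%FUN h).
rewrite -[RHS]/((horner_eval ((x *m y) 0 0) \o map_poly (meval ((x *m A) 0)))%FUN h).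
apply: rmorph_poly_eq => [q|]; rewrite [LHS]/= [RHS]/=.
  by rewrite evrC map_polyC /horner_eval hornerC meval_forms.
by rewrite evrX map_polyX /horner_eval hornerX meval_lf.
Qed.

Definition rel A y h := H (evr A y h) = 0.

Lemma relE A y h : H (evr A y h) = (map_poly (H \o msub (forms A)) h).[H (lf y)].
Proof. by rewrite /evr /= /horner_eval -horner_map -map_poly_comp. Qed.

Lemma relM A y g h : rel A y (g * h) -> rel A y g \/ rel A y h.
Proof.
rewrite /rel (rmorphM (evr A y)) rmorphM => /eqP; rewrite mulf_eq0.
by case/orP => /eqP; [left|right].
Qed.

Lemma rel_lin A y a g h : rel A y g -> rel A y h -> rel A y (g + a * h).
Proof. by rewrite /rel (rmorphD (evr A y)) (rmorphM (evr A y)) rmorphD rmorphM => -> ->; rewrite mulr0 addr0. Qed.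

Lemma rel_mul A y a h : rel A y h -> rel A y (a * h).
Proof. by rewrite /rel (rmorphM (evr A y)) rmorphM => ->; rewrite mulr0. Qed.

Definition basis A := indep H (forms A) /\ forall j, alg H (forms A) (H 'X_j).

Lemma rel_const A y q : indep H (forms A) -> rel A y q%:P -> q = 0.
Proof. by move=> iA; rewrite /rel evrC; apply: iA. Qed.

Lemma rel_exists A y : basis A -> exists2 h, h != 0 & rel A y h.
Proof.
by move=> [iA aA]; have [h h0 hz] := alg_all iA aA (lf y); exists h; rewrite // /rel relE.
Qed.

Lemma forms_shear A y v i : forms (A - y *m v) i = forms A i - (v 0 i)%:MP * lf y.
Proof.
rewrite /forms -lfZ -[RHS]addrC; apply/eqP; rewrite addrC eq_sym subr_eq -lfD; apply/eqP; congr lf.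
by apply/colP => j; rewrite !mxE big_ord1 mulrC subrK.
Qed.

(** The substitution [t_i + v_i T] for [t_i] undoes the subtraction of [v_i] times the form [y] from
    the [i]-th form. *)
Lemma evr_shear A y v h : evr (A - y *m v) y (shr (v 0) h) = evr A y h.
Proof.
rewrite -[LHS]/((evr (A - y *m v) y \o shr (v 0))%FUN h).
apply: rmorph_poly_eq => [q|]; last first.
  by change (evr (A - y *m v) y (shr (v 0) 'X) = evr A y 'X); rewrite shrX !evrX.
change (evr (A - y *m v) y (shr (v 0) q%:P) = evr A y q%:P).
rewrite shrC evrC -[LHS]/((evr (A - y *m v) y \o phi (v 0))%FUN q).
apply: rmorph_mpoly_eq => [c|i].
  by change (evr (A - y *m v) y (phi (v 0) c%:MP) = msub (forms A) c%:MP); rewrite phiC evrC !msubC.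
change (evr (A - y *m v) y (phi (v 0) 'X_i) = msub (forms A) 'X_i).
have eD a b : evr (A - y *m v) y (a + b) = evr (A - y *m v) y a + evr (A - y *m v) y b by exact: rmorphD.
have eM a b : evr (A - y *m v) y (a * b) = evr (A - y *m v) y a * evr (A - y *m v) y b by exact: rmorphM.
rewrite phiX eD eM !evrC evrX msubC !msubX.
by rewrite forms_shear subrK.
Qed.

Lemma rel_shear A y v h : rel A y h <-> rel (A - y *m v) y (shr (v 0) h).
Proof. by rewrite /rel evr_shear. Qed.

End Rel.

(** On a line of shears at most one is bad. Each failure makes [t_k - z v_k y] algebraic over the
    same [r - 1] combinations of the forms; two failures make [y], hence [t_k], algebraic over them,
    against the independence of the forms of [A]. *)
Lemma shear_indep r (A : 'M[K]_(n, r)) y (v : 'rV[K]_r) z z' : z != z' -> indep H (forms A) ->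
  ~ indep H (forms (A - y *m (z *: v))) -> ~ indep H (forms (A - y *m (z' *: v))) -> False.
Proof.
move=> zz iA n1 n2.
have [v0|] := eqVneq v 0; first by apply: n1; rewrite v0 scaler0 mulmx0 subr0.
case/rV0Pn => k vk; case: r A v k vk iA n1 n2 => [|m] A v k vk iA; first by case: k {vk}.
(* With these coefficients the projection eliminates the direction [v], so it is the same for all
   shears [z *: v]. *)
pose w (i : 'I_m) := v 0 (lift k i) / v 0 k; set u := project k w (forms A).
have nalg : ~ alg H u (H (forms A k)) by exact: indep_nalg.
have iu : indep H u by exact: indep_project.
have key x : ~ indep H (forms (A - y *m (x *: v))) -> alg H u (H (forms A k) - H (x * v 0 k)%:MP * H (lf y)).
  have -> : u = project k w (forms (A - y *m (x *: v))).
    apply: boolp.funext => i; rewrite /u /project !forms_shear !mxE /w.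
    have wk : w i * v 0 k = v 0 (lift k i) by rewrite /w divfK.
    have -> : (x * v 0 (lift k i))%:MP = (w i)%:MP * (x * v 0 k)%:MP :> {mpoly K[n]}.
      by rewrite -mpolyCM -wk mulrCA.
    by rewrite mulrBr mulrA opprB addrA subrK.
  by move/(@nindep_alg _ _ _ H m k w); rewrite forms_shear mxE rmorphB rmorphM.
move=> /key a1 /key a2; apply: nalg.
have ay : alg H u (H (lf y)).
  have E : H (lf y) = H (((z' - z) * v 0 k)^-1)%:MP *
      ((H (forms A k) - H (z * v 0 k)%:MP * H (lf y)) - (H (forms A k) - H (z' * v 0 k)%:MP * H (lf y))).
    have E1 (a Y Z Z' : L) : a - Z * Y - (a - Z' * Y) = (Z' - Z) * Y by ring.
    rewrite E1 -rmorphB -mpolyCB -mulrBl mulrA -rmorphM -mpolyCM mulVf ?mpolyC1 ?rmorph1 ?mul1r //.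
    by rewrite mulf_neq0 // subr_eq0 eq_sym.
  by rewrite E; apply: alg_mul => //; [exact: alg_const | exact: alg_sub].
rewrite -[H (forms A k)](subrK (H (z * v 0 k)%:MP * H (lf y))).
by apply: alg_add => //; apply: alg_mul => //; exact: alg_const.
Qed.

Lemma basis_shear r (A : 'M[K]_(n, r)) y (v : 'rV[K]_r) : basis A -> indep H (forms (A - y *m v)) ->
  alg H (forms (A - y *m v)) (H (lf y)) -> basis (A - y *m v).
Proof.
move=> [iA aA] iB ay; split=> // j; set B := A - y *m v in iB ay *.
have aq q : alg H (forms B) (H (msub (forms A) q)).
  move: q; apply: mpoly_alg_ind => [c|i|q q' h h'|q q' h h'].
  - by rewrite msubC; exact: alg_const.
  - have -> : msub (forms A) 'X_i = forms B i + (v 0 i)%:MP * lf y by rewrite msubX /B forms_shear subrK.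
    rewrite rmorphD rmorphM; apply: alg_add => //; last by apply: alg_mul => //; exact: alg_const.
    by rewrite -(msubX (forms B) i); exact: alg_msub.
  - by rewrite (rmorphD (msub (forms A))) rmorphD; exact: alg_add.
  - by rewrite (rmorphM (msub (forms A))) rmorphM; exact: alg_mul.
have [h h0 hz] := aA j; apply: (@alg_root _ _ _ _ _ _ iB (map_poly (H \o msub (forms A)) h)).
- rewrite map_poly_eq0_id0 //= ; apply: contra_neq h0 => /iA /eqP; rewrite lead_coef_eq0 => /eqP //.
- by rewrite rootE hz.
- by move=> i; rewrite coef_map /=.
Qed.

End Forms.

Lemma lift_points_poly (K : closedFieldType) (n : nat) (L : fieldType) (H : {rmorphism {mpoly K[n]} -> L}) r
  (al : {rmorphism {poly {mpoly K[r]}} -> {mpoly K[n]}}) (eta : {rmorphism {poly {mpoly K[r]}} -> K}) :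
  (forall c, eta c%:MP%:P = c) -> (forall c, al c%:MP%:P = c%:MP) -> (forall a, H (al a) = 0 -> eta a = 0) ->
  (forall j, exists h : {poly {poly {mpoly K[r]}}}, (map_poly (H \o al) h).[H 'X_j] = 0 /\ eta (lead_coef h) != 0) ->
  exists2 x, zeros H x & forall a, (al a).@[x 0] = eta a.
Proof.
pose kC : {rmorphism K -> {poly {mpoly K[r]}}} := (polyC \o @mpolyC r K)%FUN.
move=> h1 h2 h3 h4; exact (@lift_points K n L H _ al eta kC h1 h2 h3 h4).
Qed.

Lemma lift_evr (K : closedFieldType) (n : nat) (L : fieldType) (H : {rmorphism {mpoly K[n]} -> L}) r
  (A : 'M[K]_(n, r)) (y : 'cV[K]_n) (t0 : 'I_r -> K) (s : K) :
  (forall a, H (evr A y a) = 0 -> evp a t0 s = 0) ->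
  (forall j, exists2 h : {poly {mpoly K[r]}}, (map_poly (H \o msub (forms A)) h).[H 'X_j] = 0 & (lead_coef h).@[t0] != 0) ->
  exists2 x, zeros H x & forall a, (evr A y a).@[x 0] = evp a t0 s.
Proof.
move=> h3 h4.
pose eta : {rmorphism {poly {mpoly K[r]}} -> K} := (horner_eval s \o map_poly (meval t0))%FUN.
have etaC q : eta q%:P = q.@[t0] by rewrite /eta /= map_polyC /horner_eval hornerC.
pose al : {rmorphism {poly {mpoly K[r]}} -> {mpoly K[n]}} := evr A y.
have alC q : al q%:P = msub (forms A) q by exact: evrC.
have [c|c|//|j|x Vx xE] := @lift_points_poly K n L H r al eta.
- by rewrite etaC mevalC.
- by rewrite alC msubC.
- have [h hz hl] := h4 j; exists (map_poly polyC h); split.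
    rewrite -map_poly_comp -[RHS]hz; congr (_.[_]); apply: eq_map_poly => q.
    by change (H (al q%:P) = H (msub (forms A) q)); rewrite alC.
  by rewrite lead_coef_map_inj ?etaC //; exact: polyC_inj.
by exists x.
Qed.

Lemma finite_listed (K : closedFieldType) n (Q : 'rV[K]_n -> Prop) (c : seq K) :
  (forall x, Q x -> forall j, x 0 j \in c) -> exists s, uniq s /\ forall x, Q x <-> x \in s.
Proof.
move=> Qc; pose cand : seq 'rV[K]_n := [seq \row_j val (f j) | f : {ffun 'I_n -> seq_sub c} <- enum {: {ffun 'I_n -> seq_sub c}}].
exists (undup [seq x <- cand | boolp.asbool (Q x)]); split; first exact: undup_uniq.
move=> x; rewrite mem_undup mem_filter; split=> [Qx|/andP[/boolp.asboolP]//].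
apply/andP; split; first exact/boolp.asboolP.
apply/mapP; exists [ffun j => SeqSub (Qc x Qx j)]; first by rewrite mem_enum.
by apply/rowP => j; rewrite !mxE ffunE.
Qed.

Lemma size_factor (R : idomainType) (f g h : {poly R}) : f = g * h -> g != 0 -> h \is monic ->
  size f = (size g + size h).-1.
Proof. by move=> -> g0 hm; rewrite size_Mmonic. Qed.

Section Relations.
Variables (K : closedFieldType) (n : nat) (L : fieldType) (H : {rmorphism {mpoly K[n]} -> L}).
Variable r : nat.
Implicit Types (A : 'M[K]_(n, r)) (y : 'cV[K]_n) (v : 'rV[K]_r) (f g h : {poly {mpoly K[r]}}).
Local Notation rel := (rel H).
Local Notation indep := (indep H).
Local Notation basis := (basis H).

(** [D] is the degree of the hypersurface onto which [(A, y)] maps the variety. Total degree is used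
    because shears preserve it; [Tmin] speaks of the degree in [T], which division by a monic
    relation controls. *)
Definition minrel A y D f := [/\ rel A y f, f != 0, tdm D f &
  forall D' g, rel A y g -> g != 0 -> tdm D' g -> (D <= D')%N].

Definition Tmin A y m := forall h, rel A y h -> h != 0 -> (m < size h)%N.

Lemma minrel_exists A y : basis A -> exists D f, minrel A y D f.
Proof.
move=> bA; have [h h0 hr] := rel_exists y bA; have [D tD _] := exact_tdm h0.
have [k] := ubnP D; elim: k D h h0 hr tD => // k IH D h h0 hr tD lt.
have [[D' [g [gr g0 tg lt']]]|no] := classic (exists D' g, [/\ rel A y g, g != 0, tdm D' g & (D' < D)%N]).
  by apply: (IH D' g) => //; apply: leq_trans lt' _.
exists D, h; split=> // D' g gr g0 tg; rewrite leqNgt; apply/negP => lt'.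
by apply: no; exists D', g.
Qed.

Lemma minrel_gt0 A y D f : indep (forms A) -> minrel A y D f -> (0 < D)%N.
Proof.
move=> iA [fr f0 tf _]; rewrite lt0n; apply: contra_neqN f0 => /eqP D0; rewrite D0 in tf.
have s1 := size_tdm tf; rewrite (size1_polyC s1) in fr *.
by rewrite (rel_const iA fr) polyC0.
Qed.

Lemma minrel_top A y D f : minrel A y D f -> topf D f != 0.
Proof.
move=> [fr f0 tf mf]; apply: contraNneq f0 => t0; have h := topf_eq0 tf t0.
case: D tf mf t0 h => [|D] tf mf t0 h.
  by apply/eqP/polyP=> k; apply/eqP; rewrite coef0 -msize_poly_eq0 -leqn0; apply: leq_trans (h k) _.
case: eqP => // /eqP f0; have := mf D f fr f0 h; by rewrite ltnn.
Qed.

Lemma minrel_shear A y v D f : minrel A y D f -> minrel (A - y *m v) y D (shr (v 0) f).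
Proof.
move=> [fr f0 tf mf]; split; [exact: (proj1 (rel_shear H A y v f) fr)|by rewrite shr_eq0|exact: tdm_shr|].
move=> D' g gr g0 tg; apply: (mf D' (shr (fun i => - v 0 i) g)); last 2 first.
- by rewrite shr_eq0.
- exact: tdm_shr.
have E : (- v) 0 = (fun i => - v 0 i) :> ('I_r -> K) by apply: boolp.funext => i; rewrite mxE.
by have := proj1 (rel_shear H (A - y *m v) y (- v) g) gr; rewrite E mulmxN opprK subrK.
Qed.

Lemma rel_scale A y (c : K) f : rel A y f -> rel A y (c%:MP%:P * f).
Proof. exact: rel_mul. Qed.

Lemma minrel_scale A y (c : K) D f : c != 0 -> minrel A y D f -> minrel A y D (c%:MP%:P * f).
Proof.
move=> c0 [fr f0 tf mf]; split=> //; first exact: rel_scale.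
  by rewrite mulf_neq0 // !polyC_eq0 mpolyC_eq0.
rewrite -[D]add0n; apply: tdmM => //; apply: tdmC; rewrite msizeC; by case: (_ != 0).
Qed.

(** A relation of smaller degree in [T] would yield a proper monic factor [S1] of [f] that is itself
    a relation. Total degrees add under multiplication, and the cofactor has positive degree, so
    [S1] would undercut [D]. *)
Lemma minrel_Tmin A y D f : indep (forms A) -> minrel A y D f -> f \is monic -> size f = D.+1 -> Tmin A y D.
Proof.
move=> iA [fr f0 tf mf] fm sf h hr h0; rewrite ltnNge; apply/negP => sh.
have [|c [S1 [Q1 [c0 mS fE cS sS]]]] := mono_factor_mpoly (rel_lin (A := A) (y := y)) fm fr h0 hr.
  by rewrite sf ltnS.
have S10 := monic_neq0 mS; have mQ : Q1 \is monic by move: fm; rewrite fE monicMl.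
have Sr : rel A y S1.
  have [cr|//] := relM cS.
  by case/eqP: c0; exact: rel_const iA cr.
have [D1 t1 n1] := exact_tdm S10; have [D2 t2 n2] := exact_tdm (monic_neq0 mQ).
have nz : exists v : 'I_r -> K, (topf D1 S1 * topf D2 Q1).@[v] != 0 by apply: infinite_nonroot; rewrite mulf_neq0.
have tSQ : tdm D (S1 * Q1) by rewrite -fE.
have arith (a b c' : nat) : (a + b).-1 = D.+1 -> (c' <= D)%N -> (a <= c')%N -> (D1 + D2 <= D)%N -> (D <= D1)%N ->
    (b <= D2.+1)%N -> False by clear; lia.
have sfE := size_factor fE S10 mQ.
exact: (arith _ _ _ (etrans (esym sfE) sf) sh sS (tdm_mul_exact t1 n1 t2 n2 tSQ nz) (mf D1 S1 Sr S10 t1) (size_tdm t2)).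
Qed.

Lemma Tmin_domainp A y k f : f \is monic -> size f = k.+2 -> rel A y f -> Tmin A y k.+1 -> domainp k f.
Proof.
move=> mf sf fr T g g0 sg; apply/negP => /eqP /(det_mulmodmx_eq0 mf sf)[h h0 [sh E]].
have : rel A y (h * g).
  by rewrite (rdivp_eq mf (h * g)) E addr0; exact: rel_mul.
by case/relM => /T; [move/(_ h0) | move/(_ g0)]; rewrite ltnNge ?sh ?sg.
Qed.

(** Division by the monic [f] leaves a relation too short to be nonzero, so [f] divides every
    relation. *)
Lemma rel_fibre A y k f h (t0 : 'I_r -> K) s : f \is monic -> size f = k.+2 -> rel A y f -> Tmin A y k.+1 ->
  evp f t0 s = 0 -> rel A y h -> evp h t0 s = 0.
Proof.
move=> mf sf fr T fs hr.
have r0 : rmodp h f = 0.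
  apply/eqP/negPn/negP => n0; suff rr : rel A y (rmodp h f).
    by have := T _ rr n0; rewrite ltnNge -ltnS -sf ltn_rmodp monic_neq0.
  have -> : rmodp h f = h + (- rdivp h f) * f by rewrite {2}(rdivp_eq mf h) mulNr addrC addKr.
  exact: rel_lin.
rewrite (rdivp_eq mf h) r0 addr0 /evp rmorphM hornerM.
by rewrite -[X in _ * X]/(evp f t0 s) fs mulr0.
Qed.

Lemma lift_fibre A y k f (t0 : 'rV[K]_r) s (h : 'I_n -> {poly {mpoly K[r]}}) :
  f \is monic -> size f = k.+2 -> rel A y f -> Tmin A y k.+1 -> evp f (t0 0) s = 0 ->
  (forall j, (map_poly (H \o msub (forms A)) (h j)).[H 'X_j] = 0) -> (forall j, (lead_coef (h j)).@[t0 0] != 0) ->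
  exists x, [/\ zeros H x, x *m A = t0 & (x *m y) 0 0 = s].
Proof.
move=> mf sf fr T fs hz hl.
have [a Ha|j|x Vx xE] := @lift_evr K n L H r A y (t0 0) s.
- exact: (rel_fibre mf sf fr T fs Ha).
- by exists (h j).
have xA : x *m A = t0.
  apply/rowP => i; have := xE ('X_i)%:P; rewrite evrC meval_forms mevalXU => ->.
  by rewrite /evp map_polyC hornerC /= mevalXU.
exists x; split=> //; have := xE 'X; rewrite evrX meval_lf => ->.
by rewrite /evp map_polyX hornerX.
Qed.

Lemma indep_rank A : indep (forms A) -> \rank A = r.
Proof.
move=> iA; apply/eqP; rewrite -mxrank_tr -[_ == r]/(row_free A^T).
apply: inj_row_free => u uA; pose q : {mpoly K[r]} := \sum_i u 0 i *: 'X_i.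
have q0 : q = 0.
  apply: iA; suff -> : msub (forms A) q = 0 by rewrite rmorph0.
  apply: mpoly_eq0_eval => x; rewrite meval_msub raddf_sum /=.
  have /esym := congr1 (fun z : 'rV_n => (z *m (\row_j x j)^T) 0 0) uA; rewrite mul0mx [in X in X = _]mxE => E0.
  transitivity ((u *m A^T *m (\row_j x j)^T) 0 0); last by rewrite -E0.
  rewrite -mulmxA mxE; apply: eq_bigr => i _; rewrite mevalZ mevalXU; congr (_ * _).
  rewrite /forms; have -> : (lf (col i A)).@[x] = (lf (col i A)).@[(\row_j x j) 0] by apply: meval_eq => j; rewrite mxE.
  by rewrite meval_lf !mxE; apply: eq_bigr => j _; rewrite !mxE mulrC.
apply/rowP => i; have := congr1 (fun z : {mpoly K[r]} => z@_U_(i)%MM) q0.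
rewrite mcoeff0 raddf_sum /= (bigD1 i) //= mcoeffZ mcoeffXU eqxx mulr1 big1 ?addr0 ?mxE // => j ne.
by rewrite mcoeffZ mcoeffXU (negPf ne) mulr0.
Qed.

Implicit Type hs : 'I_n -> {poly {mpoly K[r]}}.

Definition coord_rel A hs := forall j,
  hs j != 0 /\ (map_poly (H \o msub (forms A)) (hs j)).[H 'X_j] = 0.

Lemma coord_rel_exists A : basis A -> exists hs, coord_rel A hs.
Proof.
move=> [_ aA]; have /fin_all_exists[h hP] : forall j, exists h : {poly {mpoly K[r]}},
    h != 0 /\ (map_poly (H \o msub (forms A)) h).[H 'X_j] = 0 by move=> j; have [h] := aA j; exists h.
by exists h.
Qed.

Lemma coord_rel_root A hs x j : coord_rel A hs -> zeros H x -> root (map_poly (meval ((x *m A) 0)) (hs j)) (x 0 j).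
Proof.
move=> /(_ j)[_ hz] Vx; pose P := (map_poly (msub (forms A)) (hs j)).['X_j].
have : H P = 0 by rewrite /P -horner_map -map_poly_comp.
move/Vx; rewrite /P -horner_map /= mevalXU -map_poly_comp /root => E; apply/eqP; rewrite -[RHS]E.
by congr (_.[_]); apply: eq_map_poly => q /=; rewrite meval_forms.
Qed.

Lemma fibre_listed A hs (t0 : 'rV[K]_r) : coord_rel A hs -> (forall j, (lead_coef (hs j)).@[t0 0] != 0) ->
  exists s, uniq s /\ forall x, (zeros H x /\ x *m A = t0) <-> x \in s.
Proof.
move=> hA hl; apply: (@finite_listed _ _ _ (flatten [seq rootseq (map_poly (meval (t0 0)) (hs j)) | j <- enum 'I_n])).
move=> x [Vx xA] j; apply/flattenP; exists (rootseq (map_poly (meval (t0 0)) (hs j))).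
  by apply: map_f; rewrite mem_enum.
rewrite rootseqP; last by rewrite map_poly_eq0_id0 //; have [] := hA j.
by rewrite -xA; exact: coord_rel_root.
Qed.

(** On the line through a point where [C] is nonzero there are two parameters keeping it nonzero,
    and [shear_indep] excludes at most one of them. *)
Lemma generic_shear A y (C : {mpoly K[r]}) : indep (forms A) -> C != 0 ->
  exists v, C.@[v 0] != 0 /\ indep (forms (A - y *m v)).
Proof.
move=> iA C0; have [v0 Cv0] := infinite_nonroot C0.
pose q : {poly K} := onto_line idfun (fun=> 0) v0 C.
have qE z : q.[z] = C.@[fun i => z * v0 i].
  rewrite -[LHS]/((horner_eval z \o onto_line idfun (fun=> 0) v0)%FUN C) -[RHS]/(meval _ C).
  apply: rmorph_mpoly_eq => [c|i]; rewrite [LHS]/= ?onto_lineC ?onto_lineX /horner_eval !hornerE /=.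
    by rewrite mevalC.
  by rewrite mevalXU mulrC.
have q0 : q != 0.
  apply: contraNneq Cv0 => q0; have := qE 1; rewrite q0 horner0 => /esym/eqP; congr (_ == _).
  by apply: meval_eq => i; rewrite mul1r.
have [z1 r1] := closed_nonrootP _ q0.
have [z2] := closed_nonrootP _ (mulf_neq0 q0 (negbT (polyXsubC_eq0 z1))).
rewrite rootM root_XsubC negb_or => /andP[r2 z21].
pose v : 'rV[K]_r := \row_i v0 i.
have ok z : ~~ root q z -> C.@[(z *: v) 0] != 0.
  by rewrite rootE qE; congr (_ != _); apply: meval_eq => i; rewrite !mxE.
have [i1|n1] := classic (indep (forms (A - y *m (z1 *: v)))); first by exists (z1 *: v); split=> //; exact: ok.
have [i2|n2] := classic (indep (forms (A - y *m (z2 *: v)))); first by exists (z2 *: v); split=> //; exact: ok.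
by case: (@shear_indep _ _ _ H _ A y v z2 z1 z21 iA n2 n1).
Qed.

(** Noether normalisation by a shear: the coefficient of [T ^ D] becomes the nonzero constant
    [topf D f] at [v], which is scaled to 1. *)
Lemma normal_form A y v D f : basis A -> minrel A y D f -> (topf D f).@[v 0] != 0 ->
  indep (forms (A - y *m v)) ->
  let f' := (((topf D f).@[v 0])^-1)%:MP%:P * shr (v 0) f in
  [/\ basis (A - y *m v), minrel (A - y *m v) y D f', f' \is monic & size f' = D.+1].
Proof.
move=> bA mf tv iB f'; have c0 : ((topf D f).@[v 0])^-1 != 0 by rewrite invr_eq0.
have mf' : minrel (A - y *m v) y D f' by apply: minrel_scale => //; exact: minrel_shear.
have [fr f0 tf _] := mf'; have [_ _ tf0 _] := mf.
have cD : f'`_D = 1.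
  by rewrite coefCM shr_top // -mpolyCM mulVf ?mpolyC1.
have sf : size f' = D.+1.
  apply/eqP; rewrite eqn_leq size_tdm // ltnNge; apply/negP => le.
  by move: cD; rewrite nth_default // => /esym/eqP; rewrite oner_eq0.
have fm : f' \is monic by rewrite monicE /lead_coef sf cD.
split=> //; apply: basis_shear => //; exists f' => //.
by rewrite -relE.
Qed.

Variable p : nat.
Hypothesis chK : p \in [pchar K].

(** Relations form a prime ideal, so [g] and [g ^+ p.-1] would both be relations of degree at least
    [D > 0], while their degrees add up to at most [D]. *)
Lemma minrel_not_power A y D f g : indep (forms A) -> minrel A y D f -> g ^+ p = f -> False.
Proof.
move=> iA mf gp; have [fr f0 tf mn] := mf; have p2 : (1 < p)%N := prime_gt1 (pcharf_prime chK).
have relX k : rel A y (g ^+ k.+1) -> rel A y g.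
  by elim: k => [//|k IH]; rewrite exprS => /relM[|/IH].
have gr : rel A y g by apply: (relX p.-1); rewrite prednK ?gp // ltnW.
have g0 : g != 0 by apply: contraNneq f0 => g0; rewrite -gp g0 expr0n; case: (p) p2.
have g'0 : g ^+ p.-1 != 0 by rewrite expf_neq0.
have gr' : rel A y (g ^+ p.-1).
  by have -> : p.-1 = p.-2.+1 by [case: (p) p2 => // -[]]; rewrite exprSr; exact: rel_mul.
have [D1 t1 n1] := exact_tdm g0; have [D2 t2 n2] := exact_tdm g'0.
have := tdm_mul_exact t1 n1 t2 n2; rewrite -exprS prednK ?gp ?(ltnW p2) // => /(_ _ tf) le.
have := mn _ _ gr g0 t1; have := mn _ _ gr' g'0 t2; have := minrel_gt0 iA mf.
have /le : exists v : 'I_r -> K, (topf D1 g * topf D2 (g ^+ p.-1)).@[v] != 0 by apply: infinite_nonroot; rewrite mulf_neq0.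
clear; lia.
Qed.

Lemma uniq_fibre k f (t0 : 'I_r -> K) : f \is monic -> size f = k.+2 ->
  (\det (mulmodmx k f f^`())).@[t0] != 0 ->
  let rs := rootseq (map_poly (meval t0) f) in
  [/\ uniq rs, size rs = k.+1 & forall s, (s \in rs) = (evp f t0 s == 0)].
Proof.
move=> mf sf d0; have [u s] := separable_spec mf sf (phi := meval t0) d0; split=> // z.
rewrite rootseqP // -size_poly_eq0 size_map_poly_id0 ?sf // (monicP mf) /= meval1 oner_neq0.
by [].
Qed.

(** A generic fibre of a separable model has [D] distinct values of [T], each of which lifts to a
    point of [X]; the fibre is a finite section of [X] by a linear subspace of codimension [r]. *)
Lemma degree_bound (X : 'rV[K]_n -> Prop) d A y D f : (forall x, X x <-> zeros H x) -> var_deg X r d ->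
  basis A -> minrel A y D f -> (D <= d)%N.
Proof.
move=> XH [_ dmax] bA mf; have [iA _] := bA; have [fr f0 tf mn] := mf.
(* The direction is chosen so that the derivative in [T] survives the shear, which makes the
   discriminant nonzero. *)
have [C C0 CP] := generic_direction chK tf (minrel_top mf) (fun g => @minrel_not_power _ _ _ _ g iA mf).
have [v [Cv iB]] := generic_shear y iA C0; have [tv dv] := CP _ Cv.
have [bB mf' fm sf] := normal_form bA mf tv iB; set B := A - y *m v in bB mf' iB; set f' := _ * _ in mf' fm sf.
have [fr' _ _ _] := mf'; have D0 := minrel_gt0 iA mf.
have sfk : size f' = D.-1.+2 by rewrite prednK.
have TB : Tmin B y D.-1.+1 by rewrite prednK //; exact: minrel_Tmin iB mf' fm sf.
have df' : f'^`() != 0.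
  rewrite derivM derivC mul0r add0r deriv_shr mulf_neq0 ?shr_eq0 //.
  by rewrite !polyC_eq0 mpolyC_eq0 invr_eq0.
have d0 : \det (mulmodmx D.-1 f' f'^`()) != 0.
  apply: (Tmin_domainp fm sfk fr' TB) => //.
  by rewrite -ltnS -sfk lt_size_deriv // monic_neq0.
have [hs hsB] := coord_rel_exists bB.
have q0 : \det (mulmodmx D.-1 f' f'^`()) * \prod_j lead_coef (hs j) != 0.
  by rewrite mulf_neq0 //; apply/prodf_neq0 => j _; rewrite lead_coef_eq0; case: (hsB j).
have [w] := infinite_nonroot q0; rewrite mevalM mulf_eq0 negb_or rmorph_prod => /andP[dw /prodf_neq0 lw].
pose t0 : 'rV[K]_r := \row_i w i.
have t0E : t0 0 = w by apply: boolp.funext => i; rewrite mxE.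
have [urs srs rsP] := uniq_fibre fm sfk dw.
have [|s [us sP]] := @fibre_listed B hs t0 hsB; first by move=> j; rewrite t0E; exact: lw.
have : (size s <= d)%N.
  apply: (dmax B t0 s); split; first exact: indep_rank.
  by split=> // x; rewrite XH.
apply: leq_trans; rewrite -(prednK D0) -srs -(size_map (fun x : 'rV[K]_n => (x *m y) 0 0)).
apply: uniq_leq_size => // z; rewrite rsP => /eqP fz.
have [|j|j|x [Vx xB xy]] := @lift_fibre B y D.-1 f' t0 z hs fm sfk fr' TB.
- by rewrite t0E.
- by have [_] := hsB j.
- by rewrite t0E; exact: lw.
by apply/mapP; exists x => //; apply/sP.
Qed.

End Relations.

Lemma embFp_rmorph (p : nat) (K : fieldType) : p \in [pchar K] ->
  exists e : {rmorphism 'F_p -> K}, e =1 @embFp p K.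
Proof.
move=> chK; have pp := pcharf_prime chK.
have nat_e k : embFp K (k%:R : 'F_p) = k%:R.
  rewrite /embFp [nat_of_ord _](val_Fp_nat pp) {2}(divn_eq k p) natrD natrM (pcharf0 chK) mulr0 add0r //.
have rep (a : 'F_p) : a = (nat_of_ord a)%:R by rewrite natr_Zp.
have eD (a b : 'F_p) : embFp K (a + b) = embFp K a + embFp K b.
  by rewrite {1}(rep a) {1}(rep b) -natrD nat_e natrD.
have eB : zmod_morphism (@embFp p K).
  by move=> a b; apply/eqP; rewrite eq_sym subr_eq -eD subrK.
have eM : monoid_morphism (@embFp p K).
  split; first by rewrite -[1]/(1%:R) nat_e.
  by move=> a b; rewrite {1}(rep a) {1}(rep b) -natrM nat_e natrM.
pose e : {rmorphism 'F_p -> K} := HB.pack (@embFp p K)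
  (GRing.isZmodMorphism.Build _ _ (@embFp p K) eB) (GRing.isMonoidMorphism.Build _ _ (@embFp p K) eM).
by exists e.
Qed.

(** * Linear forms and projections over the prime field *)

Section PrimeField.
Variables (p : nat) (K : fieldType) (e : {rmorphism 'F_p -> K}).
Hypothesis pp : prime p.

Lemma Fp_exp (a : 'F_p) : a ^+ p = a.
Proof. by have := expf_card a; rewrite card_Fp. Qed.

Lemma frob_fixed (x : K) : x ^+ p = x -> exists a, e a = x.
Proof.
move=> xp; apply: NNPP => no; pose s := x :: map e (enum 'F_p).
have us : uniq s.
  rewrite /s /= map_inj_uniq ?enum_uniq ?andbT; last exact: fmorph_inj.
  by apply/mapP => -[a _ xe]; apply: no; exists a.
pose q : {poly K} := 'X^p - 'X.
have sq : size q = p.+1 by rewrite size_polyDl size_polyXn // size_polyN size_polyX ltnS prime_gt1.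
have q0 : q != 0 by rewrite -size_poly_eq0 sq.
have : (size s < size q)%N.
  apply: max_poly_roots => //; apply/allP => z; rewrite inE rootE !hornerE => /orP[/eqP ->|/mapP[a _ ->]].
    by rewrite xp subrr.
  by rewrite -rmorphXn /= Fp_exp subrr.
by rewrite sq /s /= size_map -cardE card_Fp // ltnn.
Qed.

(** Each pair of distinct elements of [s] excludes at most one [c], and there are [p - 1] nonzero
    candidates. *)
Lemma separating (s : seq (K * K)) : uniq s -> (size s * size s + 1 < p)%N ->
  exists2 c : 'F_p, c != 0 & uniq [seq u.1 + e c * u.2 | u <- s].
Proof.
move=> us sp; pose l := [seq (u.1 - v.1) / (v.2 - u.2) | u <- s, v <- s].
have [c c0 cl] : exists2 c : 'F_p, c != 0 & e c \notin l.
  apply: NNPP => no; have sub : {subset map e (enum (predC1 (0 : 'F_p))) <= l}.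
    move=> z /mapP[c]; rewrite mem_enum inE => c0 ->; apply: NNPP => cl; apply: no; exists c => //; exact/negP.
  have um : uniq (map e (enum (predC1 (0 : 'F_p)))) by rewrite map_inj_uniq ?enum_uniq //; exact: fmorph_inj.
  have := uniq_leq_size um sub; rewrite size_map -cardE cardC1 card_Fp // size_allpairs.
  by move: sp; case: (p) => // q; rewrite addn1 ltnS ltnNge => /negP.
exists c => //; rewrite map_inj_in_uniq // => u v us' vs E.
have [E2|ne] := eqVneq u.2 v.2.
  by move: E; rewrite E2 => /addIr E1; rewrite [u]surjective_pairing [v]surjective_pairing E1 E2.
case/negP: cl; apply/allpairsP; exists (u, v); split=> //=.
have n0 : v.2 - u.2 != 0 by rewrite subr_eq0 eq_sym.
apply: (mulIf n0); rewrite divfK // mulrBr; apply/eqP; rewrite subr_eq addrAC eq_sym subr_eq.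
by rewrite addrC eq_sym addrC E addrC.
Qed.

End PrimeField.

Section Fp.
Variables (p : nat) (K : closedFieldType) (n : nat) (L : fieldType) (H : {rmorphism {mpoly K[n]} -> L}).
Hypothesis chK : p \in [pchar K].
Variable e : {rmorphism 'F_p -> K}.
Variables (r d : nat) (X : 'rV[K]_n -> Prop).
Hypothesis XH : forall x, X x <-> zeros H x.
Hypothesis Xd : var_deg X r d.
Hypothesis dp : (d.+1 * d.+1 + 1 < p)%N.
Local Notation eM := (map_mx e).
Local Notation P := {poly {mpoly K[r]}}.
Let pp : prime p := pcharf_prime chK.

Definition good (A : 'M['F_p]_(n, r)) (y : 'cV['F_p]_n) m := basis H (eM A) /\ Tmin H (eM A) (eM y) m.

Lemma good_le A y m : good A y m -> (m <= d)%N.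
Proof.
move=> [bA T]; have [D [f mf]] := minrel_exists (eM y) bA; have [fr f0 tf _] := mf.
rewrite -ltnS; apply: leq_trans (T f fr f0) _; apply: leq_trans (size_tdm tf) _.
exact: (degree_bound chK XH Xd bA mf : (D <= d)%N).
Qed.

(** Among the multiples of a rational vector off the zeros of the top form at most [D] make it
    vanish. Since [p > D + 1], two remain, and [shear_indep] excludes at most one of them. *)
Lemma Fp_direction A y D (f : P) : basis H (eM A) -> minrel H (eM A) (eM y) D f ->
  exists v : 'rV['F_p]_r, (topf D f).@[(eM v) 0] != 0 /\ indep H (forms (eM (A - y *m v))).
Proof.
move=> bA mf; have [iA _] := bA; have Dd := degree_bound chK XH Xd bA mf.
have Dp : (D.+1 < p)%N by move: Dd dp; clear; nia.
have ei : injective e by exact: fmorph_inj.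
have sC := msize_topf D f; set C := topf D f in sC *.
have C0 : C != 0 := minrel_top mf.
have [|w Cw] := @exists_nonroot K 'F_p e ei r C C0.
  by rewrite card_Fp // (leq_ltn_trans _ (ltnW Dp)) // -subn1 leq_subLR add1n.
pose q : {poly K} := onto_line idfun (fun=> 0) (fun i => e (w i)) C.
have qE z : q.[z] = C.@[fun i => z * e (w i)].
  rewrite -[LHS]/((horner_eval z \o onto_line idfun (fun=> 0) (fun i => e (w i)))%FUN C) -[RHS]/(meval _ C).
  apply: rmorph_mpoly_eq => [c|i]; rewrite [LHS]/= ?onto_lineC ?onto_lineX /horner_eval !hornerE /=.
    by rewrite mevalC.
  by rewrite mevalXU mulrC.
have q0 : q != 0.
  apply: contraNneq Cw => q0; have := qE 1; rewrite q0 horner0 => /esym/eqP; congr (_ == _).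
  by apply: meval_eq => i; rewrite mul1r.
have sq : (size q <= D.+1)%N by apply: leq_trans (size_onto_line _ _ _ _) sC.
have card_bad : (#|[pred z : 'F_p | root q (e z)]| <= D)%N.
  by apply: leq_trans (card_roots_le ei q0) _; rewrite -subn1 leq_subLR add1n.
have : (1 < #|[pred z : 'F_p | ~~ root q (e z)]|)%N.
  have := cardC [pred z : 'F_p | root q (e z)]; rewrite card_Fp //.
  have -> : #|[predC [pred z : 'F_p | root q (e z)]]| = #|[pred z : 'F_p | ~~ root q (e z)]| by apply: eq_card.
  by move: card_bad Dp; move: #|_| #|_| => a b; clear; lia.
case/card_gt1P => z1 [z2 [r1 r2 z12]]; rewrite !inE in r1 r2.
pose v : 'rV['F_p]_r := \row_i w i.
have ok z : ~~ root q (e z) -> C.@[(eM (z *: v)) 0] != 0.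
  by rewrite rootE qE; congr (_ != _); apply: meval_eq => i; rewrite !mxE rmorphM.
have eS z : eM (A - y *m (z *: v)) = eM A - eM y *m (e z *: eM v).
  by rewrite map_mxB map_mxM map_mxZ.
have ez12 : e z1 != e z2 by rewrite (inj_eq ei).
have [i1|n1] := classic (indep H (forms (eM (A - y *m (z1 *: v))))); first by exists (z1 *: v); split; [exact: ok|].
have [i2|n2] := classic (indep H (forms (eM (A - y *m (z2 *: v))))); first by exists (z2 *: v); split; [exact: ok|].
rewrite eS in n1; rewrite eS in n2; case: (shear_indep ez12 iA n1 n2).
Qed.

Lemma Fp_normal A y D (f : P) : basis H (eM A) -> minrel H (eM A) (eM y) D f ->
  exists B (g : P), [/\ basis H (eM B), minrel H (eM B) (eM y) D g, g \is monic, size g = D.+1 & good B y D].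
Proof.
move=> bA mf; have [v [tv iB]] := Fp_direction bA mf; exists (A - y *m v).
have eS : eM (A - y *m v) = eM A - eM y *m eM v by rewrite map_mxB map_mxM.
rewrite eS in iB *; have [bB mg gm sg] := normal_form bA mf tv iB.
eexists; split; [exact: bB|exact: mg|exact: gm|exact: sg|].
by split; rewrite eS //; exact: minrel_Tmin mg gm sg.
Qed.

Lemma max_good (s : 'I_r -> 'I_n) : coords_basis H s ->
  exists m A y, good A y m /\ forall A' y' m', good A' y' m' -> (m' <= m)%N.
Proof.
move=> bs; pose A0 : 'M['F_p]_(n, r) := \matrix_(j, i) (s i == j)%:R.
have fA : forms (eM A0) = coords K s.
  apply: boolp.funext => i; rewrite /forms /lf /coords (bigD1 (s i)) //= !mxE eqxx rmorph1 scale1r big1 ?addr0 // => j ne.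
  by rewrite !mxE eq_sym (negPf ne) rmorph0 scale0r.
have g0 : good A0 0 0.
  by split; [rewrite /basis fA; exact: bs | move=> h _ h0; rewrite size_poly_gt0].
have : exists m A y, good A y m by exists 0%N, A0, 0.
move=> [m [A [y g]]]; have [k] := ubnP (d - m)%N; elim: k m A y g => // k IH m A y g lt.
have [[m' [A' [y' [g' mm]]]]|no] := classic (exists m' A' y', good A' y' m' /\ (m < m')%N).
  apply: (IH m' A' y' g'); have := good_le g'; move: mm lt; clear; lia.
exists m, A, y; split=> // A' y' m' g'; rewrite leqNgt; apply/negP => mm; apply: no.
by exists m', A', y'.
Qed.

(* The maximality of the degree is what makes the model injective outside its discriminant. *)
Lemma best_model (s : 'I_r -> 'I_n) : coords_basis H s ->
  exists k A y (f : P), [/\ basis H (eM A), minrel H (eM A) (eM y) k.+1 f, f \is monic, size f = k.+2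
    & forall A' y' m', good A' y' m' -> (m' <= k.+1)%N].
Proof.
move=> /max_good[m [A [y [[bA T] mx]]]]; have [D [f mf]] := minrel_exists (eM y) bA.
have [B [g [bB mg gm sg gB]]] := Fp_normal bA mf.
have Dm := mx _ _ _ gB; have [fr f0 tf _] := mf.
have mD : (m <= D)%N by rewrite -ltnS (leq_trans (T f fr f0)) // size_tdm.
have E : m = D by apply/eqP; rewrite eqn_leq mD Dm.
have [iA _] := bA; have D0 := minrel_gt0 iA mf.
by exists D.-1, B, y, g; rewrite prednK // -E in mg sg gB *; split=> //; rewrite ?E.
Qed.

End Fp.

(** * Integrality and fibres of the model of largest degree *)

Section Model.
Variables (p : nat) (K : closedFieldType) (n : nat) (L : fieldType) (H : {rmorphism {mpoly K[n]} -> L}).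
Hypothesis chK : p \in [pchar K].
Variable e : {rmorphism 'F_p -> K}.
Variables (r d : nat) (X : 'rV[K]_n -> Prop).
Hypothesis XH : forall x, X x <-> zeros H x.
Hypothesis Xd : var_deg X r d.
Hypothesis dp : (d.+1 * d.+1 + 1 < p)%N.
Local Notation eM := (map_mx e).
Local Notation P := {poly {mpoly K[r]}}.
Let pp : prime p := pcharf_prime chK.

Variables (A : 'M['F_p]_(n, r)) (y : 'cV['F_p]_n) (k : nat) (f : P).
Hypotheses (bA : basis H (eM A)) (mf : minrel H (eM A) (eM y) k.+1 f) (fm : f \is monic) (sf : size f = k.+2).
Hypothesis mx : forall (A' : 'M['F_p]_(n, r)) (y' : 'cV['F_p]_n) m', good H e A' y' m' -> (m' <= k.+1)%N.

Let iA : indep H (forms (eM A)) := proj1 bA.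
Let fr : rel H (eM A) (eM y) f. Proof. by case: mf. Qed.
Let tf : tdm k.+1 f. Proof. by case: mf. Qed.
Let T : Tmin H (eM A) (eM y) k.+1 := minrel_Tmin iA mf fm sf.
Let kd : (k.+1 <= d)%N := degree_bound chK XH Xd bA mf.
Let kp : (k.+2 * k.+2 + 1 < p)%N.
Proof. by apply: leq_trans dp; rewrite ltnS leq_add2r leq_mul. Qed.

Definition discr : {mpoly K[r]} := \det (mulmodmx k f f^`()).
Let disc := discr.

Lemma model_domainp : domainp k f.
Proof. exact: Tmin_domainp fm sf fr T. Qed.

(** The derivative has leading coefficient [k + 1], nonzero because [k + 1 < p]. *)
Lemma model_discr : disc != 0.
Proof.
apply: model_domainp; last by rewrite -ltnS -sf lt_size_deriv // monic_neq0.
apply/negP => /eqP d0; have := congr1 (fun z : P => z`_k) d0.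
rewrite coef_deriv coef0 (_ : f`_k.+1 = 1); last by rewrite -(monicP fm) /lead_coef sf.
move/eqP; rewrite -mpolyC1 -mpolyCMn mpolyC_eq0 -(dvdn_pcharf chK) => /dvdn_leq le.
by have := le isT; move: kp; clear; nia.
Qed.

Lemma minrel_le B (z : 'cV['F_p]_n) D (g : P) : basis H (eM B) -> minrel H (eM B) (eM z) D g -> (D <= k.+1)%N.
Proof.
by move=> bB mg; have [B' [g' [_ _ _ _ gd]]] := Fp_normal chK XH Xd dp bB mg; exact: mx gd.
Qed.

Local Notation dl j := (delta_mx j 0 : 'cV_n).

Lemma lf_delta j : lf (eM (dl j)) = 'X_j.
Proof.
rewrite /lf (bigD1 j) //= !mxE !eqxx rmorph1 scale1r big1 ?addr0 // => i ne.
by rewrite !mxE (negPf ne) rmorph0 scale0r.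
Qed.

Lemma mul_delta (x : 'rV[K]_n) j : (x *m eM (dl j)) 0 0 = x 0 j.
Proof. by rewrite -meval_lf lf_delta mevalXU. Qed.

Lemma mul_shift (x : 'rV[K]_n) c j : (x *m eM (y + c *: dl j)) 0 0 = (x *m eM y) 0 0 + e c * x 0 j.
Proof. by rewrite map_mxD mulmxDr mxE map_mxZ -scalemxAr [X in _ + X]mxE mul_delta. Qed.

Lemma rel_root (z : 'cV[K]_n) (h : P) x : rel H (eM A) z h -> zeros H x ->
  root (map_poly (meval ((x *m eM A) 0)) h) ((x *m z) 0 0).
Proof. by move=> hr Vx; apply/eqP; rewrite -[LHS]/(evp h _ _) -meval_evr; exact: Vx. Qed.

Lemma fibre_points (t0 : 'rV[K]_r) (hs : 'I_n -> P) : coord_rel H (eM A) hs ->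
  (forall j, (lead_coef (hs j)).@[t0 0] != 0) -> disc.@[t0 0] != 0 ->
  exists rs (g : K -> 'rV[K]_n), [/\ uniq rs, size rs = k.+1, (forall z, (z \in rs) = (evp f (t0 0) z == 0)) &
    forall z, z \in rs -> [/\ zeros H (g z), g z *m eM A = t0 & (g z *m eM y) 0 0 = z]].
Proof.
move=> hsA hl d0; have [urs srs rsP] := uniq_fibre fm sf d0; exists (rootseq (map_poly (meval (t0 0)) f)).
have /boolp.choice[g gP] : forall z, exists x, z \in rootseq (map_poly (meval (t0 0)) f) ->
    [/\ zeros H x, x *m eM A = t0 & (x *m eM y) 0 0 = z].
  move=> z; have [zr|_] := boolP (z \in _); last by exists 0.
  have [|j|j|x xP] := @lift_fibre K n L H r (eM A) (eM y) k f t0 z hs fm sf fr T.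
  - by apply/eqP; rewrite -rsP.
  - by have [_] := hsA j.
  - exact: hl.
  by exists x.
by exists g.
Qed.

(* A linear form [y + c x_j] separating a generic fibre still has degree [k.+1]. *)
Lemma separating_form j : exists2 c : 'F_p, c != 0 & Tmin H (eM A) (eM (y + c *: dl j)) k.+1.
Proof.
apply: NNPP => no.
(* For [c = 0] the dummy value 1 keeps the product of all leading coefficients nonzero. *)
have /fin_all_exists[h hP] : forall c : 'F_p, exists h : P, h != 0 /\
    (c != 0 -> rel H (eM A) (eM (y + c *: dl j)) h /\ (size h <= k.+1)%N).
  move=> c; have [->|c0] := eqVneq c 0; first by exists 1; rewrite oner_neq0; split.
  apply: NNPP => nh; apply: no; exists c => // h hr h0; rewrite ltnNge; apply/negP => sh; apply: nh.
  by exists h.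
have [hs hsA] := coord_rel_exists bA.
have q0 : disc * (\prod_j lead_coef (hs j) * \prod_c lead_coef (h c)) != 0.
  rewrite !mulf_neq0 ?model_discr //; apply/prodf_neq0 => i _; rewrite lead_coef_eq0.
    by case: (hsA i).
  by case: (hP i).
have [w] := infinite_nonroot q0; rewrite !mevalM !mulf_eq0 !negb_or => /and3P[dw lw hw].
pose t0 : 'rV[K]_r := \row_i w i.
have t0E : t0 0 = w by apply: boolp.funext => i; rewrite mxE.
have {}lw i : (lead_coef (hs i)).@[t0 0] != 0.
  by move: lw; rewrite t0E rmorph_prod => /prodf_neq0; apply.
have {}hw c : (lead_coef (h c)).@[t0 0] != 0.
  by move: hw; rewrite t0E rmorph_prod => /prodf_neq0; apply.
have [|rs [g [urs srs _ gP]]] := fibre_points hsA lw; first by rewrite t0E.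
pose s := [seq (z, g z 0 j) | z <- rs].
have us : uniq s by rewrite map_inj_uniq // => a b [].
have ss : size s = k.+1 by rewrite size_map.
have [|c c0 uc] := separating e pp us; first by rewrite ss; move: kp; clear; nia.
have [h0 /(_ c0)[hr sh]] := hP c.
have m0 : map_poly (meval (t0 0)) (h c) != 0 by rewrite map_poly_eq0_id0.
have : (size [seq (u.1 + e c * u.2)%R | u <- s] < size (map_poly (meval (t0 0%R)) (h c)))%N.
  apply: max_poly_roots => //; apply/allP => z /mapP[u /mapP[a ars ->] ->].
  have [Vx xA xy] := gP a ars; have := rel_root hr Vx; rewrite xA mul_shift xy //.
rewrite size_map ss ltnNge => /negP; apply; apply: leq_trans sh; exact: size_poly.
Qed.

(** The minimal relation of [y + c x_j] has total degree at most [k + 1] by maximality and degree at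
    least [k + 1] in [T], so its leading coefficient is a constant and the form is integral. With
    [y] integral as well, so is [x_j]. *)
Lemma coord_integral j : integralOver (H \o msub (forms (eM A))) (H 'X_j).
Proof.
have relI (z : 'cV[K]_n) (h : P) : rel H (eM A) z h -> h \is monic -> integralOver (H \o msub (forms (eM A))) (H (lf z)).
  by move=> hr hm; exists h => //; rewrite /root -relE; apply/eqP.
have [c c0 Tc] := separating_form j; set z := y + c *: dl j in Tc.
have [D [g mg]] := minrel_exists (eM z) bA; have Dk := minrel_le bA mg.
have [gr g0 tg _] := mg; have sg := Tc g gr g0.
have DE : D = k.+1 by apply/eqP; rewrite eqn_leq Dk -ltnS (leq_trans sg) // size_tdm.
have sgE : size g = k.+2 by apply/eqP; rewrite eqn_leq sg -DE size_tdm.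
have := tg k.+1; rewrite DE subSnn => /msize1_polyC; set a := _@_0 => gE.
have a0 : a != 0.
  apply: contraNneq g0 => a0; rewrite -lead_coef_eq0 /lead_coef sgE [g`__]gE a0 mpolyC0 //.
have gm : (a^-1)%:MP%:P * g \is monic.
  by rewrite monicE lead_coefM lead_coefC /lead_coef sgE [g`__]gE -mpolyCM mulVf.
have iz := relI _ _ (rel_scale (a^-1) gr) gm; have iy := relI _ _ fr fm.
have -> : H 'X_j = H ((e c)^-1)%:MP * (H (lf (eM z)) - H (lf (eM y))).
  rewrite -rmorphB /z map_mxD map_mxZ lfD lfZ lf_delta [lf (eM y) + _]addrC addrK -rmorphM mulrA -mpolyCM mulVf ?mul1r //.
  by rewrite fmorph_eq0.
apply: integral_mul; last exact: integral_sub.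
have -> : H ((e c)^-1)%:MP = (H \o msub (forms (eM A))) ((e c)^-1)%:MP by rewrite /= msubC.
exact: integral_id.
Qed.

(** Integrality of the coordinates gives some monic relation, and maximality forbids that all
    relations have degree above [k + 1] in [T]; [mono_factor_mpoly] extracts a short monic one. *)
Lemma monic_rel (z : 'cV['F_p]_n) : exists G : P, [/\ G \is monic, rel H (eM A) (eM z) G & (size G <= k.+2)%N].
Proof.
have [G0 G0m G0r] : exists2 G : P, G \is monic & rel H (eM A) (eM z) G.
  have [G Gm Gr] : integralOver (H \o msub (forms (eM A))) (H (lf (eM z))).
    rewrite /lf rmorph_sum; elim/big_ind: _ => [||j _]; [exact: integral0|exact: integral_add|].
    rewrite -mul_mpolyC rmorphM; apply: integral_mul; last exact: coord_integral.
    have -> : H ((eM z) j 0)%:MP = (H \o msub (forms (eM A))) ((eM z) j 0)%:MP by rewrite /= msubC.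
    exact: integral_id.
  by exists G => //; rewrite /rel relE; apply/eqP.
have [h [hr h0 sh]] : exists h, [/\ rel H (eM A) (eM z) h, h != 0 & (size h <= k.+2)%N].
  apply: NNPP => no; have : good H e A z k.+2.
    by split=> // h hr h0; rewrite ltnNge; apply/negP => sh; apply: no; exists h.
  by move/mx; rewrite ltnn.
have [le|lt] := leqP (size G0) (size h); first by exists G0; split=> //; apply: leq_trans sh.
have [c [S1 [Q1 [c0 mS fE cS sS]]]] := mono_factor_mpoly (rel_lin (A := eM A) (y := eM z)) G0m G0r h0 hr lt.
exists S1; split=> //; last exact: leq_trans sh.
by have [cr|//] := relM cS; case/eqP: c0; exact: rel_const iA cr.
Qed.

Lemma integral_coords : exists hs, coord_rel H (eM A) hs /\ forall j, hs j \is monic.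
Proof.
have /fin_all_exists[hs hsP] : forall j, exists h : P, h \is monic /\ root (map_poly (H \o msub (forms (eM A))) h) (H 'X_j).
  by move=> j; have [h hm hr] := coord_integral j; exists h.
exists hs; split=> j; have [hm hr] := hsP j => //; split; first exact: monic_neq0.
exact/eqP.
Qed.

(** Off the discriminant the lifts of the [k + 1] roots give [k + 1] pairs [(T, x_j)]. A second
    point over one root would add a further pair; a rational form [y + c x_j] separates all of them,
    yet it satisfies a monic relation of degree at most [k + 1]. *)
Lemma fibre_unique (x x' : 'rV[K]_n) : disc.@[(x *m eM A) 0] != 0 -> zeros H x -> zeros H x' ->
  x *m eM A = x' *m eM A -> (x *m eM y) 0 0 = (x' *m eM y) 0 0 -> x = x'.
Proof.
move=> d0 Vx Vx' EA Ey; apply/rowP => j; apply/eqP/negPn/negP => nej.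
have [hs [hsA hsm]] := integral_coords; set t0 := x *m eM A in d0.
have [|//|rs [g [urs srs rsP gP]]] := @fibre_points t0 hs hsA.
  by move=> i; rewrite (monicP (hsm i)) meval1 oner_neq0.
set z0 := (x *m eM y) 0 0.
have z0r : z0 \in rs by rewrite rsP -/(root _ _); exact: rel_root fr Vx.
pose s := [seq (z, g z 0 j) | z <- rs].
have [x2 [V2 A2 y2 ns]] : exists x2, [/\ zeros H x2, x2 *m eM A = t0, (x2 *m eM y) 0 0 = z0 & (z0, x2 0 j) \notin s].
  have key x2 : x2 0 j != g z0 0 j -> (z0, x2 0 j) \notin s.
    by apply: contra => /mapP[z _ [<- ->]].
  have [E|ne] := eqVneq (x 0 j) (g z0 0 j); last by exists x; split=> //; exact: key.
  by exists x'; split=> //; apply: key; rewrite -E eq_sym.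
have us : uniq ((z0, x2 0 j) :: s) by rewrite /= ns map_inj_uniq // => a b [].
have ss : size ((z0, x2 0 j) :: s) = k.+2 by rewrite /= size_map srs.
have [|c c0 uc] := separating e pp us; first by rewrite ss.
have [G [Gm Gr sG]] := monic_rel (y + c *: dl j).
have Gm' : map_poly (meval (t0 0)) G \is monic by exact: monic_map.
have : (size [seq (u.1 + e c * u.2)%R | u <- (z0, x2 0%R j) :: s] < size (map_poly (meval (t0 0%R)) G))%N.
  apply: max_poly_roots (monic_neq0 Gm') _ uc; apply/allP => z; rewrite inE => /orP[/eqP ->|/mapP[u /mapP[a ars ->] ->]].
    by have := rel_root Gr V2; rewrite A2 mul_shift y2.
  by have [Va aA ay] := gP a ars; have := rel_root Gr Va; rewrite aA mul_shift ay.
rewrite size_map ss ltnNge => /negP; apply; apply: leq_trans sG; exact: size_poly.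
Qed.

Hypothesis XF : forall x, X x <-> X (map_mx (fun a => a ^+ p) x).

Lemma frob_mx m1 (x : 'rV[K]_n) (M : 'M['F_p]_(n, m1)) :
  map_mx (fun a => a ^+ p) x *m eM M = map_mx (fun a => a ^+ p) (x *m eM M).
Proof.
apply/matrixP => i j; rewrite !mxE -(pFrobenius_autE chK) rmorph_sum; apply: eq_bigr => l _.
by rewrite !mxE rmorphM /= !(pFrobenius_autE chK) -[e _ ^+ p]rmorphXn /= Fp_exp.
Qed.

Lemma closed_pth_root (x : K) : exists a, a ^+ p = x.
Proof. exact: (closed_rootn x (prime_gt0 pp)). Qed.

(** Applying Frobenius to the coefficients of [f] gives another monic relation of the same degree,
    since [X] is stable under Frobenius; the difference of the two is too short to be a nonzero
    relation. *)
Lemma model_frobenius i m : (f`_i)@_m ^+ p = (f`_i)@_m.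
Proof.
pose F : {rmorphism K -> K} := pFrobenius_aut chK.
pose fF : P := map_poly (map_mpoly F) f.
have sF : size fF = k.+2.
  by rewrite /fF size_map_poly_id0 ?sf // (monicP fm) rmorph1 oner_neq0.
have evF (q : {mpoly K[r]}) (w : 'I_r -> K) : (map_mpoly F q).@[fun i => w i ^+ p] = F q.@[w].
  rewrite -[LHS]/((meval (fun i => w i ^+ p) \o map_mpoly F)%FUN q) -[RHS]/((F \o meval w)%FUN q).
  apply: rmorph_mpoly_eq => [c|j]; rewrite [LHS]/= [RHS]/=.
    by rewrite map_mpolyC !mevalC.
  by rewrite map_mpolyX !mevalXU pFrobenius_autE.
have evpF (h : P) w s : evp (map_poly (map_mpoly F) h) (fun i => w i ^+ p) (s ^+ p) = F (evp h w s).
  rewrite /evp -horner_map /= -(pFrobenius_autE chK s); congr (_.[_]).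
  by rewrite -!map_poly_comp; apply: eq_map_poly => q; rewrite [LHS]/= evF.
have fFr : rel H (eM A) (eM y) fF.
  apply/ideal_of_zeros => x Vx; rewrite meval_evr.
  have /boolp.choice[rt rtP] := closed_pth_root.
  pose x' := map_mx rt x; have xE : x = map_mx (fun a => a ^+ p) x' by apply/rowP => j; rewrite !mxE rtP.
  have Vx' : zeros H x' by apply/XH/XF; rewrite -xE; apply/XH.
  have := evpF f ((x' *m eM A) 0) ((x' *m eM y) 0 0); rewrite -[X in F X]meval_evr Vx' // rmorph0 => <-.
  rewrite xE !frob_mx; congr (evp _ _ _); last by rewrite mxE.
  by apply: boolp.funext => j; rewrite mxE.
have E : fF = f.
  apply/eqP; rewrite -subr_eq0; apply/negPn/negP => n0.
  have dr : rel H (eM A) (eM y) (fF - f).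
    by have := rel_lin (-1) fFr fr; rewrite mulN1r.
  have := T dr n0; rewrite ltnNge => /negP; apply; apply/leq_sizeP => j jk.
  rewrite coefB; move: jk; rewrite leq_eqVlt => /orP[/eqP <-|lt].
    have l1 : f`_k.+1 = 1 by rewrite -(monicP fm) /lead_coef sf.
    by rewrite /fF coef_map /= l1 rmorph1 subrr.
  by rewrite !nth_default ?subrr ?sf ?sF.
by rewrite -{2}E coef_map /= mcoeff_map_mpoly /= pFrobenius_autE.
Qed.

Lemma model_points :
  (#|[set ab : 'rV['F_p]_r * 'F_p | (evp f ((eM ab.1) 0%R) (e ab.2) == 0%R) && (discr.@[(eM ab.1) 0%R] != 0%R)]|
   <= #|[set x : 'rV['F_p]_n | boolp.asbool (X (eM x))]|)%N.
Proof.
apply: leq_trans (leq_imset_card (fun x : 'rV['F_p]_n => (x *m A, (x *m y) 0 0)) _).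
apply/subset_leq_card/subsetP => -[a b]; rewrite inE /= => /andP[fab dab].
have [hs [hsA hsm]] := integral_coords.
have [|j|j|x [Vx xA xy]] := @lift_fibre K n L H r (eM A) (eM y) k f (eM a) (e b) hs fm sf fr T.
- exact/eqP.
- by have [_] := hsA j.
- by rewrite (monicP (hsm j)) meval1 oner_neq0.
have eF m1 (M : 'M['F_p]_(1, m1)) : map_mx (fun a => a ^+ p) (eM M) = eM M.
  by apply/matrixP => i j; rewrite !mxE -rmorphXn /= Fp_exp.
have xF : x = map_mx (fun a => a ^+ p) x.
  apply: fibre_unique; rewrite ?xA //.
  - by apply/XH/(proj1 (XF x))/XH.
  - by rewrite frob_mx xA eF.
  - by rewrite frob_mx [RHS]mxE xy -rmorphXn /= Fp_exp.
have /fin_all_exists[x0 x0E] : forall j, exists a0, e a0 = x 0 j.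
  by move=> j; apply: frob_fixed => //; rewrite [in RHS]xF mxE.
have xE : x = eM (\row_j x0 j) by apply/rowP => j; rewrite !mxE x0E.
apply/imsetP; exists (\row_j x0 j).
  by rewrite inE; apply/boolp.asboolP; rewrite -xE; apply/XH.
congr (_, _); first by apply: (map_mx_inj (f := e)); rewrite map_mxM -xE.
by apply: (fmorph_inj e); rewrite -xy xE -map_mxM mxE.
Qed.

End Model.

(** * Irreducible sections by lines *)

Lemma map_mulmodmx (R S : comNzRingType) (phi : {rmorphism R -> S}) n (f g : {poly R}) : f \is monic -> size f = n.+2 ->
  map_mx phi (mulmodmx n f g) = mulmodmx n (map_poly phi f) (map_poly phi g).
Proof.
move=> mf sf; have mF : map_poly phi f \is monic by exact: monic_map.
have sF : size (map_poly phi f) = n.+2 by rewrite size_map_poly_id0 ?sf // (monicP mf) rmorph1 oner_neq0.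
apply/matrixP => i j; rewrite !mxE -coef_map; congr (_`_ _).
rewrite [in RHS](_ : 'X^i * _ = map_poly phi (rdivp ('X^i * g) f) * map_poly phi f + map_poly phi (rmodp ('X^i * g) f)).
  rewrite rmodp_addl_mul_small // sF; apply: leq_ltn_trans (size_poly _ _) _.
  by rewrite ltnS; exact: (size_rmodf mf sf).
by rewrite -rmorphM -rmorphD -(rdivp_eq mf) rmorphM /= map_polyXn.
Qed.

Lemma det_map_mulmodmx (R S : comNzRingType) (phi : {rmorphism R -> S}) n (f g : {poly R}) : f \is monic -> size f = n.+2 ->
  phi (\det (mulmodmx n f g)) = \det (mulmodmx n (map_poly phi f) (map_poly phi g)).
Proof. by move=> mf sf; rewrite -map_mulmodmx // det_map_mx. Qed.

Lemma kernel_or_minor (R : idomainType) m n (B : 'M[R]_(m, n)) :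
  (exists2 v : 'rV[R]_m, v != 0 & v *m B = 0) \/ exists g : 'I_m -> 'I_n, \det (colsub g B) != 0.
Proof.
pose F := @FracField.tofrac R; pose B' := map_mx F B.
have [fr|nf] := boolP (row_free B').
  have rf : row_full B'^T by rewrite /row_full mxrank_tr.
  right; exists (fullrankfun rf); have := fullrowsub_unit rf.
  rewrite -unitmx_tr trmx_mxsub trmxK -map_mxsub unitmxE det_map_mx unitfE.
  by apply: contraNneq => ->; rewrite rmorph0.
left; have : kermx B' != 0 by rewrite kermx_eq0.
case/rowV0Pn => w /sub_kermxP wB w0.
have [c c0 [q qE]] := clear_denominators (rVpoly w).
have wE : map_mx F (poly_rV q) = F c *: w :> 'rV_m.
  by rewrite map_poly_rV -[w in RHS]rVpolyK -linearZ; congr poly_rV.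
exists (poly_rV q).
  apply: contraNneq w0 => q0; move: wE; rewrite q0 map_mx0 => /esym/eqP.
  by rewrite scaler_eq0 tofrac_eq0 (negPf c0).
have E : map_mx F (poly_rV q *m B) = 0 by rewrite map_mxM wE -scalemxAl wB scaler0.
by apply/matrixP => i j; have /matrixP/(_ i j)/eqP := E; rewrite [X in X == _]mxE [X in _ == X]mxE tofrac_eq0 => /eqP ->; rewrite mxE.
Qed.

Section Weight.
Variable K : comNzRingType.

(* Homogenization: [t ^ i T ^ k] becomes [t ^ i T ^ (i + k)]. *)
Definition homogenize : {poly {poly K}} -> {poly {poly K}} :=
  horner_eval 'X \o map_poly (horner_eval (('X%:P) * 'X) \o map_poly (polyC \o polyC)).
HB.instance Definition _ := GRing.RMorphism.on homogenize.

Lemma coef_homogenize g m i : (homogenize g)`_m`_i = if (i <= m)%N then g`_(m - i)`_i else 0.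
Proof.
have thE (c : {poly K}) : (map_poly (polyC \o polyC) c).['X%:P * 'X] = \poly_(a < size c) (c`_a *: 'X^a).
  rewrite (@horner_coef_wide _ (size c)) ?size_poly // poly_def; apply: eq_bigr => a _.
  rewrite coef_map_id0 ?polyC0 //= exprMn mulrA -rmorphXn -rmorphM /= mul_polyC -mul_polyC.
  by rewrite -!mul_polyC.
have -> : homogenize g = \sum_(k < size g) \poly_(a < size g`_k) (g`_k`_a *: 'X^a) * 'X^k.
  rewrite /homogenize /= /horner_eval (@horner_coef_wide _ (size g)) ?size_poly //; apply: eq_bigr => k _.
  by rewrite -thE coef_map_id0 //= rmorph0 horner0.
rewrite !coef_sum; have [im|mi] := leqP i m; last first.
  rewrite big1 // => k _; rewrite coefMXn; case: ltnP => km; first by rewrite coef0.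
  rewrite coef_poly; case: ifP => _; last by rewrite coef0.
  by rewrite coefZ coefXn; case: eqP => [E|]; rewrite ?mulr0 //; move: E mi km; move: (nat_of_ord k) => z; lia.
have [lt|le] := ltnP (m - i) (size g); last first.
  rewrite [g`_(m - i)]nth_default // coef0 big1 // => k _; rewrite coefMXn; case: ltnP => km; first by rewrite coef0.
  rewrite coef_poly; case: ifP => _; last by rewrite coef0.
  rewrite coefZ coefXn; case: eqP => [E|]; rewrite ?mulr0 //; exfalso; have := ltn_ord k; move: E le km im.
  by move: (nat_of_ord k) => z; move: (size _) => y; clear; lia.
rewrite (bigD1 (Ordinal lt)) //= big1 ?addr0 => [|k ne].
  rewrite coefMXn ltnNge leq_subr /= subKn // coef_poly; case: ltnP => [_|ge]; first by rewrite coefZ coefXn eqxx mulr1.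
  by rewrite coef0 nth_default.
rewrite coefMXn; case: ltnP => km; first by rewrite coef0.
rewrite coef_poly; case: ifP => _; last by rewrite coef0.
rewrite coefZ coefXn; case: eqP => [E|]; rewrite ?mulr0 //; move: ne; rewrite -val_eqE /=; move: E km im.
by move: (nat_of_ord k) => z; clear; lia.
Qed.

Lemma tdeg_homogenize w g : tdeg_le w g <-> (size (homogenize g) <= w.+1)%N.
Proof.
split=> [tg|sg k i wk].
  apply/leq_sizeP => m wm; apply/polyP => i; rewrite coef_homogenize coef0; case: leqP => // im.
  by apply: tg; rewrite subnKC.
have := coef_homogenize g (k + i) i; rewrite leq_addl addnK => <-.
by rewrite [(homogenize g)`__]nth_default ?coef0 // (leq_trans sg) // addnC.
Qed.

End Weight.

(** A homogenized factor has degree at least the [T]-degree of the factor, and both degrees add. For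
    the product they agree, so they agree for each factor. *)
Lemma tdeg_factor (K : idomainType) (g h : {poly {poly K}}) : g \is monic -> h \is monic ->
  tdeg_le (size (g * h)%R).-1 (g * h) -> tdeg_le (size g).-1 g.
Proof.
move=> mg mh /tdeg_homogenize; rewrite rmorphM /=.
have low (q : {poly {poly K}}) : q \is monic -> (size q <= size (homogenize q))%N.
  move=> mq; have q0 : (0 < size q)%N by rewrite size_poly_gt0 monic_neq0.
  rewrite -[X in (X <= _)%N](prednK q0) ltnNge; apply/negP => le.
  have := coef_homogenize q (size q).-1 0; rewrite subn0 leq0n -[q`__]/(lead_coef q) (monicP mq) [(homogenize q)`__]nth_default // coef0 coef1 /=.
  by move/eqP; rewrite eq_sym oner_eq0.
have g0 := monic_neq0 mg; have h0 := monic_neq0 mh.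
have p1 : (0 < size g)%N by rewrite size_poly_gt0.
have p2 : (0 < size h)%N by rewrite size_poly_gt0.
have lg := low _ mg; have lh := low _ mh.
have Hg : homogenize g != 0 by rewrite -size_poly_gt0 (leq_trans p1).
have Hh : homogenize h != 0 by rewrite -size_poly_gt0 (leq_trans p2).
rewrite (size_mul Hg Hh) (size_mul g0 h0) => le; apply/tdeg_homogenize.
by move: p1 p2 lg lh le; move: (size g) (size h) (size (homogenize g)) (size (homogenize h)) => a b c d; clear; lia.
Qed.

Section System.
Variables (R : comNzRingType) (k : nat).
Local Notation S := (simplex k k).
Local Notation ti u := (nat_of_ord (val (enum_val (u : 'I_#|{: S}|))).1).
Local Notation tj u := (nat_of_ord (val (enum_val (u : 'I_#|{: S}|))).2).

(* The rows are indexed by the monomials [t ^ i T ^ j] of degree at most [k]; column [c] is the coefficient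
   of [t ^ c] at [T = al]. *)
Definition sys (N : nat) (al : {poly R}) : 'M[R]_(#|{: S}|, N) := \matrix_(u, c) ('X^(ti u) * al ^+ tj u)`_c.
Definition ofv (v : 'rV[R]_#|{: S}|) : {poly {poly R}} := \sum_u (v 0 u *: 'X^(ti u))%:P * 'X^(tj u).

Lemma horner_ofv N al v (c : 'I_N) : (ofv v).[al]`_c = (v *m sys N al) 0 c.
Proof.
rewrite /ofv horner_sum coef_sum mxE; apply: eq_bigr => u _.
by rewrite hornerCM hornerXn -scalerAl coefZ mxE.
Qed.

Lemma coef_ofv v a b : (ofv v)`_b`_a = \sum_u v 0 u * ((a == ti u) && (b == tj u))%:R.
Proof.
rewrite /ofv !coef_sum; apply: eq_bigr => u _; rewrite mul_polyC coefZ coefXn.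
case: (b == _); last by rewrite mulr0 coef0 andbF mulr0.
by rewrite mulr1 coefZ coefXn andbT.
Qed.

Lemma coef_ofv_eq v u : (ofv v)`_(tj u)`_(ti u) = v 0 u.
Proof.
rewrite coef_ofv (bigD1 u) //= !eqxx mulr1 big1 ?addr0 // => w ne.
case: eqP => [e1|]; last by rewrite mulr0.
case: eqP => [e2|]; last by rewrite mulr0.
suff E : u = w by rewrite E eqxx in ne.
apply: enum_val_inj; apply: val_inj; apply/eqP.
by rewrite (surjective_pairing (val (enum_val u))) (surjective_pairing (val (enum_val w))) xpair_eqE -!val_eqE /= e1 e2 !eqxx.
Qed.

Lemma ofv_eq0 v : ofv v = 0 -> v = 0.
Proof. by move=> v0; apply/rowP => u; rewrite -coef_ofv_eq v0 !coef0 mxE. Qed.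

Lemma tdeg_ofv v : tdeg_le k (ofv v).
Proof.
move=> b a ab; rewrite coef_ofv big1 // => u _; case: eqP => [e1|]; last by rewrite mulr0.
case: eqP => [e2|]; last by rewrite mulr0.
by have := valP (enum_val u); rewrite -e1 -e2 leqNgt ab.
Qed.

Lemma ofv_surj g : tdeg_le k g -> exists v, ofv v = g.
Proof.
move=> tg; exists (\row_u g`_(tj u)`_(ti u)); apply/polyP => b; apply/polyP => a.
have [le|lt] := leqP (a + b) k; last by rewrite tg // (tdeg_ofv _) .
have a1 : (a < k.+1)%N by lia.
have b1 : (b < k.+1)%N by lia.
have ab : ((Ordinal a1, Ordinal b1).1 + (Ordinal a1, Ordinal b1).2 <= k)%N by [].
by have := coef_ofv_eq (\row_u g`_(tj u)`_(ti u)) (enum_rank (exist (fun x : 'I_k.+1 * 'I_k.+1 => (x.1 + x.2 <= k)%N) (Ordinal a1, Ordinal b1) ab : S)); rewrite mxE enum_rankK.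
Qed.

End System.

Lemma map_sys (R R' : comNzRingType) (phi : {rmorphism R -> R'}) k N al :
  map_mx phi (sys k N al) = sys k N (map_poly phi al).
Proof.
by apply/matrixP => u c; rewrite !mxE -coef_map rmorphM /= map_polyXn rmorphXn.
Qed.

Lemma msize_det (K : idomainType) r m c (A : 'M[{mpoly K[r]}]_m) : (forall i j, (msize (A i j) <= c.+1)%N) ->
  (msize (\det A) <= (m * c).+1)%N.
Proof.
move=> Ac; apply: leq_trans (msize_sum _ _ _) _; apply/bigmax_leqP => s _ /=.
rewrite -signr_odd; set q := \prod_i _.
have sq : (msize q <= (m * c).+1)%N.
  have : (msize q <= (\sum_(i < m) c).+1)%N.
    rewrite /q; apply: (big_ind2 (fun (x : {mpoly K[r]}) (n : nat) => (msize x <= n.+1)%N)) => [|x a y b|i _].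
    - by rewrite msize1.
    - exact: msizeM_leW.
    - exact: Ac.
  by rewrite sum_nat_const card_ord.
case: (odd _); rewrite ?expr0 ?expr1 ?mul1r //.
by rewrite mulN1r msizeN.
Qed.

(** * Reducible sections by lines through a point *)

Section Bertini.
Variables (K : closedFieldType) (r k : nat) (f : {poly {mpoly K[r]}}).
Local Notation S := {mpoly K[r]}.
Hypotheses (mf : f \is monic) (sf : size f = k.+2) (tf : tdm k.+1 f).
Hypothesis df : domainp k f.
Variable x0 : 'I_r -> K.
Hypothesis d0 : (\det (mulmodmx k f f^`())).@[x0] != 0.
(** One more than the Bezout number of [f] and a polynomial of degree [k]: vanishing to this order
    on the branch forces a zero norm. *)
Let N := (k.+1 * k).+1.

(* [ray b] restricts to the line through [x0] of direction [b], and [cone] to the generic such line. *)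
Definition cone : {rmorphism {mpoly K[r]} -> {poly {mpoly K[r]}}} :=
  onto_line (@mpolyC r K) (fun i => (x0 i)%:MP) (fun i => 'X_i).
Definition ray (b : 'I_r -> K) : {rmorphism {mpoly K[r]} -> {poly K}} := onto_line idfun x0 b.
Let F : {poly {poly S}} := map_poly cone f.

Lemma rayE b q : ray b q = map_poly (meval b) (cone q).
Proof.
rewrite -[RHS]/((map_poly (meval b) \o cone)%FUN q); apply: rmorph_mpoly_eq => [c|i] /=.
  by rewrite !onto_lineC map_polyC /= mevalC.
rewrite !onto_lineX rmorphD rmorphM /= !map_polyC /= map_polyX mevalC.
by rewrite mevalXU.
Qed.

Lemma coneX i : cone 'X_i = (x0 i)%:MP%:P + ('X_i)%:P * 'X.
Proof. exact: onto_lineX. Qed.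
Lemma coneC c : cone c%:MP = c%:MP%:P.
Proof. exact: onto_lineC. Qed.

Lemma cone0 q : (cone q).[0] = (q.@[x0])%:MP.
Proof.
rewrite -[LHS]/((horner_eval 0 \o cone)%FUN q) -[RHS]/((@mpolyC r K \o meval x0)%FUN q).
apply: rmorph_mpoly_eq => [c|i] /=.
  by rewrite coneC /horner_eval hornerC mevalC.
by rewrite coneX /horner_eval hornerD hornerM hornerX mulr0 addr0 hornerC mevalXU.
Qed.

Let gr (i : nat) (q : S) := (msize q <= i.+1)%N.

Lemma coef_cone q i : gr i (cone q)`_i.
Proof.
elim/mpoly_alg_ind: q i => [c|j|p q hp hq|p q hp hq] i; rewrite /gr.
- by rewrite coneC coefC; case: (i == 0)%N => //; rewrite ?msize0 // msizeC; case: (_ != _).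
- rewrite coneX coefD coefC coefCM coefX; case: i => [|[|i]] /=; rewrite ?mulr0 ?addr0 ?add0r ?mulr1 ?msize0 //.
    by rewrite msizeC; case: (_ != _).
  by rewrite msizeX mdeg1.
- by rewrite rmorphD coefD; apply: leq_trans (msizeD_le _ _) _; rewrite geq_max; apply/andP; split; [exact: hp|exact: hq].
rewrite rmorphM coefM; apply: leq_trans (msize_sum _ _ _) _; apply/bigmax_leqP => j _.
by rewrite -[i in (_ <= i.+1)%N](subnKC (ltn_ord j : (j <= i)%N)); apply: msizeM_leW; [exact: hp|exact: hq].
Qed.

Lemma branch_exists : exists al0 : K, exists al : {poly S},
  [/\ al.[0] = al0%:MP, (forall i, gr i al`_i), (forall i, (i < N)%N -> (F.[al])`_i = 0)
    & (map_poly (meval x0) f).[al0] = 0 /\ (map_poly (meval x0) f)^`().[al0] != 0].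
Proof.
have s2 : size (map_poly (meval x0) f) = k.+2.
  by rewrite size_map_poly_id0 ?sf // (monicP mf) rmorph1 oner_neq0.
have s1 : size (map_poly (meval x0) f) != 1%N by rewrite s2.
have /closed_rootP[al0 /rootP r0] := s1.
have r1 : (map_poly (meval x0) f)^`().[al0] != 0.
  have [u [v E]] := det_mulmodmx_ideal mf sf (meval x0) al0 f^`().
  by apply: contraNneq d0 => e0; rewrite E r0 -deriv_map e0 !mulr0 addr0.
have F0 : map_poly (horner_eval 0) F = map_poly (@mpolyC r K) (map_poly (meval x0) f).
  by rewrite /F -!map_poly_comp; apply: eq_map_poly => q; exact: cone0.
exists al0.
have [||||||||||b [b0 bg bN]] := @hensel S F al0%:MP (((map_poly (meval x0) f)^`().[al0])^-1)%:MP _ _ gr _ _ _ _ _ _ _ _ N.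
- by rewrite F0 horner_map r0 rmorph0.
- by rewrite -deriv_map F0 [(map_poly (@mpolyC r K) _)^`()]deriv_map horner_map -rmorphM /= mulVf // rmorph1.
- by move=> i; rewrite /gr msize0.
- by move=> i x y hx hy; apply: leq_trans (msizeD_le _ _) _; rewrite geq_max; apply/andP.
- by move=> i x; rewrite /gr msizeN.
- by move=> i j x y; exact: msizeM_leW.
- by rewrite /gr msize1.
- by rewrite /gr msizeC; case: (_ != _).
- by rewrite /gr msizeC; case: (_ != _).
- by move=> j i; rewrite /F coef_map; exact: coef_cone.
by exists b; split.
Qed.

Lemma ray_monic (S' : comNzRingType) (phi : {rmorphism S -> S'}) : map_poly phi f \is monic /\ size (map_poly phi f) = k.+2.
Proof. by rewrite monic_map // size_map_poly_id0 ?sf // (monicP mf) rmorph1 oner_neq0. Qed.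

Lemma tdeg_line (S' : comNzRingType) (iota : {rmorphism K -> S'}) (a b : 'I_r -> S') :
  tdeg_le k.+1 (map_poly (onto_line iota a b) f).
Proof.
move=> j i ij; rewrite coef_map nth_default //; apply: leq_trans (size_onto_line _ _ _ _) _.
by apply: leq_trans (tf j) _; move: ij; clear; lia.
Qed.

Variables (E : finType) (e : E -> K).
Hypotheses (e_inj : injective e) (kE : (k.+1 < #|E|)%N).

(** The norm of [h] vanishes to a higher order than its degree permits, so it is zero. At a
    parameter value [tau] other than 0 the generic line becomes an affine change of coordinates,
    which would carry [h] to an element of norm zero for [f] itself. *)
Lemma cone_nonvanishing (al : {poly S}) (h : {poly {poly S}}) : (forall i, (i < N)%N -> (F.[al])`_i = 0) ->
  tdeg_le k h -> (forall i, (i < N)%N -> (h.[al])`_i = 0) -> h = 0.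
Proof.
move=> Fal th hal; have [mF sF] := ray_monic cone.
have D0 : \det (mulmodmx k F h) = 0.
  have [u [v E0]] := det_mulmodmx_ideal mF sF idfun al h; rewrite !map_poly_id // in E0.
  apply/polyP => i; rewrite coef0; have [lt|le] := ltnP i N; last first.
    by rewrite nth_default // (leq_trans _ le) //; apply: (size_det_mulmodmx mF sF _ th); exact: tdeg_line.
  rewrite [\det _]E0 coefD !coefM !big1 ?addr0 // => j _.
    by rewrite Fal ?mulr0 // (leq_ltn_trans (leq_subr _ _)).
  by rewrite hal ?mulr0 // (leq_ltn_trans (leq_subr _ _)).
apply/eqP/negPn/negP => h0; have l0 : lead_coef h != 0 by rewrite lead_coef_eq0.
have sl : (size (lead_coef h) <= k.+1)%N.
  apply/leq_sizeP => i ki; apply: th; apply: leq_trans ki (leq_addr _ _).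
have sh : (size h <= k.+1)%N.
  apply/leq_sizeP => j kj; apply/polyP => i; rewrite coef0; apply: th; exact: leq_trans kj (leq_addl _ _).
(* The value [tau] must be nonzero, to be inverted, and must not kill the leading coefficient of
   [h]; at most [k + 1] values are excluded. *)
have q0 : 'X * lead_coef h != 0 by rewrite mulf_neq0 // polyX_eq0.
have ei : injective (fun z : E => (e z)%:MP_[r]) by move=> x y /eqP; rewrite -subr_eq0 -mpolyCB mpolyC_eq0 subr_eq0 => /eqP/e_inj.
have := card_roots_le ei q0; rewrite mulrC size_mulX // => cr.
have [z zr] : exists z, ~~ root (lead_coef h * 'X) (e z)%:MP_[r].
  apply/existsP; rewrite -negb_forall; apply/negP => /forallP all.
  have : (#|E| <= k.+1)%N.
    by apply: leq_trans sl; apply: leq_trans cr; apply/subset_leq_card/subsetP => z _; rewrite inE.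
  by rewrite leqNgt kE.
move: zr; rewrite rootE hornerM hornerX mulf_eq0 negb_or mpolyC_eq0; set tau := e z => /andP[l1 t0].
(* The substitution of [x0 + tau b] for the coordinates, with inverse [th2]. *)
pose th1 : {rmorphism S -> S} := horner_eval tau%:MP \o cone.
pose th2 : {rmorphism S -> S} := msub (fun i => (tau^-1)%:MP * ('X_i - (x0 i)%:MP)).
have tt : tau%:MP_[r] * (tau^-1)%:MP = 1 by rewrite -mpolyCM mulfV.
have K12 : th1 \o th2 =1 id.
  apply: (@rmorph_mpoly_eq K r S (th1 \o th2) idfun) => [c|i] /=.
    by rewrite msubC coneC /horner_eval hornerC.
  rewrite msubX rmorphM rmorphB /= !coneC coneX /horner_eval.
  by rewrite hornerM hornerD hornerN hornerD hornerM hornerX !hornerC addrAC subrr add0r mulrC -mulrA tt mulr1.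
have K21 : th2 \o th1 =1 id.
  apply: (@rmorph_mpoly_eq K r S (th2 \o th1) idfun) => [c|i] /=.
    by rewrite coneC /horner_eval hornerC msubC.
  rewrite coneX /horner_eval hornerD hornerM hornerX !hornerC rmorphD rmorphM /= !msubC msubX.
  by rewrite mulrC mulrA tt mul1r addrC subrK.
pose hh := map_poly (horner_eval tau%:MP) h.
have hh0 : hh != 0.
  apply: contraNneq l1 => E0; have := congr1 (fun q : {poly S} => q`_(size h).-1) E0.
  by rewrite coef_map coef0 => E1; apply/eqP.
have G0 : map_poly th2 hh != 0.
  apply: contraNneq hh0 => E0; have := congr1 (map_poly th1) E0.
  have -> : map_poly th1 (map_poly th2 hh) = hh by apply/polyP => i; rewrite !coef_map; exact: K12.
  by move=> ->; apply/eqP; apply/polyP => i; rewrite coef_map !coef0; exact: (rmorph0 th1).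
have := df G0; rewrite (leq_trans (size_poly _ _)) ?(leq_trans (size_poly _ _)) // => /(_ isT)/negP; apply.
have [mF1 sF1] := ray_monic th1.
have fE : map_poly th2 (map_poly th1 f) = f.
  by rewrite -map_poly_comp map_poly_id // => q _; exact: K21.
rewrite -[X in mulmodmx k X]fE -det_map_mulmodmx // (_ : \det _ = 0) ?rmorph0 //.
have -> : map_poly th1 f = map_poly (horner_eval tau%:MP) F by rewrite -map_poly_comp.
by rewrite -det_map_mulmodmx // D0 rmorph0.
Qed.

(** The polynomial [de] is a maximal minor of [sys]: its size is the number of monomials, and its
    entries have degree at most [(k + 1) k], the largest column index. In a factorization only one
    factor vanishes at the simple root [al0]; the other is a unit along the branch, so the first
    vanishes there to order [N] and its coefficients lie in the kernel. *)
Theorem bertini : exists de : S, [/\ de != 0, (msize de <= (#|{: simplex k k}| * (k.+1 * k)).+1)%N &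
  forall b, de.@[b] != 0 -> domainp k (map_poly (ray b) f)].
Proof.
have [al0 [al [al_0 alg Fal [r0 r1]]]] := branch_exists.
case: (kernel_or_minor (sys k N al)) => [[v v0 vB]|[g dg]].
  case/eqP: v0; apply: ofv_eq0; apply: (cone_nonvanishing Fal); first exact: tdeg_ofv.
  by move=> i iN; rewrite -[i]/(nat_of_ord (Ordinal iN)) horner_ofv vB mxE.
exists (\det (colsub g (sys k N al))); split=> //.
  apply: msize_det => u c; rewrite !mxE.
  have aX j i : gr i (al ^+ j)`_i.
    apply: (coefPX (P := gr)) => //.
    - by move=> i0; rewrite /gr msize0.
    - by move=> i0 x y hx hy; apply: leq_trans (msizeD_le _ _) _; rewrite geq_max; apply/andP.
    - by move=> i0 j0 x y; exact: msizeM_leW.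
    - by rewrite /gr msize1.
  rewrite coefXnM; case: ltnP => _; first by rewrite msize0.
  by apply: leq_trans (aX _ _) _; rewrite ltnS (leq_trans (leq_subr _ _)) // -ltnS ltn_ord.
move=> b; rewrite -(det_map_mx (meval b)) map_mxsub map_sys; set ab := map_poly (meval b) al => db.
have [mb sb] := ray_monic (ray b); set fb := map_poly (ray b) f in mb sb *.
have fbE : fb = map_poly (map_poly (meval b)) F.
  by rewrite /fb /F -map_poly_comp; apply: eq_map_poly => q; exact: rayE.
have ab0 : ab.[0] = al0.
  by rewrite /ab -(rmorph0 (meval b)) horner_map al_0 /= mevalC.
have fb0 : 'X^N %| fb.[ab].
  by apply/dvdpXn_coef => i iN; rewrite fbE /ab horner_map coef_map Fal //; exact: (rmorph0 (meval b)).
have spec0 : map_poly (horner_eval 0) fb = map_poly (meval x0) f.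
  rewrite /fb -map_poly_comp; apply: eq_map_poly => q; rewrite /= rayE /horner_eval.
  by rewrite -(rmorph0 (meval b)) horner_map cone0 /= mevalC.
apply: domainp_irreducible => //; first exact: gauss_poly.
have key (g1 h1 : {poly {poly K}}) : g1 \is monic -> h1 \is monic -> fb = g1 * h1 -> (1 < size h1)%N ->
    (map_poly (horner_eval 0) h1).[al0] != 0 -> False.
  move=> m1 m2 fE sh1 h10.
  have tg : tdeg_le (size g1).-1 g1.
    by apply: (tdeg_factor m1 m2); rewrite -fE sb; exact: tdeg_line.
  have sg : ((size g1).-1 <= k)%N.
    have : size fb = (size g1 + size h1).-1 by rewrite fE size_Mmonic // monic_neq0.
    by rewrite sb; move: sh1; move: (size g1) (size h1) => x y; clear; lia.
  have [v vE] := ofv_surj (tdeg_leW sg tg).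
  have cop : coprimep 'X^N h1.[ab].
    rewrite coprimep_expl // coprimep_sym coprimepX rootE.
    have -> : h1.[ab].[0] = (map_poly (horner_eval 0) h1).[ab.[0]].
      by rewrite -[LHS]/(horner_eval 0 h1.[ab]) -horner_map.
    by rewrite ab0.
  have gd : 'X^N %| g1.[ab].
    by rewrite -(Gauss_dvdpl _ cop) -hornerM -fE.
  have v0 : v *m colsub g (sys k N ab) = 0.
    rewrite mulmx_colsub; apply/matrixP => i j; rewrite ord1 [LHS]mxE [RHS]mxE -horner_ofv vE.
    by move/dvdpXn_coef: gd; apply.
  have vz : v = 0.
    by apply/eqP/negPn/negP => ne; case/negP: db; apply/det0P; exists v.
  by move: (monic_neq0 m1); rewrite -vE vz; rewrite /ofv big1 ?eqxx // => u _; rewrite mxE scale0r mul0r.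
move=> g1 h1 m1 m2 fE sg1 sh1.
have [h0|hn] := eqVneq (map_poly (horner_eval 0) h1).[al0] 0; last exact: key fE sh1 hn.
apply: (key h1 g1) => //; first by rewrite mulrC.
apply: contraNneq r1 => g0; rewrite -spec0 fE rmorphM /= derivM hornerD !hornerM g0 h0.
by rewrite mulr0 mul0r addr0.
Qed.

End Bertini.

(** * Counting points *)

Section StepanovChoice.
Local Open Scope nat_scope.

Lemma sum_staircase l m : m <= l.+1 -> 2 * \sum_(j < m) (l.+1 - j) = m * (2 * l + 3 - m).
Proof.
elim: m => [|m IH] ml; first by rewrite big_ord0.
by rewrite big_ord_recr mulnDr IH ?(ltnW ml) //=; nia.
Qed.

Lemma sqrt_floor p : exists l, 4 * (l * l) <= p /\ p < 4 * (l.+1 * l.+1).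
Proof.
have ex : exists l, 4 * (l * l) <= p by exists 0.
have bd l : 4 * (l * l) <= p -> l <= p by nia.
case: (ex_maxnP ex bd) => l lp mx; exists l; split=> //; rewrite ltnNge; apply/negP => /mx.
by rewrite ltnn.
Qed.

Lemma stepanov_parameters_nat k l m M p : 0 < k -> 16 * (k.+1 * k.+1) <= 7 * l.+1 -> 4 * (l * l) <= p ->
  p <= k.+1 * (m + k) -> M * (20 * k + 9) <= 20 * (1 + k.+1 * l) + (20 * k + 9) -> k < l.+1 ->
  2 * M * k * (m + l + 1 + M) < m * k.+1 * (2 * l + 2 - k).
Proof.
move=> k0 h1 h2 h3 h4 h5.
have := @stepanov_parameters (Z.of_nat k) (Z.of_nat l) (Z.of_nat m) (Z.of_nat M) (Z.of_nat p).
move/(_ ltac:(clear - k0; lia) ltac:(clear - h1; lia) ltac:(clear - h2; lia) ltac:(clear - h3; lia) ltac:(clear; lia) ltac:(clear - h4; lia)).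
by clear - h5; lia.
Qed.

(* With these parameters, of the about [(k + 1) p] points of a plane curve of degree [k + 1] with [t] in [F_p],
   Stepanov's method leaves at most [(k + 9 / 20) p] with [T] outside [F_p]. *)
Lemma stepanov_choice k p : 0 < k -> 21 * (k.+1 * k.+1 * (k.+1 * k.+1)) <= p -> exists m1 l M : nat,
  [/\ 0 < m1, 0 < M, k.+1 * (m1 + k).-1 < p,
      (let H := m1 + l in
       H * M * k.+1 * k.+1 < m1 * k.+1 * \sum_(j < k.+1) (l.+1 - j) + (H - (k + M * k)) * M * k.+1)
    & 20 * (k.+1 * ((m1 + k).-1 + l * p)) <= M * (p * (20 * k + 9))].
Proof.
move=> k0 kp; have [l [lp pl]] := sqrt_floor p.
(* The constant 21 enters here: [21 (k + 1) ^ 4 <= p < 4 (l + 1) ^ 2], and 4 times [16 ^ 2] is 1024,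
   just below 1029, which is 21 times [7 ^ 2]. *)
have l7 : 16 * (k.+1 * k.+1) <= 7 * l.+1.
  move: kp pl; set u := k.+1 * k.+1; clear; move=> kp pl; rewrite leqNgt; apply/negP => h.
  have h2 : (7 * l.+1) * (7 * l.+1) < (16 * u) * (16 * u) by rewrite ltn_mul.
  move: h2 (leq_ltn_trans kp pl) => {h kp pl}; move: l.+1 => x; move: u => v; rewrite -!mulnA (mulnCA x) (mulnCA v).
  by move: (x * x) (v * v) => a b; lia.
(* [m1] is the largest value with [k.+1 * (m1 + k).-1 < p], and [M] is the least integer with
   [M c > 20 (1 + (k + 1) l)], the size that the final estimate requires. *)
pose q := p.-1 %/ k.+1; pose m1 := q.+1 - k; pose c := 20 * k + 9.
pose M := (20 * (1 + k.+1 * l)) %/ c + 1.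
have p0 : 0 < p by apply: leq_trans kp.
have c0 : 0 < c by rewrite /c addn_gt0 orbT.
have qp : k.+1 * q <= p.-1 by rewrite mulnC leq_trunc_div.
have pq : p <= k.+1 * q.+1 by have := ltn_ceil p.-1 (ltn0Sn k); rewrite -/q mulnC; case: (p) p0.
have kq : k < q.+1.
  rewrite -(ltn_pmul2l (ltn0Sn k)); apply: leq_trans pq; apply: leq_trans kp.
  apply: (@leq_trans (k.+1 * k.+1)); first by rewrite ltn_pmul2l.
  by apply: leq_trans (leq_pmulr _ _) (leq_pmull _ _).
have m1k : m1 + k = q.+1 by rewrite /m1 subnK // ltnW.
have m10 : 0 < m1 by rewrite /m1 subn_gt0.
have Mc1 : M * c <= 20 * (1 + k.+1 * l) + c.
  by rewrite /M mulnDl mul1n leq_add2r leq_trunc_div.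
have Mc2 : 20 * (1 + k.+1 * l) <= M * c.
  by rewrite /M addn1 ltnW // ltn_ceil.
exists m1, l, M; split=> //.
- by rewrite /M addn1.
- by rewrite m1k /=; move: qp; case: (p) p0.
- have kl : k < l.+1 by move: l7 k0; clear; nia.
  have key : M * k * (m1 + l + 1 + M) < m1 * \sum_(j < k.+1) (l.+1 - j).
    have S2 := sum_staircase kl.
    have Z : 2 * M * k * (m1 + l + 1 + M) < m1 * k.+1 * (2 * l + 2 - k).
      by apply: (@stepanov_parameters_nat k l m1 M p) => //; rewrite m1k.
    rewrite (_ : 2 * l + 3 - k.+1 = 2 * l + 2 - k) in S2; last by lia.
    rewrite -(ltn_pmul2l (isT : 0 < 2)) (mulnCA 2 m1) S2 (mulnA m1).
    by move: Z; rewrite !mulnA.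
  move: key; move: (\sum_(_ < _) _) => S /=; set H := m1 + l; set t := H - _ => key.
  have ht : H <= t + (k + M * k) by rewrite /t; move: (k + M * k) => x; clear; lia.
  have h1 : H * M <= t * M + (k + M * k) * M by rewrite -mulnDl leq_mul.
  have h2 : H * M * k.+1 < m1 * S + t * M.
    by move: h1 key; clearbody t H; clear; lia.
  have := ltn_mul h2 (ltnSn k); rewrite -(ltn_pmul2r (ltn0Sn k)) in h2.
  by move: h2; rewrite mulnDl -!mulnA (mulnC k.+1 S) !mulnA => h2 _.
rewrite m1k /=.
have : 20 * (k.+1 * q + k.+1 * l * p) <= p * (M * c).
  apply: leq_trans (_ : p * (20 * (1 + k.+1 * l)) <= _); last by rewrite leq_mul2l Mc2 orbT.
  by move: qp p0; clear; nia.
by rewrite /c; clear; lia.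
Qed.

End StepanovChoice.

(** With [B = D ^ 3 k] and [E = 20 D (1 + D k)], at most a share [B / p] of the directions is bad
    and a good line has at least [(11 p - E) / 20] points. Since [E + 11 B <= p], the product
    [(p - B) (11 p - E)] is at least [10 p ^ 2], which leaves one half. *)
Lemma count_arith D k p g b P N : k.+1 = D -> (21 * (D * D * (D * D)) <= p -> g + b = P -> b * p <= D * D * (D * k) * P ->
  g * (11 * p) <= g * (20 * (D * (1 + D * k))) + 20 * (p.-1 * N) -> 0 < p -> P <= 2 * N)%N.
Proof.
move=> DE kp GB hb hG p0; set B := (D * D * (D * k))%N in hb; set E := (20 * (D * (1 + D * k)))%N in hG.
have EB : (E + 11 * B <= p)%N.
  apply: leq_trans kp; rewrite /E /B -DE; clear; nia.
have [x xE] : exists x, (x + E = 11 * p)%N by exists (11 * p - E)%N; move: EB; clear; lia.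
have [y yB] : exists y, (y + B = p)%N by exists (p - B)%N; move: EB; clear; lia.
clearbody E B; have h1 : (y * P <= g * p)%N by move: hb; rewrite -GB -yB; clear; lia.
have h2 : (g * x <= 20 * (p.-1 * N))%N by move: hG; rewrite -xE mulnDr addnC leq_add2l.
have h3 : (10 * (p * p) <= y * x)%N.
  have a1 : (y * x + y * E = 11 * (y * p))%N by rewrite -mulnDr xE mulnCA.
  have a2 : (y * p + B * p = p * p)%N by rewrite -mulnDl yB.
  have a3 : (y * E <= p * E)%N by rewrite leq_mul2r -yB leq_addr orbT.
  have a4 : (p * E + 11 * (B * p) <= p * p)%N by move: EB; rewrite -(leq_pmul2l p0) mulnDr; clear; lia.
  by move: a1 a2 a3 a4; clear; lia.
have h4 : (10 * (p * p) * P <= 20 * (p.-1 * N) * p)%N.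
  apply: leq_trans (leq_mul h3 (leqnn P)) _; rewrite mulnAC; apply: leq_trans (leq_mul h1 (leqnn x)) _.
  by rewrite mulnAC leq_mul2r h2 orbT.
have h5 : (p * P <= p * (2 * N))%N.
  have : (p * (10 * (p * P)) <= p * (20 * (p.-1 * N)))%N by move: h4; clear; lia.
  rewrite leq_pmul2l // => h; have : (p.-1 * N <= p * N)%N by rewrite leq_mul2r leq_pred orbT.
  by move: h; clear; lia.
by rewrite leq_pmul2l in h5.
Qed.

Section Count.
Variables (p : nat) (K : closedFieldType) (r k : nat) (f : {poly {mpoly K[r]}}).
Hypothesis chK : p \in [pchar K].
Variable e : {rmorphism 'F_p -> K}.
Local Notation S := {mpoly K[r]}.
Local Notation eM := (map_mx e).
Hypotheses (mf : f \is monic) (sf : size f = k.+2) (tf : tdm k.+1 f).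
Hypothesis df : domainp k f.
Hypothesis frobf : forall i m, (f`_i)@_m ^+ p = (f`_i)@_m.
Local Notation disc := (\det (mulmodmx k f f^`())).
Hypothesis disc0 : disc != 0.
Let pp : prime p := pcharf_prime chK.
Let ei : injective e := fmorph_inj e.

Definition model_set : {set 'rV['F_p]_r * 'F_p} :=
  [set ab : 'rV['F_p]_r * 'F_p | (evp f ((eM ab.1) 0) (e ab.2) == 0) && (disc.@[(eM ab.1) 0] != 0)].

Lemma tdeg_deriv (R : comNzRingType) D (g : {poly {poly R}}) : tdeg_le D.+1 g -> tdeg_le D g^`().
Proof. by move=> tg j i ij; rewrite coef_deriv coefMn tg ?mul0rn // addnS. Qed.

(** On the line through the origin whose direction is given by the variables themselves, total
    degree becomes degree in the parameter without loss, so the bound for norms on a plane curve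
    applies. *)
Lemma msize_disc : (msize disc <= (k.+1 * k).+1)%N.
Proof.
pose c : {rmorphism S -> {poly S}} := onto_line (@mpolyC r K) (fun i => 0) (fun i => 'X_i).
have [mF sF] := ray_monic mf sf c.
have tF : tdeg_le k.+1 (map_poly c f) by exact: (tdeg_line tf).
have sc : (size (c disc) <= (k.+1 * k).+1)%N.
  by rewrite det_map_mulmodmx // -deriv_map; apply: size_det_mulmodmx => //; exact: tdeg_deriv.
apply: leq_trans sc; have [s0|s0] := posnP (msize disc); first by rewrite s0.
rewrite -(prednK s0) ltnNge; apply/negP => le.
have := @coef_onto_line K S (@mpolyC r K) r (fun i => 0) (fun i => 'X_i) disc (msize disc).-1.
rewrite (prednK s0) leqnn => /(_ isT).
have z : (c disc)`_(msize disc).-1 = 0 by rewrite nth_default.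
move/(etrans (esym z))/esym; apply/eqP.
have -> : mmap (@mpolyC r K) (fun i => 'X_i) (pihomog mdeg (msize disc).-1 disc) = pihomog mdeg (msize disc).-1 disc.
  apply: (@rmorph_mpoly_eq K r S (msub (fun i => 'X_i)) idfun) => [x|i]; first exact: msubC.
  exact: msubX.
exact: pihomog_top_neq0.
Qed.

Lemma frob_ray (x b : 'rV['F_p]_r) (q : S) i : (forall m, q@_m ^+ p = q@_m) ->
  (ray ((eM x) 0) ((eM b) 0) q)`_i ^+ p = (ray ((eM x) 0) ((eM b) 0) q)`_i.
Proof.
pose F : {rmorphism K -> K} := pFrobenius_aut chK; set ry := ray _ _ => qF.
have qE : map_mpoly F q = q by apply/mpolyP => m; rewrite mcoeff_map_mpoly /= pFrobenius_autE qF.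
have E : map_poly F (ry q) = ry (map_mpoly F q).
  rewrite -[LHS]/((map_poly F \o ry) q) -[RHS]/((ry \o map_mpoly F) q).
  apply: rmorph_mpoly_eq => [c|j] /=.
    by rewrite map_mpolyC /ry /ray /= !onto_lineC map_polyC.
  rewrite map_mpolyX /ry /ray /= !onto_lineX rmorphD rmorphM /= !map_polyC /= map_polyX !pFrobenius_autE.
  by rewrite !mxE -!rmorphXn /= !Fp_exp.
by rewrite -{2}qE -E coef_map /= pFrobenius_autE.
Qed.

Lemma ray_eval (x b : 'rV['F_p]_r) (q : S) a :
  (ray ((eM x) 0) ((eM b) 0) q).[e a] = q.@[(eM (x + a *: b)) 0].
Proof.
rewrite -[LHS]/((horner_eval (e a) \o ray ((eM x) 0) ((eM b) 0)) q).
apply: rmorph_mpoly_eq => [c|j] /=.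
  by rewrite /ray /= onto_lineC mevalC /horner_eval hornerC.
by rewrite /ray /= onto_lineX mevalXU /horner_eval hornerD hornerM hornerX !hornerC !mxE rmorphD rmorphM mulrC.
Qed.

Lemma fixed_roots (rs : seq K) : uniq rs ->
  (size rs <= count (fun b => b ^+ p != b) rs + #|[set c : 'F_p | e c \in rs]|)%N.
Proof.
move=> urs; rewrite -(count_predC (fun b => b ^+ p != b)) leq_add2l -size_filter.
rewrite cardE -(size_map e); apply: uniq_leq_size; first exact: filter_uniq.
move=> z; rewrite mem_filter /= negbK => /andP[/eqP zp zr].
have [a az] := frob_fixed e pp zp.
by apply/mapP; exists a => //; rewrite mem_enum inE az.
Qed.

(** The base point [a = 0] is left out: for [a] nonzero, [a] and the point determine the direction,
    so that over all directions a point of the model is counted at most [p - 1] times. *)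
Definition line_set (x b : 'rV['F_p]_r) : {set 'F_p * 'F_p} :=
  [set ac : 'F_p * 'F_p | (ac.1 != 0) && ((x + ac.1 *: b, ac.2) \in model_set)].

(** All but at most [1 + (k + 1) k] values of [a] have [k + 1] points above them, and Stepanov's
    method allows at most [(k + 9/20) p] irrational ones; [k + 1] minus [k + 9/20] is 11/20. *)
Lemma line_count (x b : 'rV['F_p]_r) : (0 < k)%N -> (21 * (k.+1 * k.+1 * (k.+1 * k.+1)) <= p)%N ->
  disc.@[(eM x) 0] != 0 -> domainp k (map_poly (ray ((eM x) 0) ((eM b) 0)) f) ->
  (11 * p <= 20 * (k.+1 * (1 + k.+1 * k)) + 20 * #|line_set x b|)%N.
Proof.
move=> k0 kp dx; set ry := ray _ _; set fb := map_poly ry f => db.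
have [mb sb] : fb \is monic /\ size fb = k.+2 := ray_monic mf sf ry.
have tb : tdeg_le k.+1 fb by exact: (tdeg_line tf idfun).
have dE : \det (mulmodmx k fb fb^`()) = ry disc by rewrite det_map_mulmodmx // -deriv_map.
have rd0 : ry disc != 0.
  apply: contraNneq dx => E; rewrite -[x]addr0 -(scale0r b) -ray_eval -/ry E horner0 //.
have frb j i : fb`_j`_i ^+ p = fb`_j`_i by rewrite coef_map /=; apply: frob_ray => m; exact: frobf.
have [m1 [l [M [m10 M0 m1p hst hM]]]] := stepanov_choice k0 kp.
pose A := [set a : 'F_p | (a != 0) && ((ry disc).[e a] != 0)].
pose s := map e (enum A).
have us : uniq s by rewrite map_inj_uniq ?enum_uniq.
have sP a : a \in s -> a ^+ p = a /\ (\det (mulmodmx k fb fb^`())).[a] != 0.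
  by case/mapP => a'; rewrite mem_enum inE dE => /andP[_ ?] ->; rewrite -rmorphXn /= Fp_exp.
have := @stepanov K k fb p mb sb tb db chK frb.
rewrite dE => /(_ rd0 m1 l M s m10 m1p hst us); rewrite -dE => /(_ sP).
set NonF := \sum_(a <- s) _ => hN.
have fibE a : map_poly (horner_eval (e a)) fb = map_poly (meval ((eM (x + a *: b)) 0)) f.
  by rewrite /fb -map_poly_comp; apply: eq_map_poly => q; exact: ray_eval.
have rP a c : (e c \in rootseq (map_poly (horner_eval (e a)) fb)) = (evp f ((eM (x + a *: b)) 0) (e c) == 0).
  rewrite fibE rootseqP //; rewrite -size_poly_eq0.
  by have [_ ->] := ray_monic mf sf (meval ((eM (x + a *: b)) 0)).
have szA : (p <= #|A| + (1 + k.+1 * k))%N.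
  have cr := card_roots_le ei rd0.
  apply: leq_trans (_ : #|A| + #|~: A| <= _)%N; first by rewrite cardsC card_Fp.
  rewrite leq_add2l.
  have sd : (size (ry disc) <= (k.+1 * k).+1)%N.
    by rewrite -dE; apply: size_det_mulmodmx => //; exact: tdeg_deriv.
  have -> : ~: A = 0 |: [set a | root (ry disc) (e a)].
    by apply/setP => a; rewrite !inE negb_and !negbK.
  apply: leq_trans (leq_card_setU _ _) _; rewrite cards1 leq_add2l cardsE; apply: leq_trans cr _.
  by move: sd; case: (size _).
have tot : (k.+1 * #|A| <= NonF + #|line_set x b|)%N.
  have -> : #|line_set x b| = (\sum_(a in A) #|[set c : 'F_p | e c \in rootseq (map_poly (horner_eval (e a)) fb)]|)%N.
    rewrite -sum1_card (eq_bigl (fun ac : 'F_p * 'F_p => (ac.1 \in A) && (ac.2 \in [set c | e c \in rootseq (map_poly (horner_eval (e ac.1)) fb)]))).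
      by rewrite -(pair_big_dep (mem A) (fun a c => c \in [set c | e c \in rootseq (map_poly (horner_eval (e a)) fb)]) (fun _ _ => 1%N)); apply: eq_bigr => a _; rewrite sum1_card.
    by move=> [a c]; rewrite !inE /= ray_eval rP -andbA [X in _ && X]andbC.
  rewrite /NonF /s big_map big_enum /= -big_split /= mulnC -sum_nat_const; apply: leq_sum => a.
  rewrite inE => /andP[_ da]; have [|u1 <-] := separable_spec mb sb (phi := horner_eval (e a)).
    by rewrite dE.
  exact: fixed_roots.
have nf : (20 * NonF <= p * (20 * k + 9))%N.
  by rewrite -(leq_pmul2l M0) mulnCA; apply: leq_trans hM; rewrite leq_mul2l.
move: szA tot nf; clear hN; rewrite -(leq_pmul2l (ltn0Sn k)); move: NonF #|A| #|line_set x b| => a1 a2 a3; clear; lia.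
Qed.

Variable x0 : 'rV['F_p]_r.
Hypothesis dx0 : disc.@[(eM x0) 0] != 0.
Local Notation row b := (\row_i (b : {ffun 'I_r -> 'F_p}) i).

Lemma lines_cover : (\sum_(b : {ffun 'I_r -> 'F_p}) #|line_set x0 (row b)| <= p.-1 * #|model_set|)%N.
Proof.
pose T := [set t : {ffun 'I_r -> 'F_p} * ('F_p * 'F_p) | t.2 \in line_set x0 (row t.1)].
have -> : (\sum_(b : {ffun 'I_r -> 'F_p}) #|line_set x0 (row b)| = #|T|)%N.
  rewrite -sum1_card (eq_bigl (fun t : {ffun 'I_r -> 'F_p} * ('F_p * 'F_p) => xpredT t.1 && (t.2 \in line_set x0 (row t.1)))).
    rewrite -(pair_big_dep xpredT (fun b ac => ac \in line_set x0 (row b)) (fun _ _ => 1%N)).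
    by apply: eq_bigr => b _; rewrite sum1_card.
  by move=> t; rewrite inE.
pose g (t : {ffun 'I_r -> 'F_p} * ('F_p * 'F_p)) := (t.2.1, (x0 + t.2.1 *: row t.1, t.2.2)).
have gi : {in T &, injective g}.
  move=> [b [a c]] [b' [a' c']]; rewrite !inE /= => /andP[a0 _] _ [<- /addrI E <-]; congr (_, _).
  apply/ffunP => i; have /rowP/(_ i) := E; rewrite !mxE; exact: mulfI.
rewrite -(card_in_imset gi) -[p in p.-1](card_Fp pp) -(cardsC1 (0 : 'F_p)) -cardsX.
apply/subset_leq_card/subsetP => _ /imsetP[[b [a c]] tT ->]; move: tT; rewrite !inE /=.
by [].
Qed.

Lemma card_simplex_le : (#|{: simplex k k}| <= k.+1 * k.+1)%N.
Proof. by rewrite card_sig; apply: leq_trans (max_card _) _; rewrite card_prod !card_ord. Qed.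

Lemma model_count : (0 < k)%N -> (21 * (k.+1 * k.+1 * (k.+1 * k.+1)) <= p)%N ->
  (p ^ r <= 2 * #|model_set|)%N.
Proof.
move=> k0 kp; have kE : (k.+1 < #|'F_p|)%N.
  rewrite card_Fp //; apply: leq_trans kp; move: k0; clear; nia.
have [de [de0 sde deP]] := bertini mf sf tf df dx0 ei kE.
have := schwartz_zippel ei de0; rewrite card_Fp // => hbad; set bad := #|_| in hbad.
pose G := [pred b : {ffun 'I_r -> 'F_p} | de.@[fun i => e (b i)] != 0].
have GB : (#|G| + bad = p ^ r)%N.
  have cf : #|{ffun 'I_r -> 'F_p}| = (p ^ r)%N by rewrite card_ffun [#|'I_r|]card_ord card_Fp.
  rewrite addnC -cf -(cardC [pred v : {ffun 'I_r -> 'F_p} | de.@[fun i => e (v i)] == 0]).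
  by apply: (f_equal2 addn); apply: eq_card => v; rewrite !inE.
have hb : (bad * p <= k.+1 * k.+1 * (k.+1 * k) * p ^ r)%N.
  apply: leq_trans hbad _; rewrite leq_mul2r; apply/orP; right.
  apply: leq_trans (leq_mul card_simplex_le (leqnn (k.+1 * k))); move: sde; case: (msize de) => //.
have hG : (#|G| * (11 * p) <= #|G| * (20 * (k.+1 * (1 + k.+1 * k))) + 20 * (p.-1 * #|model_set|))%N.
  apply: leq_trans (leq_add (leqnn _) (leq_mul (leqnn 20) lines_cover)).
  rewrite -!sum_nat_const; apply: leq_trans (_ : \sum_(b in G) (20 * (k.+1 * (1 + k.+1 * k)) + 20 * #|line_set x0 (row b)|) <= _)%N.
    apply: leq_sum => b bG; apply: line_count => //.
    move: (bG); rewrite inE => /deP; rewrite (_ : (fun i => e (b i)) = (eM (row b)) 0) //.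
    by apply: boolp.funext => i; rewrite !mxE.
  rewrite big_split leq_add2l big_distrr /= [X in (_ <= X)%N](bigID (mem G)) /=; exact: leq_addr.
exact: (count_arith (erefl k.+1) kp GB hb hG (prime_gt0 pp)).
Qed.

(** In degree one the model is the graph of minus the constant coefficient of [f], and its
    discriminant is 1. *)
Lemma model_count1 : k = 0%N -> (p ^ r <= #|model_set|)%N.
Proof.
move=> k0; have <- : #|{: 'rV['F_p]_r}| = (p ^ r)%N by rewrite card_mx mul1n card_Fp.
have l1 : f`_1 = 1 by have := monicP mf; rewrite /lead_coef sf k0.
have f1 : f^`() = 1.
  apply/polyP => i; rewrite coef_deriv coef1; case: i => [|i] /=; first by rewrite l1.
  by rewrite nth_default ?mul0rn // sf k0.
have d1 : disc = 1.
  by rewrite f1 -polyC1 (mulmodmxC mf sf) det1.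
have /fin_all_exists[c cP] : forall a : 'rV['F_p]_r, exists c : 'F_p, e c = (f`_0).@[(eM a) 0].
  move=> a; apply: (frob_fixed e pp).
  rewrite -[a]addr0 -(scale0r 0) -ray_eval rmorph0 horner_coef0 frob_ray //.
pose g (a : 'rV['F_p]_r) := (a, - c a).
have gi : injective g by move=> a b [].
rewrite -(card_imset _ gi); apply/subset_leq_card/subsetP => _ /imsetP[a _ ->].
rewrite inE d1 /= meval1 oner_eq0 andbT /evp (@horner_coef_wide _ 2); last first.
  by apply: leq_trans (size_poly _ _) _; rewrite sf k0.
by rewrite !big_ord_recl big_ord0 !coef_map /= l1 meval1 mul1r expr1 expr0 mulr1 addr0 rmorphN cP subrr.
Qed.

End Count.

(** * Invariance under a shift, and the count on the variety *)

Section Shift.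
Variables (p : nat) (K : closedFieldType) (n : nat).
Hypothesis chK : p \in [pchar K].
Variable e : {rmorphism 'F_p -> K}.
Hypothesis eE : e =1 @embFp p K.
Let pp : prime p := pcharf_prime chK.

Lemma variety_frobenius (S : seq (Defs.mpoly 'F_p n)) (x : 'rV[K]_n) :
  variety S x <-> variety S (map_mx (fun a => a ^+ p) x).
Proof.
suff E : variety S (map_mx (fun a => a ^+ p) x) = variety S x by rewrite E.
apply: eq_all => P; have -> : Defs.meval (@embFp p K) P (map_mx (fun a => a ^+ p) x) = Defs.meval (@embFp p K) P x ^+ p.
  rewrite -(pFrobenius_autE chK) /Defs.meval rmorph_sum; apply: eq_bigr => m _.
  rewrite rmorphM rmorph_prod /= pFrobenius_autE -eE -[e _ ^+ p]rmorphXn /= Fp_exp //; congr (_ * _).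
  by apply: eq_bigr => i _; rewrite !mxE pFrobenius_autE exprAC.
by rewrite expf_eq0 prime_gt0.
Qed.

Lemma embvE (a : 'rV['F_p]_n) : embv K a = map_mx e a.
Proof. by apply/rowP => i; rewrite !mxE eE. Qed.

Lemma Delta_ge (U : {set 'rV['F_p]_n}) (S : seq (Defs.mpoly 'F_p n)) :
  ~ shift_free (fun x : 'rV[K]_n => variety S x) (setDiff U) -> (#|Fp_points K S| <= Delta_count K S U)%N.
Proof.
move=> nsf; have [u [uU u0 uX]] : exists u, [/\ u \in setDiff U, u != 0 &
    forall x : 'rV[K]_n, variety S x <-> shiftv (fun x : 'rV[K]_n => variety S x) (embv K u) x].
  by apply: NNPP => no; apply: nsf => u uU u0 uX; apply: no; exists u.
move: uU; rewrite /setDiff => /imset2P[v w vU wU uE].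
have shift a : a \in Fp_points K S -> a + u \in Fp_points K S.
  rewrite !inE => Xa; apply/uX; exists (embv K a); split=> //.
  by rewrite !embvE map_mxD.
have vw : w != v by apply: contraNneq u0 => E; rewrite uE E subrr.
rewrite /Delta_count; set Xp := Fp_points K S in shift *.
have sub : [set a + t | a in Xp, t in U] \subset [set a + t | a in Xp, t in U :\ v].
  apply/subsetP => _ /imset2P[a t aX tU ->]; have [->|ne] := eqVneq t v.
    apply/imset2P; exists (a + u) w; [exact: shift|by rewrite !inE vw|].
    by rewrite uE -addrA subrK.
  by apply/imset2P; exists a t; rewrite // !inE ne.
have le : (#|[set (a + t)%R | a in Xp, t in U]| <= #|Xp| * #|U :\ v|)%N.
  apply: leq_trans (subset_leq_card sub) _; rewrite curry_imset2X -cardsX.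
  exact: leq_imset_card.
have := cardsD1 v U; rewrite vU add1n => cU.
have arith (a b x : nat) : (x <= b -> a <= a + b - x)%N by clear; lia.
by rewrite cU mulnS; exact: arith.
Qed.

End Shift.

Lemma card_points_ge (p : nat) (K : closedFieldType) (n r d : nat) (S : seq (Defs.mpoly 'F_p n)) :
  p \in [pchar K] -> (0 < d)%N -> (10 * (d * d * (d * d)) <= p)%N ->
  ((1 < d)%N -> (21 * (d * d * (d * d)) <= p)%N) ->
  abs_irreducible (fun x : 'rV[K]_n => variety S x) ->
  var_dim (fun x : 'rV[K]_n => variety S x) r ->
  var_deg (fun x : 'rV[K]_n => variety S x) r d -> (p ^ r <= 2 * #|Fp_points K S|)%N.
Proof.
move=> chK d0 p10 p21 irr dim deg; have pp := pcharf_prime chK.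
have [L [H [s [XH bs]]]] := dim_basis irr dim.
have [e eE] := embFp_rmorph chK.
(* This is the size needed to separate [k + 2 <= d + 1] pairs by a rational form in
   [fibre_unique]. *)
have dp : (d.+1 * d.+1 + 1 < p)%N by apply: leq_trans p10; move: d0; clear; nia.
have [k [A [y [f [bA mf fm sf mx]]]]] := best_model chK e XH deg dp bs.
have kd := degree_bound chK XH deg bA mf.
have [_ _ tf _] := mf.
have df := model_domainp bA mf fm sf.
have dn0 := model_discr chK XH deg dp bA mf fm sf.
have fro := model_frobenius chK XH bA mf fm sf (@variety_frobenius p K n chK e eE S).
have pts := model_points chK XH deg dp bA mf fm sf mx (@variety_frobenius p K n chK e eE S).
have ei : injective e by exact: fmorph_inj.
have kp : (k.+1 * k < p)%N by apply: leq_ltn_trans dp; rewrite addn1 ltnW // ltnS leq_mul // ltnW // ltnW.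
have [|v vn] := exists_nonroot ei dn0.
  rewrite card_Fp //; apply: leq_ltn_trans kp.
  by rewrite -subn1 leq_subLR add1n; exact: (msize_disc fm sf tf).
pose x0 : 'rV['F_p]_r := \row_i v i.
have x0E : (map_mx e x0) 0 = (fun i => e (v i)) by apply: boolp.funext => i; rewrite !mxE.
have N2 : (p ^ r <= 2 * #|@model_set p K r k f e|)%N.
  have [k0|k0] := posnP k.
    by apply: leq_trans (model_count1 chK e fm sf fro k0) _; rewrite leq_pmull.
  apply: (@model_count p K r k f chK e fm sf tf df fro x0) => //; first by rewrite x0E.
  have d1 : (1 < d)%N by apply: leq_trans kd.
  by apply: leq_trans (p21 d1); rewrite leq_mul2l /= !leq_mul.
apply: leq_trans N2 _; rewrite leq_mul2l /=; apply: leq_trans pts _.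
apply/subset_leq_card/subsetP => a; rewrite !inE => /boolp.asboolP.
by rewrite -embvE.
Qed.

End PointCount.

Import RealEstimates PointCount.

Theorem theorem4p3 (p : nat) (K : closedFieldType) (n r d : nat)
    (U : {set 'rV['F_p]_n}) (S : seq (mpoly 'F_p n)) :
  prime p ->
  p \in [pchar K]%R ->
  (* K is algebraic over F_p, hence an algebraic closure of F_p *)
  (forall x : K, exists k, (0 < k)%N /\ (x ^+ (p ^ k) = x)%R) ->
  (1 <= d)%N -> (d < p)%N ->
  U != set0 -> shift0_closed U ->
  abs_irreducible (fun x : 'rV[K]_n => variety S x) ->
  var_dim (fun x : 'rV[K]_n => variety S x) r ->
  var_deg (fun x : 'rV[K]_n => variety S x) r d ->
  ~ shift_free (fun x : 'rV[K]_n => variety S x) (setDiff U) ->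
  Rle (Rmult (INR 4) (Rsqr (alpha_bound p d #|setDiff U|))) (INR p) ->
  Rle (Rdiv (INR (p ^ r)) (INR 2)) (INR (Delta_count K S U)).
Proof.
move=> pp chK _ d0 _ _ _ irr dim deg nsf hp.
have [|p10 p21] := @alpha_bound_large p d #|setDiff U| (prime_gt0 pp) d0.
  by rewrite -[IZR 4](INR_IZR_INZ 4).
have [e eE] := embFp_rmorph chK.
have le : (p ^ r <= 2 * Delta_count K S U)%N.
  apply: leq_trans (card_points_ge chK d0 p10 p21 irr dim deg) _.
  by rewrite leq_mul2l /=; exact: (Delta_ge eE nsf).
have := le_INR _ _ (elimT leP le); rewrite mult_INR.
by move=> h; apply: (Rmult_le_reg_l (INR 2)); [simpl; lra|]; simpl in *; lra.
Qed.
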